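(* Let $s=\sigma+i\tau$ with $0\le\sigma\le2$ and $\tau>0$, and let $0<\delta\le0.05$. Then the equation $$x-\max\!\left(\tfrac{1-\sigma}{2},0\right)\ln\!\left(\tfrac12+x+\tau\right)=\ln\frac{8}{\delta}$$ in the real unknown $x$ has a unique solution $x_0$ (and $x_0>5$). Put $v=\lceil x_0\rceil$, $$N=1.11\left(1+\frac{\frac12+\tau}{v}\right)^{1/2},\qquad M=\lceil N\rceil,\qquad \lambda=3.151,$$ and $$D(N,s)=\sum_{n=1}^{\lceil\lambda vN\rceil}n^{-s}Q\!\left(v,\tfrac{n}{N}\right),\qquad E_1(M,s)=(2\pi)^{s-1}\Gamma(1-s)e^{i\frac{\pi}{2}(1-s)}\sum_{m=1}^{M}E_1(m,s),$$ where $E_{1}(m,s)=m^{s-1}-\sum_{w=0}^{v-1}\binom{s-1}{w}\left(m+\frac{i}{2\pi N}\right)^{s-1-w}\left(\frac{-i}{2\pi N}\right)^{w}$. Then $$\left|\zeta(s)-\Big(D(N,s)+E_1(M,s)-\frac{\Gamma(1-s+v)}{(1-s)\Gamma(v)}N^{1-s}\Big)\right|<\delta .$$ Moreover, if in addition $\tau>\frac53\left(\frac32+\ln\frac8\delta\right)$, then the total number of summands $\lceil\lambda vN\rceil+(v+1)M$ used to compute $D(N,s)$ and $E_1(M,s)$ (each $E_1(m,s)$ counting as $v+1$ summands) is at most $$S=2+8\sqrt{1+\ln\frac8\delta+\max\!\left(\tfrac{1-\sigma}{2},0\right)\ln(2\tau)}\;\sqrt{\tau}.$$ For $\tau=0$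 (i.e. real $s\in[0,2]$, $s\neq1$), with $v,N,\lambda$ chosen in the same way, the same accuracy estimate holds with the term $E_1(M,s)$ omitted altogether: $\left|\zeta(s)-D(N,s)+\frac{\Gamma(1-s+v)}{(1-s)\Gamma(v)}N^{1-s}\right|<\delta$.
   Context: $\zeta$ is the Riemann zeta function, $\Gamma$ the gamma function, $\lceil x\rceil$ the smallest integer $\ge x$. $Q(v,m)=\sum_{w=0}^{v-1}\frac{m^{w}}{w!}e^{-m}$ is the normalized incomplete gamma function. $\binom{s-1}{w}=\frac{(s-1)(s-2)\cdots(s-w)}{w!}$ is the generalized binomial coefficient. Complex powers use the principal branch of the logarithm.
   Formalization: The solution x_0 is claimed unique only among x>0: for σ<1 the left side tends to +∞ as x decreases to −1/2−τ, so the equation has a second, negative root and uniqueness over all real x fails. *)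

(* Defs.v *)
From Stdlib Require Import Reals Lra ZArith ClassicalEpsilon.
Open Scope R_scope.

Definition Cplx : Type := (R * R)%type.
Definition RtoC (x : R) : Cplx := (x, 0).
Definition Ci : Cplx := (0, 1).
Definition Cadd (z w : Cplx) : Cplx := (fst z + fst w, snd z + snd w).
Definition Copp (z : Cplx) : Cplx := (- fst z, - snd z).
Definition Csub (z w : Cplx) : Cplx := Cadd z (Copp w).
Definition Cmul (z w : Cplx) : Cplx :=
  (fst z * fst w - snd z * snd w, fst z * snd w + snd z * fst w).
Definition Cinv (z : Cplx) : Cplx :=
  let d := fst z * fst z + snd z * snd z in (fst z / d, - snd z / d).
Definition Cdiv (z w : Cplx) : Cplx := Cmul z (Cinv w).
Definition Cnorm (z : Cplx) : R := sqrt (fst z * fst z + snd z * snd z).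

Definition Cexp (z : Cplx) : Cplx := (exp (fst z) * cos (snd z), exp (fst z) * sin (snd z)).

Definition Carg (z : Cplx) : R :=
  let x := fst z in let y := snd z in
  if Rlt_dec 0 x then atan (y / x)
  else if Rlt_dec x 0 then
    (if Rle_dec 0 y then atan (y / x) + PI else atan (y / x) - PI)
  else if Rlt_dec 0 y then PI / 2
  else if Rlt_dec y 0 then - (PI / 2)
  else 0.

Definition Clog (z : Cplx) : Cplx := (ln (Cnorm z), Carg z).
Definition Cpow (z w : Cplx) : Cplx :=
  if Req_EM_T (Cnorm z) 0 then (0, 0) else Cexp (Cmul w (Clog z)).

Fixpoint Cpown (z : Cplx) (n : nat) : Cplx :=
  match n with O => (1, 0) | S k => Cmul z (Cpown z k) end.

Fixpoint Csum (f : nat -> Cplx) (n : nat) : Cplx :=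
  match n with O => (0, 0) | S k => Cadd (Csum f k) (f k) end.
Fixpoint Cprod (f : nat -> Cplx) (n : nat) : Cplx :=
  match n with O => (1, 0) | S k => Cmul (Cprod f k) (f k) end.
Fixpoint Rsum (f : nat -> R) (n : nat) : R :=
  match n with O => 0 | S k => Rsum f k + f k end.

Definition C_cv (u : nat -> Cplx) (l : Cplx) : Prop :=
  forall eps : R, eps > 0 -> exists N : nat, forall n : nat, (n >= N)%nat ->
    Cnorm (Csub (u n) l) < eps.
Definition Clim (u : nat -> Cplx) : Cplx :=
  epsilon (inhabits (0, 0)) (fun l => C_cv u l).

(** Gamma function via the Euler–Gauss limit formula
    Gamma(z) = lim n^z n! / (z (z+1) ... (z+n)),  z not in {0,-1,-2,...} *)
Definition Cgamma (z : Cplx) : Cplx :=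
  Clim (fun n => Cdiv (Cmul (Cpow (RtoC (INR n)) z) (RtoC (INR (fact n))))
                      (Cprod (fun k => Cadd z (RtoC (INR k))) (S n))).

(** Riemann zeta function on Re s > -1, s <> 1 (analytic continuation):
    zeta(s) = lim_N ( sum_{n=1}^N n^{-s} - N^{1-s}/(1-s) - N^{-s}/2 ). *)
Definition zeta (s : Cplx) : Cplx :=
  Clim (fun N =>
    Csub (Csub (Csum (fun k => Cpow (RtoC (INR (S k))) (Copp s)) N)
               (Cdiv (Cpow (RtoC (INR N)) (Csub (RtoC 1) s)) (Csub (RtoC 1) s)))
         (Cmul (RtoC (/ 2)) (Cpow (RtoC (INR N)) (Copp s)))).

Definition Rceil (x : R) : Z := (1 - up (- x))%Z.

(** normalized incomplete gamma Q(v,m) = sum_{w=0}^{v-1} m^w/w! e^{-m} *)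
Definition Qinc (v : nat) (m : R) : R :=
  Rsum (fun w => m ^ w / INR (fact w) * exp (- m)) v.

Definition Cbinom (z : Cplx) (w : nat) : Cplx :=
  Cdiv (Cprod (fun j => Csub z (RtoC (INR j))) w) (RtoC (INR (fact w))).

Definition Dsum (s : Cplx) (v : nat) (N : R) (K : nat) : Cplx :=
  Csum (fun k => Cmul (Cpow (RtoC (INR (S k))) (Copp s))
                      (RtoC (Qinc v (INR (S k) / N)))) K.

Definition E1m (s : Cplx) (v : nat) (N : R) (m : nat) : Cplx :=
  let s1 := Csub s (RtoC 1) in
  let a := (0, 1 / (2 * PI * N)) in
  Csub (Cpow (RtoC (INR m)) s1)
       (Csum (fun w => Cmul (Cmul (Cbinom s1 w)
                                  (Cpow (Cadd (RtoC (INR m)) a) (Csub s1 (RtoC (INR w)))))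
                            (Cpown (Copp a) w)) v).

Definition E1M (s : Cplx) (v : nat) (N : R) (M : nat) : Cplx :=
  let s1 := Csub (RtoC 1) s in
  Cmul (Cmul (Cmul (Cpow (RtoC (2 * PI)) (Copp s1)) (Cgamma s1))
             (Cexp (Cmul (0, PI / 2) s1)))
       (Csum (fun k => E1m s v N (S k)) M).

Definition Gterm (s : Cplx) (v : nat) (N : R) : Cplx :=
  let s1 := Csub (RtoC 1) s in
  Cmul (Cdiv (Cgamma (Cadd s1 (RtoC (INR v))))
             (Cmul s1 (Cgamma (RtoC (INR v)))))
       (Cpow (RtoC N) s1).

(* Main.v *)
From Stdlib Require Import Reals ZArith Lra Lia ClassicalEpsilon.
From Stdlib Require Ranalysis5.
From Coquelicot Require Import Rcomplements Hierarchy Continuity Derive AutoDerive.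
Require Import Defs.
Open Scope R_scope.

(** Put z = v + 1 - s and t = 1/N, and regard D, E_1 and the Gamma term as functions of t.
    Their derivatives are -t^(v-1)/Gamma(v) sum_n n^(z-1) e^(-nt), t^(v-1)/Gamma(v) Gamma(z)
    sum_(m<=M) (t - 2 pi i m)^(-z) and -t^(v-1)/Gamma(v) Gamma(z) t^(-z).  Lipschitz' formula
    sum_n n^(z-1) e^(-nt) = Gamma(z) sum_(k in Z) (t + 2 pi i k)^(-z) cancels everything but the
    terms k > 0 and k < -M, so D + E_1 - Gamma term changes little between t = 0, where it tends
    to zeta(s) by the trapezoidal rule, and t = 1/N.  The size of the remaining terms is
    controlled by |Gamma(b - i tau)| e^(pi tau/2), which the Gauss product bounds by comparing
    the sum of the convex function ln(1 + tau^2/u^2)/2 with its integral. *)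

(** * Complex arithmetic and principal powers *)

(** [zeta] and [Cgamma] are given as limits of explicit sequences, so the argument runs on functions
    of one real variable: a mean value inequality ([mvt_cmp]) plays the part of integration, and
    limits pass through sums by dominated convergence. The series behind D is never differentiated
    as a whole; its partial sums are, with an error that vanishes as they grow. The terms k > 0 can
    be left uncompensated because the argument of t + 2 pi i k is then positive and its power
    carries no factor e^(pi tau/2). Every remainder is measured in X = e^(-v) (1/2 + v + tau)^c with
    c = max((1-sigma)/2, 0); the equation for x_0 says that X = delta/8 at v = x_0, and rounding up
    only decreases X. The factor 1.11 in N is chosen so that 2 pi 1.11^2 >= e^2, which brings the
    omitted terms k < -M down to the size of X; lambda = 3.151 satisfies lambda - ln lambda >= 2,
    which does the same for the truncation of D. The three remainders are at most 2.5 X, 1.25 X and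
    0.6 X, together 4.35 X < 8 X. *)

Notation C0 := (RtoC 0).
Notation C1 := (RtoC 1).

Lemma Ceq (z w : Cplx) : fst z = fst w -> snd z = snd w -> z = w.
Proof. destruct z, w; simpl; intros; subst; reflexivity. Qed.

Lemma Cplx_ring : ring_theory C0 C1 Cadd Cmul Csub Copp (@eq Cplx).
Proof.
  constructor; intros; apply Ceq;
    unfold Csub, Cadd, Cmul, Copp, RtoC; simpl; ring.
Qed.

Lemma sqr_sum_neq0 (z : Cplx) : z <> C0 -> fst z * fst z + snd z * snd z <> 0.
Proof.
  intros Hz H; apply Hz; destruct z as [x y]; simpl in *.
  unfold RtoC; f_equal; nra.
Qed.

Lemma Cplx_field : field_theory C0 C1 Cadd Cmul Csub Copp Cdiv Cinv (@eq Cplx).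
Proof.
  constructor.
  - exact Cplx_ring.
  - intros H; injection H; lra.
  - reflexivity.
  - intros z Hz; apply sqr_sum_neq0 in Hz.
    apply Ceq; unfold Cinv, Cmul, RtoC; simpl; field; exact Hz.
Qed.

Add Field Cplx_field_inst : Cplx_field.

Lemma RtoC_add x y : RtoC (x + y) = Cadd (RtoC x) (RtoC y).
Proof. apply Ceq; unfold RtoC, Cadd; simpl; ring. Qed.
Lemma RtoC_mul x y : RtoC (x * y) = Cmul (RtoC x) (RtoC y).
Proof. apply Ceq; unfold RtoC, Cmul; simpl; ring. Qed.
Lemma RtoC_opp x : RtoC (- x) = Copp (RtoC x).
Proof. apply Ceq; unfold RtoC, Copp; simpl; ring. Qed.
Lemma RtoC_sub x y : RtoC (x - y) = Csub (RtoC x) (RtoC y).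
Proof. apply Ceq; unfold RtoC, Csub, Cadd, Copp; simpl; ring. Qed.
Lemma RtoC_neq0 x : x <> 0 -> RtoC x <> C0.
Proof. intros H E; apply H; injection E; auto. Qed.
Lemma RtoC_inv x : x <> 0 -> RtoC (/ x) = Cinv (RtoC x).
Proof. intros H; apply Ceq; unfold RtoC, Cinv; simpl; field; lra. Qed.
Lemma RtoC_div x y : y <> 0 -> RtoC (x / y) = Cdiv (RtoC x) (RtoC y).
Proof. intros H; unfold Rdiv; rewrite RtoC_mul, RtoC_inv by exact H; reflexivity. Qed.
Lemma RtoC_S n : RtoC (INR (S n)) = Cadd (RtoC (INR n)) C1.
Proof. rewrite S_INR, RtoC_add; reflexivity. Qed.

Lemma Cnorm_ge0 z : 0 <= Cnorm z.
Proof. apply sqrt_pos. Qed.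

Lemma Cnorm_sqr z : Cnorm z * Cnorm z = fst z * fst z + snd z * snd z.
Proof. apply sqrt_sqrt; nra. Qed.

Lemma Cnorm_0 : Cnorm C0 = 0.
Proof. unfold Cnorm, RtoC; simpl; rewrite Rmult_0_l, Rplus_0_l; apply sqrt_0. Qed.

Lemma Cnorm_eq0 z : Cnorm z = 0 -> z = C0.
Proof.
  intros H; pose proof (Cnorm_sqr z) as E; rewrite H in E.
  destruct z; unfold RtoC; simpl in *; f_equal; nra.
Qed.

Lemma Cnorm_gt0 z : z <> C0 -> 0 < Cnorm z.
Proof.
  intros H; destruct (Cnorm_ge0 z) as [h | h]; [exact h |].
  exfalso; apply H, Cnorm_eq0; auto.
Qed.

Lemma neq0_Cnorm z : 0 < Cnorm z -> z <> C0.
Proof. intros H E; rewrite E, Cnorm_0 in H; lra. Qed.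

Lemma Cnorm_unique z r : 0 <= r -> r * r = fst z * fst z + snd z * snd z -> Cnorm z = r.
Proof. intros Hr E; unfold Cnorm; rewrite <- E; apply sqrt_square, Hr. Qed.

Lemma Cnorm_mul z w : Cnorm (Cmul z w) = Cnorm z * Cnorm w.
Proof.
  apply Cnorm_unique.
  - apply Rmult_le_pos; apply Cnorm_ge0.
  - replace (Cnorm z * Cnorm w * (Cnorm z * Cnorm w))
      with ((Cnorm z * Cnorm z) * (Cnorm w * Cnorm w)) by ring.
    rewrite !Cnorm_sqr; unfold Cmul; simpl; ring.
Qed.

Lemma Cnorm_opp z : Cnorm (Copp z) = Cnorm z.
Proof. unfold Cnorm, Copp; simpl; f_equal; ring. Qed.

Lemma Cnorm_sub_sym z w : Cnorm (Csub z w) = Cnorm (Csub w z).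
Proof. rewrite <- Cnorm_opp; f_equal; ring. Qed.

Lemma Cnorm_RtoC x : Cnorm (RtoC x) = Rabs x.
Proof.
  apply Cnorm_unique; [apply Rabs_pos |].
  rewrite <- Rabs_mult, Rabs_pos_eq by nra; unfold RtoC; simpl; ring.
Qed.

Lemma Cnorm_1 : Cnorm C1 = 1.
Proof. rewrite Cnorm_RtoC; apply Rabs_R1. Qed.

Lemma Cnorm_inv z : z <> C0 -> Cnorm (Cinv z) = / Cnorm z.
Proof.
  intros Hz; pose proof (Cnorm_gt0 z Hz) as Hp.
  assert (E : Cnorm (Cmul (Cinv z) z) = 1).
  { replace (Cmul (Cinv z) z) with C1 by (field; exact Hz); apply Cnorm_1. }
  rewrite Cnorm_mul in E.
  apply (Rmult_eq_reg_r (Cnorm z)); [| lra]; rewrite E; field; lra.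
Qed.

Lemma Cnorm_div z w : w <> C0 -> Cnorm (Cdiv z w) = Cnorm z / Cnorm w.
Proof. intros H; unfold Cdiv, Rdiv; rewrite Cnorm_mul, Cnorm_inv by exact H; reflexivity. Qed.

(** Cauchy-Schwarz in the plane: by Lagrange's identity the difference of the squares is the square
    of the cross product. It yields the triangle inequality, and the projection argument in
    [mvt_cmp]. *)
Lemma Cdot_le z w : fst z * fst w + snd z * snd w <= Cnorm z * Cnorm w.
Proof.
  apply Rsqr_incr_0_var; [| apply Rmult_le_pos; apply Cnorm_ge0].
  unfold Rsqr.
  replace (Cnorm z * Cnorm w * (Cnorm z * Cnorm w))
    with ((Cnorm z * Cnorm z) * (Cnorm w * Cnorm w)) by ring.
  rewrite !Cnorm_sqr.
  pose proof (Rle_0_sqr (fst z * snd w - snd z * fst w)); unfold Rsqr in *; nra.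
Qed.

Lemma Cnorm_add z w : Cnorm (Cadd z w) <= Cnorm z + Cnorm w.
Proof.
  apply Rsqr_incr_0_var;
    [| pose proof (Cnorm_ge0 z); pose proof (Cnorm_ge0 w); lra].
  unfold Rsqr; rewrite Cnorm_sqr.
  pose proof (Cnorm_sqr z); pose proof (Cnorm_sqr w); pose proof (Cdot_le z w).
  unfold Cadd; simpl; nra.
Qed.

Lemma Cnorm_sub z w : Cnorm (Csub z w) <= Cnorm z + Cnorm w.
Proof. rewrite <- (Cnorm_opp w); apply Cnorm_add. Qed.

Lemma Cnorm_sub3 x y z : Cnorm (Csub x z) <= Cnorm (Csub x y) + Cnorm (Csub y z).
Proof. replace (Csub x z) with (Cadd (Csub x y) (Csub y z)) by ring; apply Cnorm_add. Qed.

Lemma Cnorm_le_sub z w : Cnorm z <= Cnorm w + Cnorm (Csub z w).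
Proof. replace z with (Cadd w (Csub z w)) at 1 by ring; apply Cnorm_add. Qed.

Lemma fst_le_Cnorm z : Rabs (fst z) <= Cnorm z.
Proof.
  rewrite <- sqrt_Rsqr_abs; apply sqrt_le_1_alt; unfold Rsqr; nra.
Qed.

Lemma snd_le_Cnorm z : Rabs (snd z) <= Cnorm z.
Proof.
  rewrite <- sqrt_Rsqr_abs; apply sqrt_le_1_alt; unfold Rsqr; nra.
Qed.

Lemma Cnorm_le_abs z : Cnorm z <= Rabs (fst z) + Rabs (snd z).
Proof.
  replace z with (Cadd (RtoC (fst z)) (Cmul Ci (RtoC (snd z)))) at 1
    by (apply Ceq; unfold Cadd, Cmul, RtoC, Ci; simpl; ring).
  eapply Rle_trans; [apply Cnorm_add |].
  rewrite Cnorm_mul, !Cnorm_RtoC.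
  replace (Cnorm Ci) with 1; [lra |].
  symmetry; apply Cnorm_unique; unfold Ci; simpl; lra.
Qed.

Lemma fst_gt0_neq0 z : 0 < fst z -> z <> C0.
Proof. intros H E; rewrite E in H; unfold RtoC in H; simpl in H; lra. Qed.

Lemma Cexp_add z w : Cexp (Cadd z w) = Cmul (Cexp z) (Cexp w).
Proof.
  apply Ceq; unfold Cexp, Cadd, Cmul; simpl;
    rewrite exp_plus, ?cos_plus, ?sin_plus; ring.
Qed.

Lemma Cnorm_exp z : Cnorm (Cexp z) = exp (fst z).
Proof.
  apply Cnorm_unique; [left; apply exp_pos |].
  unfold Cexp; simpl.
  pose proof (sin2_cos2 (snd z)) as H; unfold Rsqr in H.
  transitivity (exp (fst z) * exp (fst z) * 1); [ring | rewrite <- H; ring].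
Qed.

Lemma Cexp_0 : Cexp C0 = C1.
Proof. unfold Cexp, RtoC; simpl; rewrite exp_0, cos_0, sin_0; f_equal; ring. Qed.

Lemma Cexp_neq0 z : Cexp z <> C0.
Proof. apply neq0_Cnorm; rewrite Cnorm_exp; apply exp_pos. Qed.

Lemma Cexp_RtoC x : Cexp (RtoC x) = RtoC (exp x).
Proof. unfold Cexp, RtoC; simpl; rewrite cos_0, sin_0; f_equal; ring. Qed.

(** All bases of powers below lie in the open right half-plane, where the principal argument is this
    single smooth expression; the other branches of [Carg] never arise. *)
Lemma Carg_pos z : 0 < fst z -> Carg z = atan (snd z / fst z).
Proof. intros H; unfold Carg; destruct (Rlt_dec 0 (fst z)); [reflexivity | lra]. Qed.

Lemma Cpow_exp z w : z <> C0 -> Cpow z w = Cexp (Cmul w (Clog z)).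
Proof.
  intros H; unfold Cpow; destruct (Req_EM_T (Cnorm z) 0) as [E | E]; [| reflexivity].
  exfalso; apply H, Cnorm_eq0, E.
Qed.

Lemma Clog_RtoC x : 0 < x -> Clog (RtoC x) = RtoC (ln x).
Proof.
  intros H; unfold Clog; rewrite Carg_pos by exact H.
  rewrite Cnorm_RtoC, Rabs_pos_eq by lra; unfold RtoC; simpl.
  replace (0 / x) with 0 by (field; lra); rewrite atan_0; reflexivity.
Qed.

Lemma Cexp_Clog z : 0 < fst z -> Cexp (Clog z) = z.
Proof.
  intros H; assert (Hn : 0 < Cnorm z) by (apply Cnorm_gt0, fst_gt0_neq0, H).
  unfold Clog, Cexp; simpl; rewrite exp_ln by exact Hn; rewrite Carg_pos by exact H.
  rewrite cos_atan, sin_atan.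
  assert (E : sqrt (1 + (snd z / fst z)²) = Cnorm z / fst z).
  { apply sqrt_lem_1.
    - pose proof (Rle_0_sqr (snd z / fst z)); lra.
    - apply Rlt_le, Rdiv_lt_0_compat; assumption.
    - unfold Rsqr; replace (Cnorm z / fst z * (Cnorm z / fst z))
        with (Cnorm z * Cnorm z / (fst z * fst z)) by (field; lra).
      rewrite Cnorm_sqr; field; lra. }
  rewrite E; apply Ceq; simpl; field; lra.
Qed.

Lemma Cpow_neq0 z w : z <> C0 -> Cpow z w <> C0.
Proof. intros H; rewrite Cpow_exp by exact H; apply Cexp_neq0. Qed.

Lemma Cpow_add z w1 w2 : z <> C0 -> Cpow z (Cadd w1 w2) = Cmul (Cpow z w1) (Cpow z w2).
Proof. intros H; rewrite !Cpow_exp, <- Cexp_add by exact H; f_equal; ring. Qed.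

Lemma Cpow_0 z : z <> C0 -> Cpow z C0 = C1.
Proof.
  intros H; rewrite Cpow_exp by exact H; rewrite <- Cexp_0; f_equal; ring.
Qed.

Lemma Cpow_opp z w : z <> C0 -> Cpow z (Copp w) = Cinv (Cpow z w).
Proof.
  intros H.
  assert (E : Cmul (Cpow z (Copp w)) (Cpow z w) = C1).
  { rewrite <- Cpow_add by exact H; replace (Cadd (Copp w) w) with C0 by ring.
    apply Cpow_0, H. }
  pose proof (Cpow_neq0 z w H) as Hn.
  replace (Cpow z (Copp w)) with (Cmul (Cmul (Cpow z (Copp w)) (Cpow z w)) (Cinv (Cpow z w)))
    by (field; exact Hn).
  rewrite E; ring.
Qed.

Lemma Cpow_1 z : 0 < fst z -> Cpow z C1 = z.
Proof.
  intros H; rewrite Cpow_exp by apply fst_gt0_neq0, H.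
  replace (Cmul C1 (Clog z)) with (Clog z) by ring; apply Cexp_Clog, H.
Qed.

Lemma Cpow_add1 z w : 0 < fst z -> Cpow z (Cadd w C1) = Cmul (Cpow z w) z.
Proof.
  intros H; rewrite Cpow_add by apply fst_gt0_neq0, H; rewrite Cpow_1 by exact H; reflexivity.
Qed.

Lemma Cpow_sub1 z w : 0 < fst z -> Cpow z (Csub w C1) = Cdiv (Cpow z w) z.
Proof.
  intros H; pose proof (fst_gt0_neq0 z H).
  replace (Cpow z w) with (Cpow z (Cadd (Csub w C1) C1)) by (f_equal; ring).
  rewrite Cpow_add1 by exact H; field; assumption.
Qed.

Lemma Cnorm_pow z w : 0 < fst z ->
  Cnorm (Cpow z w) = exp (fst w * ln (Cnorm z) - snd w * atan (snd z / fst z)).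
Proof.
  intros H; rewrite Cpow_exp by apply fst_gt0_neq0, H.
  rewrite Cnorm_exp; unfold Clog; simpl; rewrite Carg_pos by exact H; reflexivity.
Qed.

Lemma Cnorm_pow_RtoC x w : 0 < x -> Cnorm (Cpow (RtoC x) w) = exp (fst w * ln x).
Proof.
  intros H; rewrite Cnorm_pow by exact H; rewrite Cnorm_RtoC, Rabs_pos_eq by lra.
  unfold RtoC; simpl; replace (0 / x) with 0 by (field; lra).
  rewrite atan_0; f_equal; ring.
Qed.

(** A positive factor leaves the argument unchanged, so the logarithm is additive here without any
    multiple of 2 pi i. *)
Lemma Clog_scale x z : 0 < x -> 0 < fst z -> Clog (Cmul (RtoC x) z) = Cadd (RtoC (ln x)) (Clog z).
Proof.
  intros Hx Hz.
  assert (Hn : 0 < Cnorm z) by (apply Cnorm_gt0, fst_gt0_neq0, Hz).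
  assert (H : 0 < fst (Cmul (RtoC x) z)) by (unfold Cmul, RtoC; simpl; nra).
  unfold Clog; rewrite (Carg_pos _ H), (Carg_pos _ Hz), Cnorm_mul, Cnorm_RtoC, Rabs_pos_eq by lra.
  rewrite ln_mult by assumption.
  apply Ceq; unfold Cadd, RtoC; simpl; [reflexivity |].
  rewrite Rplus_0_l; f_equal; field; lra.
Qed.

Lemma Cpow_scale x z w : 0 < x -> 0 < fst z ->
  Cpow (Cmul (RtoC x) z) w = Cmul (Cpow (RtoC x) w) (Cpow z w).
Proof.
  intros Hx Hz.
  assert (H : 0 < fst (Cmul (RtoC x) z)) by (unfold Cmul, RtoC; simpl; nra).
  rewrite !Cpow_exp, Clog_scale, Clog_RtoC, <- Cexp_add by
    (assumption || apply fst_gt0_neq0; assumption).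
  f_equal; ring.
Qed.

Lemma Cpow_RtoC_mul x y w : 0 < x -> 0 < y ->
  Cpow (RtoC (x * y)) w = Cmul (Cpow (RtoC x) w) (Cpow (RtoC y) w).
Proof. intros Hx Hy; rewrite RtoC_mul; apply Cpow_scale; assumption. Qed.

Lemma Cpow_RtoC_1 w : Cpow C1 w = C1.
Proof.
  rewrite Cpow_exp by (apply RtoC_neq0; lra).
  rewrite Clog_RtoC, ln_1 by lra; rewrite <- Cexp_0; f_equal; ring.
Qed.

Lemma Cpow_RtoC_INR x n : 0 < x -> Cpow (RtoC x) (RtoC (INR n)) = RtoC (x ^ n).
Proof.
  intros H; induction n.
  - simpl; apply Cpow_0, RtoC_neq0; lra.
  - rewrite RtoC_S, Cpow_add1 by exact H.
    rewrite IHn, <- RtoC_mul; f_equal; simpl; ring.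
Qed.

Lemma Cpown_RtoC x n : Cpown (RtoC x) n = RtoC (x ^ n).
Proof.
  induction n; [reflexivity |]; simpl; rewrite IHn, <- RtoC_mul; reflexivity.
Qed.

Lemma Cnorm_pown z n : Cnorm (Cpown z n) = Cnorm z ^ n.
Proof. induction n; simpl; [apply Cnorm_1 | rewrite Cnorm_mul, IHn; reflexivity]. Qed.

Lemma Cpown_mul z w n : Cpown (Cmul z w) n = Cmul (Cpown z n) (Cpown w n).
Proof.
  induction n.
  - change (C1 = Cmul C1 C1); ring.
  - simpl; rewrite IHn; ring.
Qed.

(** * Differentiation of complex-valued functions *)

(** Derivative with respect to a real variable, taken componentwise: every complex function that
    gets differentiated below is a curve, parametrized by t, by x or by a point of a segment. *)
Definition Cderiv (f : R -> Cplx) (x : R) (l : Cplx) : Prop :=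
  is_derive (fun t => fst (f t)) x (fst l) /\ is_derive (fun t => snd (f t)) x (snd l).

Lemma is_derive_eq (f : R -> R) (x l l' : R) : is_derive f x l -> l = l' -> is_derive f x l'.
Proof. intros H E; rewrite <- E; exact H. Qed.

Lemma Cderiv_eq f x l l' : Cderiv f x l -> l = l' -> Cderiv f x l'.
Proof. intros H E; rewrite <- E; exact H. Qed.

Lemma Cderiv_ext_loc f g x l : locally x (fun t => f t = g t) -> Cderiv f x l -> Cderiv g x l.
Proof.
  intros E [H1 H2]; split; eapply is_derive_ext_loc; try eassumption;
    revert E; apply filter_imp; intros t Ht; simpl; rewrite Ht; reflexivity.
Qed.

Lemma Cderiv_locally_gt0 f x l : Cderiv f x l -> 0 < fst (f x) ->
  locally x (fun t => 0 < fst (f t)).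
Proof.
  intros [H _] Hp.
  assert (Hc : continuous (fun t => fst (f t)) x)
    by (apply (ex_derive_continuous (V := R_NormedModule)); eexists; exact H).
  apply (Hc (fun y => 0 < y)), (open_gt 0), Hp.
Qed.

Lemma Cderiv_const c x : Cderiv (fun _ => c) x C0.
Proof. split; apply (is_derive_const (V := R_NormedModule)). Qed.

Lemma Cderiv_RtoC f x l : is_derive f x l -> Cderiv (fun t => RtoC (f t)) x (RtoC l).
Proof. intros H; split; simpl; [exact H | apply (is_derive_const (V := R_NormedModule))]. Qed.

Lemma Cderiv_id x : Cderiv RtoC x C1.
Proof. apply (Cderiv_RtoC (fun t => t)), (is_derive_id (K := R_AbsRing)). Qed.

Lemma Cderiv_add f g x l m : Cderiv f x l -> Cderiv g x m ->
  Cderiv (fun t => Cadd (f t) (g t)) x (Cadd l m).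
Proof.
  intros [H1 H2] [H3 H4]; split; simpl;
    apply (is_derive_plus (V := R_NormedModule)); assumption.
Qed.

Lemma Cderiv_opp f x l : Cderiv f x l -> Cderiv (fun t => Copp (f t)) x (Copp l).
Proof.
  intros [H1 H2]; split; simpl; apply (is_derive_opp (V := R_NormedModule)); assumption.
Qed.

Lemma Cderiv_sub f g x l m : Cderiv f x l -> Cderiv g x m ->
  Cderiv (fun t => Csub (f t) (g t)) x (Csub l m).
Proof. intros Hf Hg; apply Cderiv_add; [| apply Cderiv_opp]; assumption. Qed.

Lemma is_derive_Rmult (f g : R -> R) x l m : is_derive f x l -> is_derive g x m ->
  is_derive (fun t => f t * g t) x (l * g x + f x * m).
Proof. intros Hf Hg; apply (is_derive_mult f g x l m Hf Hg); intros; apply Rmult_comm. Qed.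

Lemma Cderiv_mul f g x l m : Cderiv f x l -> Cderiv g x m ->
  Cderiv (fun t => Cmul (f t) (g t)) x (Cadd (Cmul l (g x)) (Cmul (f x) m)).
Proof.
  intros [H1 H2] [H3 H4]; split; simpl.
  - eapply is_derive_eq.
    + apply (is_derive_minus (V := R_NormedModule)); apply is_derive_Rmult; eassumption.
    + unfold minus, plus, opp; simpl; ring.
  - eapply is_derive_eq.
    + apply (is_derive_plus (V := R_NormedModule)); apply is_derive_Rmult; eassumption.
    + unfold plus; simpl; ring.
Qed.

Lemma Cderiv_scal c f x l : Cderiv f x l -> Cderiv (fun t => Cmul c (f t)) x (Cmul c l).
Proof.
  intros H; eapply Cderiv_eq; [apply (Cderiv_mul _ _ _ _ _ (Cderiv_const c x) H) | ring].
Qed.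

Lemma is_derive_exp_cos (u v : R -> R) x l m : is_derive u x l -> is_derive v x m ->
  is_derive (fun t => exp (u t) * cos (v t)) x
    (l * (exp (u x) * cos (v x)) - m * (exp (u x) * sin (v x))).
Proof.
  intros H1 H2; auto_derive; [repeat split; eexists; eassumption |].
  rewrite (is_derive_unique (fun t : R => u t) x l H1), (is_derive_unique (fun t : R => v t) x m H2); ring.
Qed.

Lemma is_derive_exp_sin (u v : R -> R) x l m : is_derive u x l -> is_derive v x m ->
  is_derive (fun t => exp (u t) * sin (v t)) x
    (l * (exp (u x) * sin (v x)) + m * (exp (u x) * cos (v x))).
Proof.
  intros H1 H2; auto_derive; [repeat split; eexists; eassumption |].
  rewrite (is_derive_unique (fun t : R => u t) x l H1), (is_derive_unique (fun t : R => v t) x m H2); ring.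
Qed.

Lemma Cderiv_exp f x l : Cderiv f x l -> Cderiv (fun t => Cexp (f t)) x (Cmul l (Cexp (f x))).
Proof.
  intros [H1 H2]; split; simpl.
  - apply (is_derive_exp_cos (fun t => fst (f t)) (fun t => snd (f t))); assumption.
  - apply (is_derive_exp_sin (fun t => fst (f t)) (fun t => snd (f t))); assumption.
Qed.

Lemma is_derive_ln_norm (u v : R -> R) x l m : 0 < u x -> is_derive u x l -> is_derive v x m ->
  is_derive (fun t => ln (sqrt (u t * u t + v t * v t))) x
    ((l * u x + m * v x) / (u x * u x + v x * v x)).
Proof.
  intros Hx H1 H2.
  assert (Hq : 0 < u x * u x + v x * v x) by nra.
  auto_derive.
  - repeat split; try (eexists; eassumption); try exact Hq; apply sqrt_lt_R0, Hq.
  - rewrite (is_derive_unique (fun t : R => u t) x l H1), (is_derive_unique (fun t : R => v t) x m H2).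
    set (r := sqrt (u x * u x + v x * v x)).
    assert (E : u x * u x + v x * v x = r * r) by (symmetry; apply sqrt_sqrt; lra).
    assert (0 < r) by (apply sqrt_lt_R0; lra).
    rewrite E; field; lra.
Qed.

Lemma is_derive_atan_quot (u v : R -> R) x l m : 0 < u x -> is_derive u x l -> is_derive v x m ->
  is_derive (fun t => atan (v t / u t)) x
    ((m * u x - l * v x) / (u x * u x + v x * v x)).
Proof.
  intros Hx H1 H2; auto_derive.
  - repeat split; try (eexists; eassumption); lra.
  - rewrite (is_derive_unique (fun t : R => u t) x l H1), (is_derive_unique (fun t : R => v t) x m H2); field; nra.
Qed.

Lemma Cderiv_log f x l : 0 < fst (f x) -> Cderiv f x l ->
  Cderiv (fun t => Clog (f t)) x (Cdiv l (f x)).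
Proof.
  intros Hx Hf; pose proof (Cderiv_locally_gt0 f x l Hf Hx) as Hp.
  destruct Hf as [H1 H2].
  assert (Hq : 0 < fst (f x) * fst (f x) + snd (f x) * snd (f x)) by nra.
  split; simpl.
  - eapply is_derive_eq; [apply (is_derive_ln_norm (fun t => fst (f t)) (fun t => snd (f t)));
      eassumption | simpl; field; lra].
  - apply (is_derive_ext_loc (fun t => atan (snd (f t) / fst (f t)))).
    { revert Hp; apply filter_imp; intros t Ht; simpl; rewrite Carg_pos; auto. }
    eapply is_derive_eq; [apply (is_derive_atan_quot (fun t => fst (f t)) (fun t => snd (f t)));
      eassumption | simpl; field; lra].
Qed.

Lemma Cderiv_pow f w x l : 0 < fst (f x) -> Cderiv f x l ->
  Cderiv (fun t => Cpow (f t) w) x (Cmul (Cmul w l) (Cpow (f x) (Csub w C1))).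
Proof.
  intros Hx H.
  apply (Cderiv_ext_loc (fun t => Cexp (Cmul w (Clog (f t))))).
  { generalize (Cderiv_locally_gt0 f x l H Hx); apply filter_imp.
    intros t Ht; rewrite Cpow_exp; [reflexivity | apply fst_gt0_neq0, Ht]. }
  eapply Cderiv_eq.
  - apply Cderiv_exp, Cderiv_scal, Cderiv_log; eassumption.
  - rewrite Cpow_sub1, Cpow_exp by (assumption || apply fst_gt0_neq0, Hx).
    field; apply fst_gt0_neq0, Hx.
Qed.

Lemma incr_of_deriv (f f' : R -> R) a b : a <= b ->
  (forall x, a <= x <= b -> is_derive f x (f' x)) ->
  (forall x, a <= x <= b -> 0 <= f' x) -> f a <= f b.
Proof.
  intros Hab Hd Hp; destruct (Req_dec a b) as [-> | Hn]; [lra |].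
  destruct (MVT_cor2 f f' a b) as [c [E Hc]]; [lra | |].
  - intros; apply is_derive_Reals, Hd; assumption.
  - assert (0 <= f' c) by (apply Hp; lra); nra.
Qed.

(* Project the increment onto its own direction, then apply the real mean value theorem. *)
Lemma mvt_cmp (f f' : R -> Cplx) (h h' : R -> R) a b : a <= b ->
  (forall x, a <= x <= b -> Cderiv f x (f' x)) ->
  (forall x, a <= x <= b -> is_derive h x (h' x)) ->
  (forall x, a <= x <= b -> Cnorm (f' x) <= h' x) ->
  Cnorm (Csub (f b) (f a)) <= h b - h a.
Proof.
  intros Hab Hf Hh Hle; set (d := Csub (f b) (f a)).
  set (phi := fun x => Cnorm d * h x - (fst d * fst (f x) + snd d * snd (f x))).
  assert (Hphi : phi a <= phi b).
  { apply (incr_of_deriv phi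
      (fun x => Cnorm d * h' x - (fst d * fst (f' x) + snd d * snd (f' x)))); [exact Hab | |].
    - intros x Hx; destruct (Hf x Hx) as [H1 H2]; pose proof (Hh x Hx) as H3.
      apply (is_derive_minus (V := R_NormedModule)); [| apply (is_derive_plus (V := R_NormedModule))];
        apply (is_derive_scal); assumption.
    - intros x Hx; pose proof (Cdot_le d (f' x)); pose proof (Hle x Hx).
      pose proof (Cnorm_ge0 d); nra. }
  assert (E : Cnorm d * Cnorm d <= Cnorm d * (h b - h a)).
  { rewrite Cnorm_sqr; unfold phi in Hphi.
    replace (fst d * fst d) with (fst d * fst (f b) - fst d * fst (f a))
      by (unfold d, Csub, Cadd, Copp; simpl; ring).
    replace (snd d * snd d) with (snd d * snd (f b) - snd d * snd (f a))
      by (unfold d, Csub, Cadd, Copp; simpl; ring).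
    lra. }
  destruct (Req_dec (Cnorm d) 0) as [H0 | H0].
  - rewrite H0.
    assert (h a <= h b); [| lra].
    apply (incr_of_deriv h h'); try assumption.
    intros x Hx; eapply Rle_trans; [apply Cnorm_ge0 | apply Hle, Hx].
  - pose proof (Cnorm_ge0 d); nra.
Qed.

(** * Finite sums, limits and dominated convergence *)

Lemma Csum_0 f : Csum f 0 = C0.
Proof. reflexivity. Qed.
Lemma Csum_S f n : Csum f (S n) = Cadd (Csum f n) (f n).
Proof. reflexivity. Qed.
Lemma Rsum_S f n : Rsum f (S n) = Rsum f n + f n.
Proof. reflexivity. Qed.
Lemma Cprod_S f n : Cprod f (S n) = Cmul (Cprod f n) (f n).
Proof. reflexivity. Qed.

Lemma Csum_ext f g n : (forall k, (k < n)%nat -> f k = g k) -> Csum f n = Csum g n.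
Proof.
  induction n; intros H; [reflexivity |]; rewrite !Csum_S, IHn, H; auto.
Qed.

Lemma Cprod_ext f g n : (forall k, (k < n)%nat -> f k = g k) -> Cprod f n = Cprod g n.
Proof.
  induction n; intros H; [reflexivity |]; rewrite !Cprod_S, IHn, H; auto.
Qed.

Lemma Rsum_ext f g n : (forall k, (k < n)%nat -> f k = g k) -> Rsum f n = Rsum g n.
Proof.
  induction n; intros H; [reflexivity |]; rewrite !Rsum_S, IHn, H; auto.
Qed.

Lemma Rsum_le f g n : (forall k, (k < n)%nat -> f k <= g k) -> Rsum f n <= Rsum g n.
Proof.
  induction n; intros H; [apply Rle_refl |].
  rewrite !Rsum_S; apply Rplus_le_compat; auto.
Qed.

Lemma Rsum_ge0 f n : (forall k, (k < n)%nat -> 0 <= f k) -> 0 <= Rsum f n.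
Proof.
  induction n; intros H; [apply Rle_refl |].
  rewrite !Rsum_S; apply Rplus_le_le_0_compat; auto.
Qed.

Lemma Rsum_scal c f n : Rsum (fun k => c * f k) n = c * Rsum f n.
Proof. induction n; simpl; [ring | rewrite IHn; ring]. Qed.

Lemma Rsum_add f g n : Rsum (fun k => f k + g k) n = Rsum f n + Rsum g n.
Proof. induction n; simpl; [ring | rewrite IHn; ring]. Qed.

Lemma Rsum_split f n m : Rsum f (n + m) = Rsum f n + Rsum (fun k => f (n + k)%nat) m.
Proof.
  induction m; [rewrite Nat.add_0_r; simpl; ring |].
  rewrite Nat.add_succ_r, !Rsum_S, IHm; ring.
Qed.

Lemma Csum_scal c f n : Csum (fun k => Cmul c (f k)) n = Cmul c (Csum f n).
Proof. induction n; rewrite ?Csum_0, ?Csum_S, ?IHn; ring. Qed.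

Lemma Csum_add f g n : Csum (fun k => Cadd (f k) (g k)) n = Cadd (Csum f n) (Csum g n).
Proof. induction n; rewrite ?Csum_0, ?Csum_S, ?IHn; ring. Qed.

Lemma Csum_sub f g n : Csum (fun k => Csub (f k) (g k)) n = Csub (Csum f n) (Csum g n).
Proof. induction n; rewrite ?Csum_0, ?Csum_S, ?IHn; ring. Qed.

Lemma Csum_split f n m : Csum f (n + m) = Cadd (Csum f n) (Csum (fun k => f (n + k)%nat) m).
Proof.
  induction m; [rewrite Nat.add_0_r, Csum_0; ring |].
  rewrite Nat.add_succ_r, !Csum_S, IHm; ring.
Qed.

Lemma Csum_S_l f n : Csum f (S n) = Cadd (f 0%nat) (Csum (fun k => f (S k)) n).
Proof.
  change (S n) with (1 + n)%nat; rewrite Csum_split, Csum_S, Csum_0; simpl; ring.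
Qed.

Lemma Cprod_S_l f n : Cprod f (S n) = Cmul (f 0%nat) (Cprod (fun k => f (S k)) n).
Proof.
  induction n; [rewrite Cprod_S; change (Cmul C1 (f 0%nat) = Cmul (f 0%nat) C1); ring |].
  rewrite Cprod_S, IHn, (Cprod_S _ n); ring.
Qed.

Lemma Cprod_neq0 f n : (forall k, (k < n)%nat -> f k <> C0) -> Cprod f n <> C0.
Proof.
  induction n; intros H; [apply RtoC_neq0; lra |].
  apply neq0_Cnorm; rewrite Cprod_S, Cnorm_mul.
  apply Rmult_lt_0_compat; apply Cnorm_gt0; auto.
Qed.

Lemma Csum_swap (f : nat -> nat -> Cplx) n m :
  Csum (fun i => Csum (fun j => f i j) m) n = Csum (fun j => Csum (fun i => f i j) n) m.
Proof.
  induction n.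
  - rewrite Csum_0; induction m; [reflexivity | rewrite Csum_S, <- IHm, Csum_0; ring].
  - rewrite Csum_S, IHn, <- Csum_add; reflexivity.
Qed.

Lemma Cnorm_Csum f n : Cnorm (Csum f n) <= Rsum (fun k => Cnorm (f k)) n.
Proof.
  induction n; [rewrite Csum_0, Cnorm_0; apply Rle_refl |].
  rewrite Csum_S, Rsum_S; eapply Rle_trans; [apply Cnorm_add | lra].
Qed.

Lemma Cnorm_Csum_le f m n : (forall k, (k < n)%nat -> Cnorm (f k) <= m k) ->
  Cnorm (Csum f n) <= Rsum m n.
Proof. intros H; eapply Rle_trans; [apply Cnorm_Csum | apply Rsum_le, H]. Qed.

Lemma Csum_diff_le f m i n : (i <= n)%nat ->
  (forall k, (i <= k < n)%nat -> Cnorm (f k) <= m k) ->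
  Cnorm (Csub (Csum f n) (Csum f i)) <= Rsum m n - Rsum m i.
Proof.
  intros Hi H; replace n with (i + (n - i))%nat by lia.
  rewrite Csum_split, Rsum_split.
  replace (Csub _ _) with (Csum (fun k => f (i + k)%nat) (n - i)) by ring.
  replace (_ - _) with (Rsum (fun k => m (i + k)%nat) (n - i)) by ring.
  apply Cnorm_Csum_le; intros; apply H; lia.
Qed.

Lemma Cderiv_Csum (f f' : nat -> R -> Cplx) x n :
  (forall k, (k < n)%nat -> Cderiv (f k) x (f' k x)) ->
  Cderiv (fun t => Csum (fun k => f k t) n) x (Csum (fun k => f' k x) n).
Proof.
  induction n; intros H; [apply (Cderiv_const C0) |].
  apply Cderiv_add; auto.
Qed.

Lemma Un_cv_ext u w l : (forall n, u n = w n) -> Un_cv u l -> Un_cv w l.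
Proof. intros E H eps He; destruct (H eps He) as [n Hn]; exists n; intros; rewrite <- E; auto. Qed.

Lemma Un_cv_const c : Un_cv (fun _ => c) c.
Proof. intros eps He; exists 0%nat; intros; rewrite R_dist_eq; exact He. Qed.

Lemma Un_cv_le u w l m : (exists n0, forall n, (n0 <= n)%nat -> u n <= w n) ->
  Un_cv u l -> Un_cv w m -> l <= m.
Proof.
  intros [n0 H] Hu Hw; apply Rnot_lt_le; intros Hlt.
  destruct (Hu ((l - m) / 2)) as [n1 H1]; [lra |].
  destruct (Hw ((l - m) / 2)) as [n2 H2]; [lra |].
  pose (n := (n0 + n1 + n2)%nat).
  specialize (H1 n ltac:(lia)); specialize (H2 n ltac:(lia)); specialize (H n ltac:(lia)).
  unfold Rdist in *; apply Rabs_def2 in H1; apply Rabs_def2 in H2; lra.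
Qed.

Lemma Un_cv_squeeze u e : (exists n0, forall n, (n0 <= n)%nat -> Rabs (u n) <= e n) ->
  Un_cv e 0 -> Un_cv u 0.
Proof.
  intros [n0 H] He eps Hp; destruct (He eps Hp) as [n1 H1]; exists (n0 + n1)%nat; intros n Hn.
  specialize (H1 n ltac:(lia)); specialize (H n ltac:(lia)).
  unfold Rdist in *; rewrite Rminus_0_r in *; apply Rabs_def2 in H1; lra.
Qed.

Lemma Un_cv_subseq u l (n : nat -> nat) : cv_infty (fun K => INR (n K)) -> Un_cv u l ->
  Un_cv (fun K => u (n K)) l.
Proof.
  intros Hn H eps He; destruct (H eps He) as [n0 H0].
  destruct (Hn (INR n0)) as [K0 HK]; exists K0; intros K Hk; apply H0.
  apply INR_le, Rlt_le, HK, Hk.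
Qed.

Lemma Un_cv_scal c u l : Un_cv u l -> Un_cv (fun n => c * u n) (c * l).
Proof. intros H; apply (CV_mult (fun _ => c)); [apply Un_cv_const | exact H]. Qed.

Lemma Un_cv_inv_INR : Un_cv (fun n => / INR n) 0.
Proof.
  intros eps He; destruct (archimed_cor1 eps He) as [n0 [H0 Hp]]; exists n0; intros n Hn.
  unfold Rdist; rewrite Rminus_0_r, Rabs_pos_eq.
  - eapply Rle_lt_trans; [| exact H0].
    apply Rinv_le_contravar; [apply lt_0_INR, Hp | apply le_INR, Hn].
  - left; apply Rinv_0_lt_compat, lt_0_INR; lia.
Qed.

Lemma Un_cv_inv_INR_S c : Un_cv (fun n => c / (INR n + 1)) 0.
Proof.
  replace 0 with (c * 0) by ring; apply Un_cv_scal.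
  apply (Un_cv_ext (fun n => / INR (S n))); [intros; rewrite S_INR; reflexivity |].
  intros eps He; destruct (Un_cv_inv_INR eps He) as [n0 H]; exists n0; intros; apply H; lia.
Qed.

Lemma C_cv_iff u l : C_cv u l <-> Un_cv (fun n => Cnorm (Csub (u n) l)) 0.
Proof.
  unfold C_cv, Un_cv, Rdist; split; intros H eps He; destruct (H eps He) as [n0 Hn]; exists n0;
    intros n Hle; specialize (Hn n Hle); rewrite Rminus_0_r, Rabs_pos_eq in *; auto;
    apply Cnorm_ge0.
Qed.

Lemma C_cv_le u l e : (exists n0, forall n, (n0 <= n)%nat -> Cnorm (Csub (u n) l) <= e n) ->
  Un_cv e 0 -> C_cv u l.
Proof.
  intros [n0 H] He; apply C_cv_iff; apply (Un_cv_squeeze _ e); [| exact He].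
  exists n0; intros; rewrite Rabs_pos_eq by apply Cnorm_ge0; auto.
Qed.

Lemma C_cv_ext_from u w l n0 : (forall n, (n0 <= n)%nat -> u n = w n) -> C_cv u l -> C_cv w l.
Proof.
  intros E H eps He; destruct (H eps He) as [n1 Hn]; exists (n0 + n1)%nat; intros.
  rewrite <- E by lia; apply Hn; lia.
Qed.

Lemma C_cv_ext u w l : (forall n, u n = w n) -> C_cv u l -> C_cv w l.
Proof. intros E; apply (C_cv_ext_from u w l 0); auto. Qed.

Lemma C_cv_const c : C_cv (fun _ => c) c.
Proof.
  apply (C_cv_le _ _ (fun _ => 0)); [| apply Un_cv_const].
  exists 0%nat; intros; replace (Csub c c) with C0 by ring; rewrite Cnorm_0; lra.
Qed.

Lemma C_cv_add u w l m : C_cv u l -> C_cv w m -> C_cv (fun n => Cadd (u n) (w n)) (Cadd l m).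
Proof.
  intros H1 H2; apply C_cv_iff in H1; apply C_cv_iff in H2.
  apply (C_cv_le _ _ (fun n => Cnorm (Csub (u n) l) + Cnorm (Csub (w n) m))).
  - exists 0%nat; intros n _.
    replace (Csub _ _) with (Cadd (Csub (u n) l) (Csub (w n) m)) by ring; apply Cnorm_add.
  - replace 0 with (0 + 0) by ring; apply CV_plus; assumption.
Qed.

Lemma C_cv_scal c u l : C_cv u l -> C_cv (fun n => Cmul c (u n)) (Cmul c l).
Proof.
  intros H; apply C_cv_iff in H.
  apply (C_cv_le _ _ (fun n => Cnorm c * Cnorm (Csub (u n) l))).
  - exists 0%nat; intros n _; rewrite <- Cnorm_mul; right; f_equal; ring.
  - replace 0 with (Cnorm c * 0) by ring; apply Un_cv_scal; assumption.
Qed.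

Lemma C_cv_opp u l : C_cv u l -> C_cv (fun n => Copp (u n)) (Copp l).
Proof.
  intros H; apply (C_cv_ext (fun n => Cmul (Copp C1) (u n))); [intros; ring |].
  replace (Copp l) with (Cmul (Copp C1) l) by ring; apply C_cv_scal, H.
Qed.

Lemma C_cv_sub u w l m : C_cv u l -> C_cv w m -> C_cv (fun n => Csub (u n) (w n)) (Csub l m).
Proof. intros H1 H2; apply C_cv_add; [| apply C_cv_opp]; assumption. Qed.

Lemma C_cv_mul u w l m : C_cv u l -> C_cv w m -> C_cv (fun n => Cmul (u n) (w n)) (Cmul l m).
Proof.
  intros H1 H2.
  apply (C_cv_ext (fun n => Cadd (Cadd (Cmul (Csub (u n) l) (Csub (w n) m)) (Cmul l (w n)))
    (Cmul m (Csub (u n) l)))); [intros; ring |].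
  replace (Cmul l m) with (Cadd (Cadd C0 (Cmul l m)) (Cmul m (Csub l l))) by ring.
  apply C_cv_add; [apply C_cv_add |]; [| apply C_cv_scal; assumption |].
  - apply C_cv_iff in H1; apply C_cv_iff in H2.
    apply (C_cv_le _ _ (fun n => Cnorm (Csub (u n) l) * Cnorm (Csub (w n) m))).
    + exists 0%nat; intros n _; rewrite <- Cnorm_mul; right; f_equal; ring.
    + replace 0 with (0 * 0) by ring; apply CV_mult; assumption.
  - apply C_cv_scal, C_cv_sub; [assumption | apply C_cv_const].
Qed.

Lemma C_cv_norm u l : C_cv u l -> Un_cv (fun n => Cnorm (u n)) (Cnorm l).
Proof.
  intros H eps He; destruct (H eps He) as [n0 Hn]; exists n0; intros n Hle.
  specialize (Hn n Hle); unfold Rdist; apply Rabs_def1.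
  - pose proof (Cnorm_le_sub (u n) l); lra.
  - pose proof (Cnorm_le_sub l (u n)); rewrite Cnorm_sub_sym in Hn; lra.
Qed.

Lemma C_cv_norm_le u l B : (exists n0, forall n, (n0 <= n)%nat -> Cnorm (u n) <= B) ->
  C_cv u l -> Cnorm l <= B.
Proof.
  intros H Hu; apply (Un_cv_le _ _ _ _ H (C_cv_norm _ _ Hu) (Un_cv_const B)).
Qed.

Lemma C_cv_unique u l m : C_cv u l -> C_cv u m -> l = m.
Proof.
  intros H1 H2; pose proof (C_cv_sub _ _ _ _ H1 H2) as H.
  assert (E : Cnorm (Csub l m) <= 0).
  { eapply C_cv_norm_le; [| exact H]; exists 0%nat; intros n _.
    replace (Csub (u n) (u n)) with C0 by ring; rewrite Cnorm_0; lra. }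
  assert (E' : Csub l m = C0) by (apply Cnorm_eq0; pose proof (Cnorm_ge0 (Csub l m)); lra).
  replace l with (Cadd (Csub l m) m) by ring; rewrite E'; ring.
Qed.

Lemma Clim_eq u l : C_cv u l -> Clim u = l.
Proof.
  intros H; apply (C_cv_unique u); [| exact H].
  unfold Clim; apply epsilon_spec; exists l; exact H.
Qed.

Lemma C_cv_subseq u l (n : nat -> nat) : cv_infty (fun K => INR (n K)) -> C_cv u l ->
  C_cv (fun K => u (n K)) l.
Proof.
  intros Hn H; apply C_cv_iff; apply C_cv_iff in H.
  apply (Un_cv_subseq (fun k => Cnorm (Csub (u k) l))); assumption.
Qed.

Lemma C_cv_shift u l : C_cv u l -> C_cv (fun n => u (S n)) l.
Proof. intros H eps He; destruct (H eps He) as [n0 Hn]; exists n0; intros; apply Hn; lia. Qed.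

Lemma C_cv_unshift u l : C_cv (fun n => u (S n)) l -> C_cv u l.
Proof.
  intros H eps He; destruct (H eps He) as [n0 Hn]; exists (S n0); intros n Hle.
  destruct n; [lia | apply Hn; lia].
Qed.

Lemma C_cv_RtoC u l : Un_cv u l -> C_cv (fun n => RtoC (u n)) (RtoC l).
Proof.
  intros H eps He; destruct (H eps He) as [n0 Hn]; exists n0; intros.
  rewrite <- RtoC_sub, Cnorm_RtoC; apply Hn; assumption.
Qed.

Lemma C_cv_cauchy u : (forall eps, eps > 0 -> exists n0, forall n m, (n0 <= n)%nat -> (n <= m)%nat ->
  Cnorm (Csub (u m) (u n)) < eps) -> exists l, C_cv u l.
Proof.
  intros H.
  assert (HR : forall p : Cplx -> R, (forall z w, Rabs (p z - p w) <= Cnorm (Csub z w)) ->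
    exists l, Un_cv (fun n => p (u n)) l).
  { intros p Hp; assert (HC : Cauchy_crit (fun n => p (u n)));
      [| destruct (Rcomplete.R_complete _ HC) as [l Hl]; exists l; exact Hl].
    intros eps He; destruct (H eps He) as [n0 Hn]; exists n0; intros n m H1 H2.
    unfold Rdist; destruct (le_ge_dec n m).
    - rewrite Rabs_minus_sym; eapply Rle_lt_trans; [apply Hp |]; apply Hn; lia.
    - eapply Rle_lt_trans; [apply Hp |]; apply Hn; lia. }
  destruct (HR fst) as [x Hx].
  { intros z w; apply (fst_le_Cnorm (Csub z w)). }
  destruct (HR snd) as [y Hy].
  { intros z w; apply (snd_le_Cnorm (Csub z w)). }
  exists (x, y); intros eps He.
  destruct (Hx (eps / 2)) as [n1 H1]; [lra |]; destruct (Hy (eps / 2)) as [n2 H2]; [lra |].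
  exists (n1 + n2)%nat; intros n Hn.
  specialize (H1 n ltac:(lia)); specialize (H2 n ltac:(lia)).
  eapply Rle_lt_trans; [apply Cnorm_le_abs |].
  unfold Rdist, Csub, Cadd, Copp, Rminus in *; simpl in *; lra.
Qed.

(** If the increments of [u] are dominated by the decrements of a convergent real sequence, then [u]
    is Cauchy, and summing the increments also gives the explicit distance to the limit. Series and
    infinite products both converge through this. *)
Lemma C_cv_telescope u e L n0 : Un_cv e L ->
  (forall n, (n0 <= n)%nat -> Cnorm (Csub (u (S n)) (u n)) <= e n - e (S n)) ->
  exists l, C_cv u l /\ forall n, (n0 <= n)%nat -> Cnorm (Csub l (u n)) <= e n - L.
Proof.
  intros He H.
  assert (Hd : forall n k, (n0 <= n)%nat -> Cnorm (Csub (u (n + k)%nat) (u n)) <= e n - e (n + k)%nat).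
  { intros n k Hn; induction k.
    - rewrite Nat.add_0_r; replace (Csub (u n) (u n)) with C0 by ring; rewrite Cnorm_0; lra.
    - rewrite Nat.add_succ_r.
      pose proof (Cnorm_sub3 (u (S (n + k))) (u (n + k)%nat) (u n)).
      specialize (H (n + k)%nat ltac:(lia)); lra. }
  destruct (C_cv_cauchy u) as [l Hl].
  { intros eps Hp; destruct (He (eps / 2)) as [n1 H1]; [lra |]; exists (n0 + n1)%nat.
    intros n m Hn Hm; replace m with (n + (m - n))%nat by lia.
    eapply Rle_lt_trans; [apply Hd; lia |].
    pose proof (H1 n ltac:(lia)) as Ha; pose proof (H1 (n + (m - n))%nat ltac:(lia)) as Hb.
    unfold Rdist in *; apply Rabs_def2 in Ha; apply Rabs_def2 in Hb; lra. }
  exists l; split; [exact Hl |]; intros n Hn.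
  apply (Un_cv_le (fun k => Cnorm (Csub (u k) (u n))) (fun k => e n - e k)).
  - exists n; intros k Hk; replace k with (n + (k - n))%nat by lia; apply Hd, Hn.
  - apply C_cv_norm, C_cv_sub; [exact Hl | apply C_cv_const].
  - apply (CV_minus (fun _ => e n)); [apply Un_cv_const | exact He].
Qed.

Lemma Rsum_le_lim m S n : (forall k, 0 <= m k) -> Un_cv (Rsum m) S -> Rsum m n <= S.
Proof.
  intros Hp H; apply (growing_ineq (Rsum m)); [| exact H].
  intros k; rewrite Rsum_S; specialize (Hp k); lra.
Qed.

Lemma Rsum_cv_bounded m B : (forall k, 0 <= m k) -> (forall n, Rsum m n <= B) ->
  exists S, Un_cv (Rsum m) S /\ S <= B.
Proof.
  intros Hp HB; destruct (growing_cv (Rsum m)) as [S HS].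
  - intros k; rewrite Rsum_S; specialize (Hp k); lra.
  - exists B; intros x [n ->]; apply HB.
  - exists S; split; [exact HS |].
    apply (Un_cv_le (Rsum m) (fun _ => B) S B); [exists 0%nat; auto | exact HS | apply Un_cv_const].
Qed.

Lemma series_dominated a m S : (forall k, Cnorm (a k) <= m k) -> Un_cv (Rsum m) S ->
  exists l, C_cv (Csum a) l /\ forall n, Cnorm (Csub l (Csum a n)) <= S - Rsum m n.
Proof.
  intros H HS.
  destruct (C_cv_telescope (Csum a) (fun n => S - Rsum m n) 0 0) as [l [Hl Hn]].
  - replace 0 with (S - S) by ring; apply (CV_minus (fun _ => S)); [apply Un_cv_const | exact HS].
  - intros n _; rewrite Csum_S, Rsum_S.
    replace (Csub _ _) with (a n) by ring; specialize (H n); lra.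
  - exists l; split; [exact Hl |]; intros n; specialize (Hn n ltac:(lia)); lra.
Qed.

Lemma series_tail a m S l : (forall k, Cnorm (a k) <= m k) -> Un_cv (Rsum m) S ->
  C_cv (Csum a) l -> forall n, Cnorm (Csub l (Csum a n)) <= S - Rsum m n.
Proof.
  intros H HS Hl n; destruct (series_dominated a m S H HS) as [l' [Hl' Hn]].
  rewrite (C_cv_unique _ _ _ Hl Hl'); apply Hn.
Qed.

Lemma C_cv_Csum (a : nat -> nat -> Cplx) A n :
  (forall k, (k < n)%nat -> C_cv (fun K => a K k) (A k)) ->
  C_cv (fun K => Csum (a K) n) (Csum A n).
Proof.
  induction n; intros H; [apply (C_cv_const C0) |].
  apply (C_cv_add (fun K => Csum (a K) n)); auto.
Qed.

(** The sums [s K] enter only through their distance to partial sums of row K. The statement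
    therefore covers both full series and finite sums whose length grows with K, which are the next
    two lemmas. *)
Lemma tannery (a : nat -> nat -> Cplx) A m S s l :
  (forall k, C_cv (fun K => a K k) (A k)) ->
  (forall K n, (n <= K)%nat -> Cnorm (Csub (s K) (Csum (a K) n)) <= S - Rsum m n) ->
  Un_cv (Rsum m) S -> C_cv (Csum A) l -> C_cv s l.
Proof.
  intros Hk Hd HS Hl eps He.
  destruct (HS (eps / 3)) as [n1 H1]; [lra |].
  destruct (Hl (eps / 3)) as [n2 H2]; [lra |].
  pose (n := (n1 + n2)%nat).
  destruct (C_cv_Csum a A n (fun k _ => Hk k) (eps / 3)) as [K1 H3]; [lra |].
  exists (K1 + n)%nat; intros K HK.
  pose proof (Hd K n ltac:(lia)) as HdK.
  specialize (H1 n ltac:(lia)); specialize (H2 n ltac:(lia)); specialize (H3 K ltac:(lia)).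
  unfold Rdist in H1; apply Rabs_def2 in H1.
  pose proof (Cnorm_sub3 (s K) (Csum (a K) n) l).
  pose proof (Cnorm_sub3 (Csum (a K) n) (Csum A n) l); lra.
Qed.

Lemma tannery_series (a : nat -> nat -> Cplx) A m S s l :
  (forall k, C_cv (fun K => a K k) (A k)) ->
  (forall K k, Cnorm (a K k) <= m k) ->
  (forall K, C_cv (Csum (a K)) (s K)) ->
  Un_cv (Rsum m) S -> C_cv (Csum A) l -> C_cv s l.
Proof.
  intros Hk Hm Hs HS Hl; apply (tannery a A m S s l); try assumption.
  intros K n _; apply (series_tail (a K) m S (s K)); auto.
Qed.

Lemma tannery_finite (a : nat -> nat -> Cplx) A m S l :
  (forall k, C_cv (fun K => a K k) (A k)) ->
  (forall K k, (k < K)%nat -> Cnorm (a K k) <= m k) -> (forall k, 0 <= m k) ->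
  Un_cv (Rsum m) S -> C_cv (Csum A) l -> C_cv (fun K => Csum (a K) K) l.
Proof.
  intros Hk Hm Hp HS Hl; apply (tannery a A m S _ l); try assumption.
  intros K n Hn; eapply Rle_trans.
  - apply (Csum_diff_le (a K) m n K Hn); intros; apply Hm; lia.
  - pose proof (Rsum_le_lim m S K Hp HS); lra.
Qed.

Lemma Rsum_inv_sqr n : Rsum (fun k => / (INR k + 1) ^ 2) (S n) <= 2 - / (INR n + 1).
Proof.
  induction n; [simpl; lra |]; rewrite Rsum_S, S_INR.
  pose proof (pos_INR n) as Hp.
  assert (/ (INR n + 1 + 1) ^ 2 <= / ((INR n + 1) * (INR n + 1 + 1)))
    by (apply Rinv_le_contravar; nra).
  assert (E : / ((INR n + 1) * (INR n + 1 + 1)) = / (INR n + 1) - / (INR n + 1 + 1)) by (field; lra).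
  lra.
Qed.

(** The one majorant used throughout: each dominated series below is bounded by a multiple of the
    sum of 1/(k+1)^2. *)
Lemma series_inv_sqr_cv c : 0 <= c -> exists S, Un_cv (Rsum (fun k => c * / (INR k + 1) ^ 2)) S.
Proof.
  intros Hc.
  assert (Hp : forall k, 0 < / (INR k + 1) ^ 2)
    by (intros k; pose proof (pos_INR k); apply Rinv_0_lt_compat, pow_lt; lra).
  destruct (Rsum_cv_bounded (fun k => / (INR k + 1) ^ 2) 2) as [S [HS _]].
  - intros k; left; apply Hp.
  - intros n; destruct n; [simpl; lra |].
    pose proof (Rsum_inv_sqr n); pose proof (pos_INR n).
    assert (0 < / (INR n + 1)) by (apply Rinv_0_lt_compat; lra); lra.
  - exists (c * S); apply (Un_cv_ext (fun n => c * Rsum (fun k => / (INR k + 1) ^ 2) n)).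
    + intros n; rewrite Rsum_scal; reflexivity.
    + apply Un_cv_scal, HS.
Qed.

Lemma Un_cv_geom u rho n0 : 0 <= rho < 1 -> (forall n, 0 <= u n) ->
  (forall n, (n0 <= n)%nat -> u (S n) <= rho * u n) -> Un_cv u 0.
Proof.
  intros Hr Hp H.
  assert (Hk : forall k, u (n0 + k)%nat <= rho ^ k * u n0).
  { induction k; [rewrite Nat.add_0_r; simpl; lra |].
    rewrite Nat.add_succ_r; simpl; specialize (H (n0 + k)%nat ltac:(lia)).
    rewrite Rmult_assoc; eapply Rle_trans; [apply H | apply Rmult_le_compat_l; lra]. }
  intros eps He.
  destruct (pow_lt_1_zero rho) with (y := eps / (u n0 + 1)) as [N HN].
  - rewrite Rabs_pos_eq; lra.
  - apply Rdiv_lt_0_compat; [lra | specialize (Hp n0); lra].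
  - exists (n0 + N)%nat; intros n Hn; unfold Rdist; rewrite Rminus_0_r, Rabs_pos_eq by apply Hp.
    specialize (Hk (n - n0)%nat); replace (n0 + (n - n0))%nat with n in Hk by lia.
    specialize (HN (n - n0)%nat ltac:(lia)); rewrite Rabs_pos_eq in HN by (apply pow_le; lra).
    pose proof (Hp n0).
    assert (rho ^ (n - n0) * (u n0 + 1) < eps).
    { apply (Rmult_lt_compat_r (u n0 + 1)) in HN; [| lra].
      replace (eps / (u n0 + 1) * (u n0 + 1)) with eps in HN by (field; lra); exact HN. }
    assert (0 <= rho ^ (n - n0)) by (apply pow_le; lra); nra.
Qed.

Lemma Rabs_ln_le x a : 1 <= a -> / a <= x <= a -> Rabs (ln x) <= ln a.
Proof.
  intros Ha Hx; assert (0 < / a) by (apply Rinv_0_lt_compat; lra).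
  apply Rabs_le; split.
  - rewrite <- ln_Rinv by lra; apply ln_le; lra.
  - apply ln_le; lra.
Qed.

Lemma exp_le x y : x <= y -> exp x <= exp y.
Proof. intros [H | ->]; [left; apply exp_increasing, H | right; reflexivity]. Qed.

(** A crude bound, uniform on a half-annulus. It serves to bound derivatives along a segment, where
    only the independence of the point matters. *)
Lemma Cnorm_pow_bound z w a : 0 < fst z -> 1 <= a -> / a <= Cnorm z <= a ->
  Cnorm (Cpow z w) <= exp (Rabs (fst w) * ln a + Rabs (snd w) * PI).
Proof.
  intros Hz Ha Hn; rewrite Cnorm_pow by exact Hz; apply exp_le.
  pose proof (Rabs_ln_le _ _ Ha Hn) as H1.
  assert (H2 : Rabs (atan (snd z / fst z)) <= PI).
  { pose proof (atan_bound (snd z / fst z)); pose proof PI_RGT_0; apply Rabs_le; lra. }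
  pose proof (Rle_abs (fst w * ln (Cnorm z))) as H3; rewrite Rabs_mult in H3.
  pose proof (Rle_abs (- (snd w * atan (snd z / fst z)))) as H4.
  rewrite Rabs_Ropp, Rabs_mult in H4.
  pose proof (Rmult_le_compat_l _ _ _ (Rabs_pos (fst w)) H1).
  pose proof (Rmult_le_compat_l _ _ _ (Rabs_pos (snd w)) H2); lra.
Qed.

(** * The binomial series *)

(** The Pochhammer symbol over j!, that is, the coefficient of q^j in (1-q)^(-z). *)
Definition rising (z : Cplx) (j : nat) : Cplx :=
  Cdiv (Cprod (fun i => Cadd z (RtoC (INR i))) j) (RtoC (INR (fact j))).

Lemma RtoC_fact_neq0 n : RtoC (INR (fact n)) <> C0.
Proof. apply RtoC_neq0, INR_fact_neq_0. Qed.

Lemma RtoC_S_neq0 n : Cadd (RtoC (INR n)) C1 <> C0.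
Proof. rewrite <- RtoC_S; apply RtoC_neq0, not_0_INR; lia. Qed.

Lemma RtoC_fact_S n : RtoC (INR (fact (S n))) = Cmul (Cadd (RtoC (INR n)) C1) (RtoC (INR (fact n))).
Proof. rewrite fact_simpl, mult_INR, RtoC_mul, RtoC_S; reflexivity. Qed.

Lemma rising_0 z : rising z 0 = C1.
Proof.
  unfold rising; simpl; change (1, 0) with C1.
  field; apply RtoC_neq0; lra.
Qed.

Lemma rising_S z j :
  Cmul (Cadd (RtoC (INR j)) C1) (rising z (S j)) = Cmul (Cadd z (RtoC (INR j))) (rising z j).
Proof.
  unfold rising; rewrite RtoC_fact_S, Cprod_S.
  field; split; [apply RtoC_fact_neq0 | apply RtoC_S_neq0].
Qed.

Lemma Cderiv_monomial c n x :
  Cderiv (fun t => Cmul c (RtoC (t ^ n))) x (Cmul c (RtoC (INR n * x ^ pred n))).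
Proof.
  apply Cderiv_scal, Cderiv_RtoC.
  auto_derive; [trivial | ring].
Qed.

Lemma fst_sub_mul_gt0 q x : Cnorm q < 1 -> 0 <= x <= 1 -> 0 < fst (Csub C1 (Cmul q (RtoC x))).
Proof.
  intros Hq Hx; unfold Csub, Cadd, Copp, Cmul, RtoC; simpl.
  pose proof (fst_le_Cnorm q); pose proof (Rle_abs (fst q)); pose proof (Cnorm_ge0 q).
  assert (fst q * x <= Cnorm q * x) by (apply Rmult_le_compat_r; lra).
  assert (Cnorm q * x <= Cnorm q * 1) by (apply Rmult_le_compat_l; lra); lra.
Qed.

Definition bpoly (z q : Cplx) (J : nat) (x : R) : Cplx :=
  Csum (fun j => Cmul (Cmul (rising z j) (Cpown q j)) (RtoC (x ^ j))) J.

(** Multiplying a partial sum of the series for (1-qx)^(-z) by (1-qx)^z gives a function close to 1.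
    In its derivative the recurrence [rising_S] cancels every power of x except the last, so the
    derivative is explicit and small. *)
Lemma bpoly_deriv z q J x : Cnorm q < 1 -> 0 <= x <= 1 ->
  Cderiv (fun t => Cmul (bpoly z q J t) (Cpow (Csub C1 (Cmul q (RtoC t))) z)) x
    (Copp (Cmul (Cmul (Cmul (rising z J) (Cpown q J)) (RtoC (INR J * x ^ pred J)))
       (Cpow (Csub C1 (Cmul q (RtoC x))) (Csub z C1)))).
Proof.
  intros Hq Hx; pose proof (fst_sub_mul_gt0 q x Hq Hx) as Hp.
  eapply Cderiv_eq.
  - apply Cderiv_mul.
    + apply (Cderiv_Csum (fun j t => Cmul (Cmul (rising z j) (Cpown q j)) (RtoC (t ^ j)))
        (fun j t => Cmul (Cmul (rising z j) (Cpown q j)) (RtoC (INR j * t ^ pred j)))).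
      intros; apply Cderiv_monomial.
    + apply Cderiv_pow; [exact Hp |].
      apply Cderiv_sub; [apply Cderiv_const | apply Cderiv_scal, Cderiv_id].
  - cbv beta; set (W := Csub C1 (Cmul q (RtoC x))) in *.
    replace (Cpow W z) with (Cmul (Cpow W (Csub z C1)) W)
      by (rewrite Cpow_sub1 by exact Hp; field; apply fst_gt0_neq0, Hp).
    set (P := Cpow W (Csub z C1)); unfold bpoly.
    set (T := fun j => Cmul (Cmul (rising z j) (Cpown q j)) (RtoC (INR j * x ^ pred j))).
    assert (E : Csub (Cmul (Csum T J) W)
      (Cmul (Cmul z q) (Csum (fun j => Cmul (Cmul (rising z j) (Cpown q j)) (RtoC (x ^ j))) J))
      = Copp (T J)).
    { clear P; induction J.
      - rewrite !Csum_0; unfold T; simpl; rewrite Rmult_0_l; ring.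
      - rewrite !Csum_S.
        match goal with |- Csub (Cmul (Cadd ?a ?b) ?c) (Cmul ?d (Cadd ?e ?f)) = _ =>
          replace (Csub (Cmul (Cadd a b) c) (Cmul d (Cadd e f))) with
            (Cadd (Csub (Cmul a c) (Cmul d e)) (Csub (Cmul b c) (Cmul d f))) by ring end.
        rewrite IHJ; unfold T, W; simpl (pred (S J)); simpl (Cpown q (S J)).
        replace (rising z (S J)) with
          (Cdiv (Cmul (Cadd z (RtoC (INR J))) (rising z J)) (Cadd (RtoC (INR J)) C1))
          by (rewrite <- rising_S; field; apply RtoC_S_neq0).
        rewrite !RtoC_mul, RtoC_S.
        (* For J = 0 the exponent [pred 0] is 0 rather than -1, but the factor [INR 0] removes that
           term. *)
        destruct J; simpl pred; simpl pow.
        + simpl INR; field; try (apply RtoC_neq0; lra); apply (RtoC_S_neq0 0).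
        + rewrite !RtoC_mul; field; apply RtoC_S_neq0. }
    change (Cmul (Cmul (rising z J) (Cpown q J)) (RtoC (INR J * x ^ pred J))) with (T J).
    replace (Copp (Cmul (T J) P)) with (Cmul (Copp (T J)) P) by ring.
    rewrite <- E; ring.
Qed.

(** Ratio test. The ratio of consecutive terms is |z+n| r / n, which is at most (1+r)/2 once n
    exceeds 2(|z|+1)/(1-r). *)
Lemma rising_geom_cv0 z r : 0 <= r < 1 -> Un_cv (fun J => INR J * (Cnorm (rising z J) * r ^ J)) 0.
Proof.
  intros Hr; pose proof (Cnorm_ge0 z) as Hz.
  destruct (archimed_cor1 ((1 - r) / (2 * (Cnorm z + 1)))) as [n0 [Hn0 Hp0]].
  { apply Rdiv_lt_0_compat; lra. }
  apply (Un_cv_geom _ ((1 + r) / 2) n0); [lra | |].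
  - intros n; apply Rmult_le_pos; [apply pos_INR |].
    apply Rmult_le_pos; [apply Cnorm_ge0 | apply pow_le; lra].
  - intros n Hn.
    assert (Hn0' : 0 < INR n0) by (apply lt_0_INR; lia).
    assert (Hnn : INR n0 <= INR n) by (apply le_INR; exact Hn).
    assert (E : INR (S n) * Cnorm (rising z (S n)) = Cnorm (Cadd z (RtoC (INR n))) * Cnorm (rising z n)).
    { rewrite <- Cnorm_mul, <- rising_S, Cnorm_mul, <- RtoC_S, Cnorm_RtoC, Rabs_pos_eq; [ring | apply pos_INR]. }
    replace (INR (S n) * (Cnorm (rising z (S n)) * r ^ S n))
      with ((INR (S n) * Cnorm (rising z (S n))) * (r * r ^ n)) by (simpl; ring).
    rewrite E.
    assert (H1 : Cnorm (Cadd z (RtoC (INR n))) <= Cnorm z + INR n).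
    { eapply Rle_trans; [apply Cnorm_add |]; rewrite Cnorm_RtoC, Rabs_pos_eq by apply pos_INR; lra. }
    assert (H2 : (Cnorm z + INR n) * r <= (1 + r) / 2 * INR n).
    { assert (2 * (Cnorm z + 1) < (1 - r) * INR n0).
      { apply (Rmult_lt_compat_r (INR n0 * (2 * (Cnorm z + 1)))) in Hn0; [| nra].
        replace (/ INR n0 * (INR n0 * (2 * (Cnorm z + 1)))) with (2 * (Cnorm z + 1)) in Hn0 by (field; lra).
        replace ((1 - r) / (2 * (Cnorm z + 1)) * (INR n0 * (2 * (Cnorm z + 1))))
          with ((1 - r) * INR n0) in Hn0 by (field; lra); exact Hn0. }
      assert ((1 - r) * INR n0 <= (1 - r) * INR n) by (apply Rmult_le_compat_l; lra).
      nra. }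
    assert (H3 : 0 <= Cnorm (rising z n) * r ^ n)
      by (apply Rmult_le_pos; [apply Cnorm_ge0 | apply pow_le; lra]).
    replace (Cnorm (Cadd z (RtoC (INR n))) * Cnorm (rising z n) * (r * r ^ n))
      with ((Cnorm (Cadd z (RtoC (INR n))) * r) * (Cnorm (rising z n) * r ^ n)) by ring.
    replace ((1 + r) / 2 * (INR n * (Cnorm (rising z n) * r ^ n)))
      with ((1 + r) / 2 * INR n * (Cnorm (rising z n) * r ^ n)) by ring.
    apply Rmult_le_compat_r; [exact H3 | nra].
Qed.

(** The product of the partial sum and (1-qx)^z equals 1 at x = 0. The mean value inequality on
    [0,1] carries this to x = 1, up to a constant times J |[rising z J]| |q|^J, which tends to 0. *)
Lemma binomial_series z q : Cnorm q < 1 ->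
  C_cv (Csum (fun j => Cmul (rising z j) (Cpown q j))) (Cpow (Csub C1 q) (Copp z)).
Proof.
  intros Hq; pose proof (Cnorm_ge0 q) as Hq0.
  (* On the segment, 1 - qx has modulus between 1 - |q| and 2, so between 1/a and a. *)
  set (a := Rmax 2 (/ (1 - Cnorm q))).
  assert (Ha : 2 <= a) by apply Rmax_l.
  assert (Hb : / (1 - Cnorm q) <= a) by apply Rmax_r.
  assert (Hai : / a <= 1 - Cnorm q).
  { rewrite <- (Rinv_inv (1 - Cnorm q)); apply Rinv_le_contravar; [| exact Hb].
    apply Rinv_0_lt_compat; lra. }
  set (B := exp (Rabs (fst (Csub z C1)) * ln a + Rabs (snd (Csub z C1)) * PI)).
  set (W := fun x => Csub C1 (Cmul q (RtoC x))).
  assert (HB : forall x, 0 <= x <= 1 -> Cnorm (Cpow (W x) (Csub z C1)) <= B).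
  { intros x Hx; apply Cnorm_pow_bound; [apply fst_sub_mul_gt0; assumption | lra |].
    assert (Cnorm (Cmul q (RtoC x)) <= Cnorm q)
      by (rewrite Cnorm_mul, Cnorm_RtoC, Rabs_pos_eq by lra; nra).
    pose proof (Cnorm_sub C1 (Cmul q (RtoC x))) as H1.
    pose proof (Cnorm_add (Csub C1 (Cmul q (RtoC x))) (Cmul q (RtoC x))) as H2.
    replace (Cadd (Csub C1 (Cmul q (RtoC x))) (Cmul q (RtoC x))) with C1 in H2 by ring.
    rewrite Cnorm_1 in *; unfold W; split; lra. }
  assert (HB0 : 0 < B) by apply exp_pos.
  pose proof (fst_sub_mul_gt0 q 1 Hq ltac:(lra)) as Hp.
  replace (Csub C1 (Cmul q (RtoC 1))) with (Csub C1 q) in Hp by ring.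
  assert (Hlim : C_cv (fun J => Cmul (bpoly z q (S J) 1) (Cpow (Csub C1 q) z)) C1).
  { apply (C_cv_le _ _ (fun J => B * (INR (S J) * (Cnorm (rising z (S J)) * Cnorm q ^ S J)))).
    - exists 0%nat; intros J _.
      pose (f := fun t => Cmul (bpoly z q (S J) t) (Cpow (W t) z)).
      replace (Csub _ C1) with (Csub (f 1) (f 0)).
      2:{ unfold f, W, bpoly; f_equal.
          - f_equal; f_equal; ring.
          - rewrite Csum_S_l, rising_0.
            replace (Csum _ J) with C0.
            + replace (Csub C1 (Cmul q C0)) with C1 by ring; rewrite Cpow_RtoC_1.
              simpl; change (1, 0) with C1; ring.
            + clear; induction J; [reflexivity |]; rewrite Csum_S, <- IHJ; simpl.
              rewrite Rmult_0_l; ring. }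
      set (A := B * (INR (S J) * (Cnorm (rising z (S J)) * Cnorm q ^ S J))).
      assert (HA : 0 <= A).
      { unfold A; apply Rmult_le_pos; [lra |]; apply Rmult_le_pos; [apply pos_INR |].
        apply Rmult_le_pos; [apply Cnorm_ge0 | apply pow_le, Hq0]. }
      replace A with (A * 1 - A * 0) by ring.
      apply (mvt_cmp f (fun x => Copp (Cmul (Cmul (Cmul (rising z (S J)) (Cpown q (S J)))
          (RtoC (INR (S J) * x ^ pred (S J)))) (Cpow (W x) (Csub z C1))))
        (fun x => A * x) (fun _ => A)); [lra | | |].
      + intros x Hx; apply bpoly_deriv; assumption.
      + intros x _; auto_derive; [trivial | ring].
      + intros x Hx; rewrite Cnorm_opp, !Cnorm_mul, Cnorm_pown, Cnorm_RtoC.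
        rewrite Rabs_pos_eq by (apply Rmult_le_pos; [apply pos_INR | apply pow_le; lra]).
        assert (Hx1 : x ^ pred (S J) <= 1) by (rewrite <- (pow1 (pred (S J))); apply pow_incr; lra).
        assert (0 <= x ^ pred (S J)) by (apply pow_le; lra).
        pose proof (HB x Hx) as HBx.
        set (u := Cnorm (rising z (S J)) * Cnorm q ^ S J * INR (S J)).
        assert (Hu : 0 <= u).
        { apply Rmult_le_pos; [| apply pos_INR].
          apply Rmult_le_pos; [apply Cnorm_ge0 | apply pow_le, Hq0]. }
        replace (Cnorm (rising z (S J)) * Cnorm q ^ S J * (INR (S J) * x ^ pred (S J)))
          with (u * x ^ pred (S J)) by (unfold u; ring).
        replace A with (u * 1 * B) by (unfold A, u; ring).
        apply Rmult_le_compat; [apply Rmult_le_pos; lra | apply Cnorm_ge0 | | exact HBx].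
        apply Rmult_le_compat_l; lra.
    - replace 0 with (B * 0) by ring; apply Un_cv_scal.
      intros eps He; destruct (rising_geom_cv0 z (Cnorm q) ltac:(lra) eps He) as [n0 H].
      exists n0; intros; apply H; lia. }
  apply C_cv_unshift.
  assert (Hn : Csub C1 q <> C0) by apply fst_gt0_neq0, Hp.
  pose proof (Cpow_neq0 _ z Hn) as Hn'.
  apply (C_cv_ext (fun J => Cmul (Cinv (Cpow (Csub C1 q) z))
    (Cmul (bpoly z q (S J) 1) (Cpow (Csub C1 q) z)))).
  - intros J; replace (Csum _ (S J)) with (bpoly z q (S J) 1); [field; exact Hn' |].
    apply Csum_ext; intros; rewrite pow1; ring.
  - rewrite Cpow_opp by exact Hn.
    pose proof (C_cv_scal (Cinv (Cpow (Csub C1 q) z)) _ _ Hlim) as H.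
    replace (Cmul (Cinv (Cpow (Csub C1 q) z)) C1) with (Cinv (Cpow (Csub C1 q) z)) in H by ring.
    exact H.
Qed.

Lemma exp_ge_1_plus x : 1 + x <= exp x.
Proof. destruct (Req_dec x 0) as [-> | H]; [rewrite exp_0; lra | left; apply exp_ineq1, H]. Qed.

(** * The Gauss product for the Gamma function *)

(** Since 1 + x <= e^x and 1/(n+1)^2 <= 1/n - 1/(n+1), the partial products stay bounded. Their
    increments are then dominated by a telescoping sequence. *)
Lemma infinite_product_cv (p eps : nat -> Cplx) K n0 : (0 < n0)%nat -> 0 <= K ->
  (forall n, (n0 <= n)%nat -> p (S n) = Cmul (p n) (Cadd C1 (eps n))) ->
  (forall n, (n0 <= n)%nat -> Cnorm (eps n) <= K * (/ (INR n + 1)) ^ 2) ->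
  exists l, C_cv p l.
Proof.
  intros Hn0 HK Hp He.
  assert (Hsq : forall n, (n0 <= n)%nat -> (/ (INR n + 1)) ^ 2 <= / INR n - / INR (S n)).
  { intros n Hn; assert (0 < INR n) by (apply lt_0_INR; lia); rewrite S_INR.
    replace (/ INR n - / (INR n + 1)) with (/ (INR n * (INR n + 1))) by (field; lra).
    replace ((/ (INR n + 1)) ^ 2) with (/ ((INR n + 1) * (INR n + 1))) by (field; lra).
    apply Rinv_le_contravar; nra. }
  set (B := Cnorm (p n0) * exp (K * / INR n0)).
  assert (HB : forall k, Cnorm (p (n0 + k)%nat) <= Cnorm (p n0) * exp (K * (/ INR n0 - / INR (n0 + k)))).
  { induction k.
    - rewrite Nat.add_0_r, Rminus_diag, Rmult_0_r, exp_0; lra.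
    - rewrite Nat.add_succ_r, Hp, Cnorm_mul by lia.
      replace (K * (/ INR n0 - / INR (S (n0 + k)))) with
        (K * (/ INR n0 - / INR (n0 + k)) + K * (/ INR (n0 + k) - / INR (S (n0 + k)))) by ring.
      rewrite exp_plus, <- Rmult_assoc.
      apply Rmult_le_compat; [apply Cnorm_ge0 | apply Cnorm_ge0 | exact IHk |].
      eapply Rle_trans; [apply Cnorm_add |]; rewrite Cnorm_1.
      eapply Rle_trans; [apply exp_ge_1_plus |]; apply exp_le.
      eapply Rle_trans; [apply He; lia |].
      apply Rmult_le_compat_l; [exact HK | apply Hsq; lia]. }
  destruct (C_cv_telescope p (fun n => B * K * / INR n) 0 n0) as [l [Hl _]].
  - replace 0 with (B * K * 0) by ring; apply Un_cv_scal, Un_cv_inv_INR.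
  - intros n Hn; rewrite Hp by exact Hn.
    replace (Csub _ (p n)) with (Cmul (p n) (eps n)) by ring.
    replace (B * K * / INR n - B * K * / INR (S n)) with (B * (K * (/ INR n - / INR (S n)))) by ring.
    rewrite Cnorm_mul; apply Rmult_le_compat; [apply Cnorm_ge0 | apply Cnorm_ge0 | |].
    + replace n with (n0 + (n - n0))%nat by lia.
      eapply Rle_trans; [apply HB |]; apply Rmult_le_compat_l; [apply Cnorm_ge0 |].
      apply exp_le; apply Rmult_le_compat_l; [exact HK |].
      assert (0 < / INR (n0 + (n - n0))) by (apply Rinv_0_lt_compat, lt_0_INR; lia); lra.
    + eapply Rle_trans; [apply He, Hn |].
      apply Rmult_le_compat_l; [exact HK | apply Hsq, Hn].
  - exists l; exact Hl.
Qed.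

(** Second order Taylor bound for (1-h)^w at h = 0: the mean value inequality is applied to the
    derivative and then to the function. It shows that the factors of the Gauss product are 1 +
    O(1/n^2). *)
Lemma pow_one_minus_taylor (w : Cplx) : exists K, 0 <= K /\ forall h, 0 <= h <= / 2 ->
  Cnorm (Csub (Cpow (RtoC (1 - h)) w) (Csub C1 (Cmul w (RtoC h)))) <= K * h ^ 2.
Proof.
  set (B := exp (Rabs (fst (Csub (Csub w C1) C1)) * ln 2 + Rabs (snd (Csub (Csub w C1) C1)) * PI)).
  assert (HB0 : 0 < B) by apply exp_pos.
  pose proof (Cnorm_ge0 w) as Hw; pose proof (Cnorm_ge0 (Csub w C1)) as Hw1.
  set (K := Cnorm w * (Cnorm (Csub w C1) * B)).
  assert (HK : 0 <= K) by (apply Rmult_le_pos; [| apply Rmult_le_pos]; lra).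
  assert (Hd : forall u x, x <= / 2 ->
    Cderiv (fun t => Cpow (RtoC (1 - t)) u) x (Cmul (Copp u) (Cpow (RtoC (1 - x)) (Csub u C1)))).
  { intros u x Hx; eapply Cderiv_eq.
    - apply (Cderiv_pow (fun t => RtoC (1 - t)) u x (RtoC (- (1)))); [simpl; lra |].
      apply Cderiv_RtoC; auto_derive; [trivial | ring].
    - rewrite RtoC_opp; ring. }
  assert (Hg : forall x, 0 <= x <= / 2 ->
    Cnorm (Csub (Cpow (RtoC (1 - x)) (Csub w C1)) C1) <= Cnorm (Csub w C1) * B * x).
  { intros x Hx.
    pose (f := fun t => Cpow (RtoC (1 - t)) (Csub w C1)).
    replace (Csub (Cpow (RtoC (1 - x)) (Csub w C1)) C1) with (Csub (f x) (f 0))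
      by (unfold f; rewrite Rminus_0_r, Cpow_RtoC_1; reflexivity).
    replace (Cnorm (Csub w C1) * B * x) with
      (Cnorm (Csub w C1) * B * x - Cnorm (Csub w C1) * B * 0) by ring.
    apply (mvt_cmp f (fun t => Cmul (Copp (Csub w C1)) (Cpow (RtoC (1 - t)) (Csub (Csub w C1) C1)))
      (fun t => Cnorm (Csub w C1) * B * t) (fun _ => Cnorm (Csub w C1) * B)); [lra | | |].
    - intros t Ht; apply Hd; lra.
    - intros t _; auto_derive; [trivial | ring].
    - intros t Ht; rewrite Cnorm_mul, Cnorm_opp; apply Rmult_le_compat_l; [lra |].
      apply Cnorm_pow_bound; [simpl; lra | lra |].
      rewrite Cnorm_RtoC, Rabs_pos_eq; lra. }
  exists K; split; [exact HK |]; intros h Hh.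
  pose (f := fun t => Csub (Cpow (RtoC (1 - t)) w) (Csub C1 (Cmul w (RtoC t)))).
  replace (Csub (Cpow (RtoC (1 - h)) w) (Csub C1 (Cmul w (RtoC h)))) with (Csub (f h) (f 0)).
  2:{ unfold f; rewrite Rminus_0_r, Cpow_RtoC_1; ring. }
  apply Rle_trans with (K / 2 * h ^ 2 - K / 2 * 0 ^ 2); [| nra].
  apply (mvt_cmp f (fun t => Cmul (Copp w) (Csub (Cpow (RtoC (1 - t)) (Csub w C1)) C1))
    (fun t => K / 2 * t ^ 2) (fun t => K * t)); [lra | | |].
  - intros t Ht; eapply Cderiv_eq.
    + apply Cderiv_sub; [apply Hd; lra |].
      apply Cderiv_sub; [apply Cderiv_const | apply Cderiv_scal, Cderiv_id].
    + ring.
  - intros t _; auto_derive; [trivial | field].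
  - intros t Ht; rewrite Cnorm_mul, Cnorm_opp.
    replace (K * t) with (Cnorm w * (Cnorm (Csub w C1) * B * t)) by (unfold K; ring).
    apply Rmult_le_compat_l; [lra | apply Hg; lra].
Qed.

Definition gauss (z : Cplx) (n : nat) : Cplx :=
  Cdiv (Cmul (Cpow (RtoC (INR n)) z) (RtoC (INR (fact n))))
       (Cprod (fun k => Cadd z (RtoC (INR k))) (S n)).

Definition not_pole (z : Cplx) : Prop := forall k : nat, Cadd z (RtoC (INR k)) <> C0.

Lemma not_pole_gt0 z : 0 < fst z -> not_pole z.
Proof.
  intros H k; apply fst_gt0_neq0; unfold Cadd, RtoC; simpl; pose proof (pos_INR k); lra.
Qed.

Lemma Cprod_not_pole z n : not_pole z -> Cprod (fun k => Cadd z (RtoC (INR k))) n <> C0.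
Proof. intros H; apply Cprod_neq0; intros; apply H. Qed.

Lemma gauss_neq0 z n : not_pole z -> (0 < n)%nat -> gauss z n <> C0.
Proof.
  intros Hz Hn; pose proof (Cprod_not_pole z (S n) Hz) as Hp.
  assert (HP : Cpow (RtoC (INR n)) z <> C0) by (apply Cpow_neq0, RtoC_neq0, not_0_INR; lia).
  pose proof (RtoC_fact_neq0 n) as Hf.
  apply neq0_Cnorm; unfold gauss; rewrite Cnorm_div, Cnorm_mul by exact Hp.
  apply Rdiv_lt_0_compat; [apply Rmult_lt_0_compat |]; apply Cnorm_gt0; assumption.
Qed.

Lemma one_minus_inv_S_gt0 n : (0 < n)%nat -> 0 < 1 - / (INR n + 1).
Proof.
  intros Hn; assert (0 < INR n) by (apply lt_0_INR; lia).
  replace (1 - / (INR n + 1)) with (INR n / (INR n + 1)) by (field; lra).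
  apply Rdiv_lt_0_compat; lra.
Qed.

(** In the factor (1 - 1/(n+1))^z (1 + z/(n+1)) linking consecutive Gauss products the first order
    terms cancel, hence the convergence. *)
Lemma gauss_S z n : not_pole z -> (0 < n)%nat ->
  Cmul (gauss z (S n)) (Cmul (Cpow (RtoC (1 - / (INR n + 1))) z)
     (Cadd C1 (Cmul z (RtoC (/ (INR n + 1)))))) = gauss z n.
Proof.
  intros Hz Hn; pose proof (Cprod_not_pole z (S n) Hz) as Hp.
  assert (Hn' : 0 < INR n) by (apply lt_0_INR; lia).
  assert (E : Cpow (RtoC (INR n)) z =
    Cmul (Cpow (RtoC (INR (S n))) z) (Cpow (RtoC (1 - / (INR n + 1))) z)).
  { rewrite <- Cpow_RtoC_mul.
    - f_equal; f_equal; rewrite S_INR; field; lra.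
    - apply lt_0_INR; lia.
    - apply one_minus_inv_S_gt0, Hn. }
  assert (E2 : Cadd C1 (Cmul z (RtoC (/ (INR n + 1)))) =
     Cdiv (Cadd z (RtoC (INR (S n)))) (Cadd (RtoC (INR n)) C1)).
  { rewrite RtoC_inv, RtoC_add, RtoC_S by lra; field; apply RtoC_S_neq0. }
  unfold gauss; rewrite E, E2, RtoC_fact_S, (Cprod_S _ (S n)).
  field; repeat split; first [exact Hp | apply Hz | apply RtoC_S_neq0].
Qed.

(** The product criterion is applied both to the Gauss products and to their inverses. The two
    limits multiply to 1, so the limit is non-zero; this allows division by Gamma(z) later. *)
Lemma gauss_cv z : not_pole z -> exists G, G <> C0 /\ C_cv (gauss z) G.
Proof.
  intros Hz.
  destruct (pow_one_minus_taylor z) as [K1 [HK1 H1]].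
  destruct (pow_one_minus_taylor (Copp z)) as [K2 [HK2 H2]].
  pose proof (Cnorm_ge0 z) as Hz0.
  (* Beyond this index |z|/(n+1) <= 1/2, which keeps 1 + z/(n+1) away from 0. *)
  destruct (archimed_cor1 (/ (2 * (Cnorm z + 1)))) as [n0 [Hn0 Hp0]].
  { apply Rinv_0_lt_compat; lra. }
  assert (Hh : forall n, (n0 <= n)%nat -> 0 < / (INR n + 1) <= / 2 /\ Cnorm z * / (INR n + 1) <= / 2
    /\ (0 < n)%nat).
  { intros n Hn; assert (INR n0 <= INR n) by (apply le_INR; exact Hn).
    assert (0 < INR n0) by (apply lt_0_INR; lia).
    assert (0 < / (INR n + 1)) by (apply Rinv_0_lt_compat; lra).
    assert (1 <= INR n) by (apply (le_INR 1); lia).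
    assert (Hlt : / (INR n + 1) < / (2 * (Cnorm z + 1))).
    { eapply Rle_lt_trans; [| exact Hn0]; apply Rinv_le_contravar; lra. }
    split; [split; [assumption | apply Rinv_le_contravar; lra] |]; split; [| lia].
    apply (Rmult_lt_compat_l (Cnorm z + 1)) in Hlt; [| lra].
    replace ((Cnorm z + 1) * / (2 * (Cnorm z + 1))) with (/ 2) in * by (field; lra).
    lra. }
  assert (Hw : forall n, (n0 <= n)%nat -> / 2 <= Cnorm (Cadd C1 (Cmul z (RtoC (/ (INR n + 1)))))).
  { intros n Hn; destruct (Hh n Hn) as [Ha [Hb _]].
    set (y := Cmul z (RtoC (/ (INR n + 1)))).
    assert (Hy : Cnorm y <= / 2) by (unfold y; rewrite Cnorm_mul, Cnorm_RtoC, Rabs_pos_eq; lra).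
    pose proof (Cnorm_sub (Cadd C1 y) y) as H.
    replace (Csub (Cadd C1 y) y) with C1 in H by ring.
    rewrite Cnorm_1 in H; lra. }
  pose proof one_minus_inv_S_gt0 as Hpw.
  destruct (infinite_product_cv (gauss z)
    (fun n => Csub (Cdiv (Cpow (RtoC (1 - / (INR n + 1))) (Copp z))
      (Cadd C1 (Cmul z (RtoC (/ (INR n + 1)))))) C1) (2 * K2) n0) as [G HG]; [exact Hp0 | lra | | |].
  { intros n Hn; destruct (Hh n Hn) as [_ [_ Hn1]]; specialize (Hpw n Hn1).
    rewrite <- (gauss_S z n Hz Hn1), Cpow_opp by (apply RtoC_neq0; lra).
    pose proof (Cpow_neq0 _ z (RtoC_neq0 (1 - / (INR n + 1)) ltac:(lra))).
    assert (Cadd C1 (Cmul z (RtoC (/ (INR n + 1)))) <> C0)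
      by (apply neq0_Cnorm; specialize (Hw n Hn); lra).
    field; split; assumption. }
  { intros n Hn; destruct (Hh n Hn) as [Ha _]; specialize (Hw n Hn).
    assert (Hne : Cadd C1 (Cmul z (RtoC (/ (INR n + 1)))) <> C0) by (apply neq0_Cnorm; lra).
    specialize (H2 (/ (INR n + 1)) ltac:(lra)).
    match goal with |- Cnorm (Csub (Cdiv ?a ?b) C1) <= _ =>
      replace (Csub (Cdiv a b) C1) with (Cdiv (Csub a b) b) by (field; exact Hne) end.
    rewrite Cnorm_div by exact Hne.
    replace (Csub C1 (Cmul (Copp z) (RtoC (/ (INR n + 1))))) with
      (Cadd C1 (Cmul z (RtoC (/ (INR n + 1))))) in H2 by ring.
    set (e := Cnorm (Csub _ _)) in *.
    assert (Hi : / Cnorm (Cadd C1 (Cmul z (RtoC (/ (INR n + 1))))) <= 2).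
    { replace 2 with (/ / 2) by lra; apply Rinv_le_contravar; lra. }
    unfold Rdiv; replace (2 * K2 * (/ (INR n + 1)) ^ 2) with ((K2 * (/ (INR n + 1)) ^ 2) * 2) by ring.
    apply Rmult_le_compat; [apply Cnorm_ge0 | left; apply Rinv_0_lt_compat; lra | exact H2 | exact Hi]. }
  destruct (infinite_product_cv (fun n => Cinv (gauss z n))
    (fun n => Csub (Cmul (Cpow (RtoC (1 - / (INR n + 1))) z)
      (Cadd C1 (Cmul z (RtoC (/ (INR n + 1)))))) C1)
    (2 * K1 + Cnorm z * Cnorm z) n0) as [H HH]; [exact Hp0 | nra | | |].
  { intros n Hn; destruct (Hh n Hn) as [_ [_ Hn1]].
    rewrite <- (gauss_S z n Hz Hn1).
    pose proof (gauss_neq0 z (S n) Hz ltac:(lia)).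
    specialize (Hpw n Hn1).
    pose proof (Cpow_neq0 _ z (RtoC_neq0 (1 - / (INR n + 1)) ltac:(lra))).
    assert (Cadd C1 (Cmul z (RtoC (/ (INR n + 1)))) <> C0)
      by (apply neq0_Cnorm; specialize (Hw n Hn); lra).
    field; repeat split; assumption. }
  { intros n Hn; destruct (Hh n Hn) as [Ha [Hb _]].
    specialize (H1 (/ (INR n + 1)) ltac:(lra)).
    set (h := / (INR n + 1)) in *; set (P := Cpow (RtoC (1 - h)) z) in *.
    replace (Csub (Cmul P (Cadd C1 (Cmul z (RtoC h)))) C1) with
      (Cadd (Cmul (Csub P (Csub C1 (Cmul z (RtoC h)))) (Cadd C1 (Cmul z (RtoC h))))
        (Copp (Cmul (Cmul z z) (RtoC (h * h))))) by (rewrite RtoC_mul; ring).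
    eapply Rle_trans; [apply Cnorm_add |].
    rewrite Cnorm_opp, !Cnorm_mul, Cnorm_RtoC, (Rabs_pos_eq (h * h)) by nra.
    assert (Hle : Cnorm (Cadd C1 (Cmul z (RtoC h))) <= 2).
    { eapply Rle_trans; [apply Cnorm_add |].
      rewrite Cnorm_1, Cnorm_mul, Cnorm_RtoC, Rabs_pos_eq; lra. }
    replace ((2 * K1 + Cnorm z * Cnorm z) * h ^ 2) with
      (K1 * h ^ 2 * 2 + Cnorm z * Cnorm z * (h * h)) by ring.
    apply Rplus_le_compat_r, Rmult_le_compat; try apply Cnorm_ge0; assumption. }
  exists G; split; [| exact HG].
  intros E; assert (E1 : Cmul G H = C1).
  { apply (C_cv_unique (fun n => Cmul (gauss z n) (Cinv (gauss z n)))); [apply C_cv_mul; assumption |].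
    apply (C_cv_ext_from (fun _ => C1) _ C1 1); [| apply C_cv_const].
    intros n Hn; field; apply gauss_neq0; [exact Hz | lia]. }
  rewrite E in E1; apply (RtoC_neq0 1); [lra |]; rewrite <- E1; ring.
Qed.

Lemma Cgamma_cv z : not_pole z -> C_cv (gauss z) (Cgamma z).
Proof.
  intros H; destruct (gauss_cv z H) as [G [_ HG]].
  change (Cgamma z) with (Clim (gauss z)); rewrite (Clim_eq _ _ HG); exact HG.
Qed.

Lemma Cgamma_neq0 z : not_pole z -> Cgamma z <> C0.
Proof.
  intros H; destruct (gauss_cv z H) as [G [Hn HG]].
  rewrite (C_cv_unique _ _ _ (Cgamma_cv z H) HG); exact Hn.
Qed.

Lemma not_pole_add1 z : not_pole z -> not_pole (Cadd z C1).
Proof.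
  intros H k; replace (Cadd (Cadd z C1) (RtoC (INR k))) with (Cadd z (RtoC (INR (S k))))
    by (rewrite RtoC_S; ring); apply H.
Qed.

(** The Gauss products satisfy gauss(z+1) = z gauss(z) n/(z+1+n), and the last factor tends to 1. *)
Lemma Cgamma_add1 z : not_pole z -> Cgamma (Cadd z C1) = Cmul z (Cgamma z).
Proof.
  intros Hz; apply (C_cv_unique (gauss (Cadd z C1))); [apply Cgamma_cv, not_pole_add1, Hz |].
  pose proof (Cnorm_ge0 (Cadd z C1)) as Hn0.
  assert (HR : C_cv (fun n => Cdiv (RtoC (INR n)) (Cadd (Cadd z C1) (RtoC (INR n)))) C1).
  { destruct (archimed_cor1 (/ (2 * (Cnorm (Cadd z C1) + 1)))) as [n0 [Hn0' Hp0]].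
    { apply Rinv_0_lt_compat; lra. }
    apply (C_cv_le _ _ (fun n => Cnorm (Cadd z C1) * (2 * / INR n))).
    - exists n0; intros n Hn.
      assert (INR n0 <= INR n) by (apply le_INR; exact Hn).
      assert (0 < INR n0) by (apply lt_0_INR; lia).
      assert (Hbig : 2 * (Cnorm (Cadd z C1) + 1) < INR n0).
      { apply Rinv_lt_cancel; [lra |]; exact Hn0'. }
      set (W := Cadd (Cadd z C1) (RtoC (INR n))).
      assert (HW : INR n / 2 <= Cnorm W).
      { pose proof (Cnorm_sub W (Cadd z C1)) as Hs.
        replace (Csub W (Cadd z C1)) with (RtoC (INR n)) in Hs by (unfold W; ring).
        rewrite Cnorm_RtoC, Rabs_pos_eq in Hs by lra; lra. }
      assert (HW0 : W <> C0) by (apply neq0_Cnorm; lra).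
      replace (Csub (Cdiv (RtoC (INR n)) W) C1) with (Cdiv (Copp (Cadd z C1)) W).
      2:{ replace (RtoC (INR n)) with (Csub W (Cadd z C1)) by (unfold W; ring).
          field; exact HW0. }
      rewrite Cnorm_div, Cnorm_opp by exact HW0; unfold Rdiv.
      apply Rmult_le_compat_l; [exact Hn0 |].
      replace (2 * / INR n) with (/ (INR n / 2)) by (field; lra).
      apply Rinv_le_contravar; lra.
    - replace 0 with (Cnorm (Cadd z C1) * (2 * 0)) by ring.
      apply Un_cv_scal, Un_cv_scal, Un_cv_inv_INR. }
  apply (C_cv_ext_from (fun n => Cmul (Cmul z (gauss z n))
    (Cdiv (RtoC (INR n)) (Cadd (Cadd z C1) (RtoC (INR n))))) _ _ 1).
  - intros n Hn; unfold gauss.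
    rewrite Cpow_add1 by (simpl; apply lt_0_INR; lia).
    rewrite (Cprod_S_l (fun k => Cadd z _)), (Cprod_S (fun k => Cadd (Cadd z C1) _)).
    rewrite (Cprod_ext (fun k => Cadd (Cadd z C1) (RtoC (INR k))) (fun k => Cadd z (RtoC (INR (S k)))))
      by (intros; rewrite RtoC_S; ring).
    simpl (INR 0).
    assert (H0 : z <> C0).
    { replace z with (Cadd z (RtoC (INR 0))) by (simpl INR; ring); apply Hz. }
    assert (H1 : Cadd (Cadd z C1) (RtoC (INR n)) <> C0) by (apply not_pole_add1, Hz).
    assert (H2 : Cprod (fun k => Cadd z (RtoC (INR (S k)))) n <> C0)
      by (apply Cprod_neq0; intros; apply Hz).
    replace (Cadd z C0) with z by ring.
    field; repeat split; assumption.
  - replace (Cmul z (Cgamma z)) with (Cmul (Cmul z (Cgamma z)) C1) by ring.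
    apply C_cv_mul; [apply C_cv_scal, Cgamma_cv, Hz | exact HR].
Qed.

Lemma Cgamma_1 : Cgamma C1 = C1.
Proof.
  apply (C_cv_unique (gauss C1)).
  - apply Cgamma_cv, not_pole_gt0; simpl; lra.
  - assert (E : forall n, Cprod (fun k => Cadd C1 (RtoC (INR k))) n = RtoC (INR (fact n))).
    { induction n; [reflexivity |].
      rewrite Cprod_S, IHn, RtoC_fact_S; ring. }
    apply (C_cv_ext_from (fun n => RtoC (1 - 1 / (INR n + 1))) _ _ 1).
    + intros n Hn; unfold gauss; rewrite E, RtoC_fact_S, Cpow_1 by (simpl; apply lt_0_INR; lia).
      pose proof (pos_INR n).
      rewrite RtoC_sub, RtoC_div, RtoC_add by lra; field.
      repeat split; apply RtoC_fact_neq0 || apply RtoC_S_neq0.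
    + apply C_cv_RtoC.
      pose proof (CV_minus (fun _ => 1) _ _ _ (Un_cv_const 1) (Un_cv_inv_INR_S 1)) as H.
      rewrite Rminus_0_r in H; exact H.
Qed.

Lemma Cgamma_INR_S n : Cgamma (RtoC (INR (S n))) = RtoC (INR (fact n)).
Proof.
  induction n; [apply Cgamma_1 |].
  rewrite RtoC_S, Cgamma_add1, IHn by (apply not_pole_gt0, lt_0_INR; lia).
  rewrite RtoC_fact_S, RtoC_S; reflexivity.
Qed.

Lemma Cgamma_add_INR z n : not_pole z ->
  Cgamma (Cadd z (RtoC (INR n))) = Cmul (Cprod (fun k => Cadd z (RtoC (INR k))) n) (Cgamma z).
Proof.
  intros Hz; induction n.
  - change (Cgamma (Cadd z C0) = Cmul C1 (Cgamma z)); replace (Cadd z C0) with z by ring; ring.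
  - rewrite RtoC_S; replace (Cadd z (Cadd (RtoC (INR n)) C1)) with (Cadd (Cadd z (RtoC (INR n))) C1) by ring.
    rewrite Cgamma_add1, IHn, Cprod_S; [ring |].
    intros k; replace (Cadd (Cadd z (RtoC (INR n))) (RtoC (INR k))) with (Cadd z (RtoC (INR (n + k))));
      [apply Hz | rewrite plus_INR, RtoC_add; ring].
Qed.

Lemma rising_gauss z n : not_pole z -> (0 < n)%nat ->
  Cmul (Cpow (RtoC (INR (S n))) (Csub C1 z)) (rising z (S n)) =
  Cdiv (Cpow (RtoC (1 - / (INR n + 1))) z) (gauss z n).
Proof.
  intros Hz Hn; assert (Hn' : 0 < INR n) by (apply lt_0_INR; lia).
  assert (HS : 0 < INR (S n)) by (apply lt_0_INR; lia).
  pose proof (one_minus_inv_S_gt0 n Hn) as Hh.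
  assert (E : Cpow (RtoC (INR n)) z =
    Cmul (Cpow (RtoC (INR (S n))) z) (Cpow (RtoC (1 - / (INR n + 1))) z)).
  { rewrite <- Cpow_RtoC_mul by assumption; f_equal; f_equal; rewrite S_INR; field; lra. }
  unfold gauss, rising; rewrite E.
  replace (Csub C1 z) with (Cadd (Copp z) C1) by ring.
  rewrite Cpow_add1, Cpow_opp, RtoC_fact_S by (exact HS || apply RtoC_neq0; lra).
  assert (HP : Cpow (RtoC (INR (S n))) z <> C0) by (apply Cpow_neq0, RtoC_neq0; lra).
  rewrite !RtoC_S in *.
  field; repeat split; try apply RtoC_fact_neq0; try apply RtoC_S_neq0; try exact HP.
  - apply Cprod_not_pole, Hz.
  - apply Cpow_neq0, RtoC_neq0; lra.
Qed.

Lemma C_cv_inv u l : l <> C0 -> C_cv u l -> C_cv (fun n => Cinv (u n)) (Cinv l).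
Proof.
  intros Hl Hu; pose proof (Cnorm_gt0 l Hl) as Hp.
  pose proof Hu as H; apply C_cv_iff in H.
  apply (C_cv_le _ _ (fun n => 2 / (Cnorm l * Cnorm l) * Cnorm (Csub (u n) l))).
  - destruct (Hu (Cnorm l / 2)) as [n0 Hn]; [lra |]; exists n0; intros n Hle.
    specialize (Hn n Hle).
    pose proof (Cnorm_le_sub l (u n)) as Ht; rewrite Cnorm_sub_sym in Ht.
    assert (Hun : u n <> C0) by (apply neq0_Cnorm; lra).
    replace (Csub (Cinv (u n)) (Cinv l)) with (Cdiv (Copp (Csub (u n) l)) (Cmul (u n) l))
      by (field; split; assumption).
    assert (Hm : 0 < Cnorm (u n) * Cnorm l) by nra.
    rewrite Cnorm_div, Cnorm_opp, Cnorm_mul by (apply neq0_Cnorm; rewrite Cnorm_mul; exact Hm).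
    unfold Rdiv; rewrite Rmult_comm; apply Rmult_le_compat_r; [apply Cnorm_ge0 |].
    replace (2 * / (Cnorm l * Cnorm l)) with (/ (Cnorm l / 2 * Cnorm l)) by (field; lra).
    apply Rinv_le_contravar; nra.
  - replace 0 with (2 / (Cnorm l * Cnorm l) * 0) by ring; apply Un_cv_scal, H.
Qed.

(** The binomial coefficients behave like n^(z-1)/Gamma(z): up to a factor tending to 1 they are
    inverse Gauss products. This is how Gamma enters Lipschitz' formula. *)
Lemma rising_asymp z : not_pole z ->
  C_cv (fun n => Cmul (Cpow (RtoC (INR n)) (Csub C1 z)) (rising z n)) (Cinv (Cgamma z)).
Proof.
  intros Hz; apply C_cv_unshift.
  apply (C_cv_ext_from (fun n => Cmul (Cpow (RtoC (1 - / (INR n + 1))) z) (Cinv (gauss z n))) _ _ 1).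
  { intros n Hn; rewrite rising_gauss by (exact Hz || lia); reflexivity. }
  replace (Cinv (Cgamma z)) with (Cmul C1 (Cinv (Cgamma z))) by ring.
  apply C_cv_mul; [| apply C_cv_inv; [apply Cgamma_neq0 | apply Cgamma_cv]; exact Hz].
  destruct (pow_one_minus_taylor z) as [K [HK H]].
  apply (C_cv_le _ _ (fun n => (K + Cnorm z) / (INR n + 1))); [| apply Un_cv_inv_INR_S].
  exists 1%nat; intros n Hn.
  assert (1 <= INR n) by (apply (le_INR 1); lia).
  unfold Rdiv; set (h := / (INR n + 1)).
  assert (Hh : 0 < h <= / 2).
  { split; [apply Rinv_0_lt_compat; lra | apply Rinv_le_contravar; lra]. }
  specialize (H h ltac:(lra)); set (P := Cpow _ z) in *.
  replace (Csub P C1) with (Csub (Csub P (Csub C1 (Cmul z (RtoC h)))) (Cmul z (RtoC h))) by ring.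
  eapply Rle_trans; [apply Cnorm_sub |].
  rewrite Cnorm_mul, Cnorm_RtoC, (Rabs_pos_eq h) by lra.
  assert (K * h ^ 2 <= K * h) by (apply Rmult_le_compat_l; nra); lra.
Qed.

Lemma C_cv_bounded u l : C_cv u l -> exists B, 0 <= B /\ forall n, Cnorm (u n) <= B.
Proof.
  intros H; destruct (H 1) as [n0 Hn]; [lra |].
  assert (Hfin : exists B, 0 <= B /\ forall n, (n < n0)%nat -> Cnorm (u n) <= B).
  { clear Hn; induction n0 as [| n0 [B [HB IH]]]; [exists 0; split; [lra | intros; lia] |].
    exists (B + Cnorm (u n0)); pose proof (Cnorm_ge0 (u n0)); split; [lra |].
    intros n Hn; destruct (Nat.eq_dec n n0) as [-> | Hne]; [lra |].
    specialize (IH n ltac:(lia)); lra. }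
  destruct Hfin as [B [HB Hf]]; pose proof (Cnorm_ge0 l).
  exists (B + Cnorm l + 1); split; [lra |]; intros n; destruct (le_lt_dec n0 n) as [Hle | Hlt].
  - specialize (Hn n Hle); pose proof (Cnorm_le_sub (u n) l); lra.
  - specialize (Hf n Hlt); lra.
Qed.

(** * Lipschitz' formula *)

(** Mean value inequality along the segment from the limit to [u n]. Once [u n] is close, the
    segment keeps a real part of at least half that of [l] and a modulus of at most 2|[l]|, and [a]
    bounds the modulus both ways. *)
Lemma Cpow_cv u l w : 0 < fst l -> C_cv u l -> C_cv (fun n => Cpow (u n) w) (Cpow l w).
Proof.
  intros Hl Hu.
  set (a := 2 / fst l + 2 * Cnorm l + 1).
  pose proof (fst_le_Cnorm l) as Hfl; rewrite Rabs_pos_eq in Hfl by lra.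
  assert (Hq : 0 < 2 / fst l) by (apply Rdiv_lt_0_compat; lra).
  assert (Hai : / a <= fst l / 2).
  { replace (fst l / 2) with (/ (2 / fst l)) by (field; lra).
    apply Rinv_le_contravar; unfold a; lra. }
  set (B := Cnorm w * exp (Rabs (fst (Csub w C1)) * ln a + Rabs (snd (Csub w C1)) * PI)).
  apply (C_cv_le _ _ (fun n => B * Cnorm (Csub (u n) l))).
  - destruct (Hu (fst l / 2)) as [n0 Hn]; [lra |]; exists n0; intros n Hle.
    specialize (Hn n Hle); set (d := Csub (u n) l) in *.
    pose (g := fun x => Cadd l (Cmul (RtoC x) d)).
    assert (Hg : forall x, 0 <= x <= 1 -> fst l / 2 <= fst (g x) /\ Cnorm (g x) <= 2 * Cnorm l).
    { intros x Hx; split.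
      - change (fst (g x)) with (fst l + (x * fst d - 0 * snd d)).
        pose proof (fst_le_Cnorm d) as Hd; pose proof (Rle_abs (- fst d)) as Hd'.
        rewrite Rabs_Ropp in Hd'.
        assert (x * (- fst d) <= x * Cnorm d) by (apply Rmult_le_compat_l; lra).
        assert (x * Cnorm d <= 1 * Cnorm d)
          by (apply Rmult_le_compat_r; [apply Cnorm_ge0 | lra]). nra.
      - unfold g; eapply Rle_trans; [apply Cnorm_add |].
        rewrite Cnorm_mul, Cnorm_RtoC, Rabs_pos_eq by lra.
        assert (x * Cnorm d <= 1 * Cnorm d)
          by (apply Rmult_le_compat_r; [apply Cnorm_ge0 | lra]); lra. }
    replace (u n) with (g 1) by (unfold g, d; ring).
    replace (Cpow l w) with (Cpow (g 0) w) by (f_equal; unfold g; ring).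
    replace (B * Cnorm d) with (B * Cnorm d * 1 - B * Cnorm d * 0) by ring.
    apply (mvt_cmp (fun x => Cpow (g x) w)
      (fun x => Cmul (Cmul w d) (Cpow (g x) (Csub w C1)))
      (fun x => B * Cnorm d * x) (fun _ => B * Cnorm d)); [lra | | |].
    + intros x Hx; apply Cderiv_pow; [specialize (Hg x Hx); lra |].
      eapply Cderiv_eq.
      * apply Cderiv_add; [apply Cderiv_const |].
        apply Cderiv_mul; [apply Cderiv_id | apply Cderiv_const].
      * cbv beta; ring.
    + intros x _; auto_derive; [trivial | ring].
    + intros x Hx; destruct (Hg x Hx) as [H1 H2].
      rewrite !Cnorm_mul; unfold B.
      replace (Cnorm w * Cnorm d * Cnorm (Cpow (g x) (Csub w C1))) with
        (Cnorm w * Cnorm (Cpow (g x) (Csub w C1)) * Cnorm d) by ring.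
      apply Rmult_le_compat_r; [apply Cnorm_ge0 |].
      apply Rmult_le_compat_l; [apply Cnorm_ge0 |].
      pose proof (fst_le_Cnorm (g x)) as H3; rewrite Rabs_pos_eq in H3 by lra.
      apply Cnorm_pow_bound; unfold a in *; lra.
  - replace 0 with (B * 0) by ring; apply Un_cv_scal, C_cv_iff, Hu.
Qed.

Lemma Cnorm_one_minus_exp w h : 0 <= fst w -> 0 <= h ->
  Cnorm (Csub C1 (Cexp (Copp (Cmul w (RtoC h))))) <= Cnorm w * h.
Proof.
  intros Hw Hh.
  pose (f := fun x => Copp (Cexp (Copp (Cmul w (RtoC x))))).
  replace (Csub C1 _) with (Csub (f h) (f 0)).
  2:{ unfold f; replace (Copp (Cmul w C0)) with C0 by ring; rewrite Cexp_0; ring. }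
  replace (Cnorm w * h) with (Cnorm w * h - Cnorm w * 0) by ring.
  apply (mvt_cmp f (fun x => Cmul w (Cexp (Copp (Cmul w (RtoC x)))))
    (fun x => Cnorm w * x) (fun _ => Cnorm w)); [exact Hh | | |].
  - intros x _; eapply Cderiv_eq.
    + apply Cderiv_opp, Cderiv_exp, Cderiv_opp, Cderiv_scal, Cderiv_id.
    + cbv beta; ring.
  - intros x _; auto_derive; [trivial | ring].
  - intros x Hx; rewrite Cnorm_mul, Cnorm_exp.
    pose proof (Cnorm_ge0 w).
    assert (exp (fst (Copp (Cmul w (RtoC x)))) <= 1).
    { rewrite <- exp_0; apply exp_le; unfold Copp, Cmul, RtoC; simpl; nra. }
    nra.
Qed.

Lemma Cnorm_one_minus_exp2 w h : 0 <= fst w -> 0 <= h ->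
  Cnorm (Csub (Csub C1 (Cexp (Copp (Cmul w (RtoC h))))) (Cmul w (RtoC h))) <= Cnorm w ^ 2 * h ^ 2.
Proof.
  intros Hw Hh.
  pose (f := fun x => Csub (Csub C1 (Cexp (Copp (Cmul w (RtoC x))))) (Cmul w (RtoC x))).
  replace (Csub (Csub C1 _) _) with (Csub (f h) (f 0)).
  2:{ unfold f; replace (Copp (Cmul w C0)) with C0 by ring; rewrite Cexp_0; ring. }
  apply Rle_trans with (Cnorm w ^ 2 * h ^ 2 / 2 - Cnorm w ^ 2 * 0 ^ 2 / 2);
    [| pose proof (pow2_ge_0 (Cnorm w * h)); nra].
  apply (mvt_cmp f (fun x => Cmul (Copp w) (Csub C1 (Cexp (Copp (Cmul w (RtoC x))))))
    (fun x => Cnorm w ^ 2 * x ^ 2 / 2) (fun x => Cnorm w * (Cnorm w * x))); [exact Hh | | |].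
  - intros x _; eapply Cderiv_eq.
    + apply Cderiv_sub; [apply Cderiv_sub; [apply Cderiv_const |] | apply Cderiv_scal, Cderiv_id].
      apply Cderiv_exp, Cderiv_opp, Cderiv_scal, Cderiv_id.
    + cbv beta; ring.
  - intros x _; auto_derive; [trivial | field].
  - intros x Hx; rewrite Cnorm_mul, Cnorm_opp; apply Rmult_le_compat_l; [apply Cnorm_ge0 |].
    apply Cnorm_one_minus_exp; lra.
Qed.

(** A weak form of Jordan's inequality. Up to pi/6 the cosine is at least 1/2; beyond it the sine is
    at least 1/2, which dominates pi/8 because pi <= 4. *)
Lemma sin_ge_quarter x : 0 <= x <= PI / 2 -> x / 4 <= sin x.
Proof.
  intros Hx; pose proof PI_RGT_0 as Hpi; pose proof PI_4 as Hpi4.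
  destruct (Rle_lt_dec x (PI / 6)) as [H | H].
  - assert (Hd : sin 0 - 0 / 4 <= sin x - x / 4); [| rewrite sin_0 in Hd; lra].
    apply (incr_of_deriv (fun y => sin y - y / 4) (fun y => cos y - / 4)); [lra | |].
    + intros y _; auto_derive; [trivial | field].
    + intros y Hy; assert (cos (PI / 3) <= cos y) by (apply cos_decr_1; lra).
      rewrite cos_PI3 in *; lra.
  - assert (Hs : sin (PI / 6) <= sin x) by (apply sin_incr_1; lra).
    rewrite sin_PI6 in Hs; lra.
Qed.

(** With y = sin^2(th/2) the squared modulus is (1-r)^2 (1-y) + (1+r)^2 y >= y. The bound is
    independent of r, hence later of t. *)
Lemma Cnorm_one_minus_polar r th : 0 < r -> Rabs th <= PI ->
  Rabs th / 8 <= Cnorm (Csub C1 (r * cos th, r * sin th)).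
Proof.
  intros Hr Hth; pose proof (Rabs_pos th) as H0.
  assert (Hs : Rabs th / 8 <= Rabs (sin (th / 2))).
  { assert (E : Rabs (sin (th / 2)) = sin (Rabs th / 2)).
    { destruct (Rle_lt_dec 0 th) as [Hp | Hn].
      - rewrite (Rabs_pos_eq th) in * by exact Hp; apply Rabs_pos_eq, sin_ge_0; lra.
      - rewrite (Rabs_left th) in * by exact Hn.
        replace (sin (th / 2)) with (- sin (- th / 2)) by (rewrite <- sin_neg; f_equal; field).
        rewrite Rabs_Ropp; apply Rabs_pos_eq, sin_ge_0; lra. }
    rewrite E; pose proof (sin_ge_quarter (Rabs th / 2) ltac:(lra)); lra. }
  eapply Rle_trans; [exact Hs |].
  apply Rsqr_incr_0_var; [| apply Cnorm_ge0].
  unfold Rsqr; rewrite Cnorm_sqr, <- Rabs_mult, Rabs_pos_eq by nra.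
  assert (E1 : cos th = 1 - 2 * sin (th / 2) * sin (th / 2))
    by (rewrite <- cos_2a_sin; f_equal; field).
  assert (E2 : sin th = 2 * sin (th / 2) * cos (th / 2)) by (rewrite <- sin_2a; f_equal; field).
  rewrite E1, E2; unfold Csub, Cadd, Copp, RtoC; simpl.
  set (sn := sin (th / 2)); set (c := cos (th / 2)).
  assert (E : c * c = 1 - sn * sn)
    by (pose proof (sin2_cos2 (th / 2)) as H; unfold Rsqr in H; fold sn c in H; lra).
  assert (Hsn : sn * sn <= 1) by nra.
  replace ((1 + - (r * (1 - 2 * sn * sn))) * (1 + - (r * (1 - 2 * sn * sn)))
     + (0 + - (r * (2 * sn * c))) * (0 + - (r * (2 * sn * c)))) with
    ((1 - r * (1 - 2 * (sn * sn))) * (1 - r * (1 - 2 * (sn * sn)))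
     + 4 * (r * r) * (sn * sn) * (c * c)) by ring.
  rewrite E; assert (0 <= sn * sn) by nra; set (y := sn * sn) in *.
  replace ((1 - r * (1 - 2 * y)) * (1 - r * (1 - 2 * y)) + 4 * (r * r) * y * (1 - y))
    with ((1 - r) * (1 - r) * (1 - y) + y * ((1 + r) * (1 + r))) by ring.
  assert (0 <= (1 - r) * (1 - r) * (1 - y)) by (apply Rmult_le_pos; [apply Rle_0_sqr | lra]).
  assert (y * 1 <= y * ((1 + r) * (1 + r))) by (apply Rmult_le_compat_l; nra); lra.
Qed.

(** * Roots of e^(-t) and the discrete form of the formula *)

Definition node (t : R) (k : Z) : Cplx := (t, 2 * PI * IZR k).

Lemma Cpown_exp z n : Cpown (Cexp z) n = Cexp (Cmul (RtoC (INR n)) z).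
Proof.
  induction n.
  - simpl; change (C1 = Cexp (Cmul C0 z)); rewrite <- Cexp_0; f_equal; ring.
  - rewrite RtoC_S; simpl Cpown; rewrite IHn, <- Cexp_add; f_equal; ring.
Qed.

Lemma geom_sum q n : Cmul (Csub C1 q) (Csum (Cpown q) n) = Csub C1 (Cpown q n).
Proof.
  induction n; [simpl; change (1, 0) with C1; change (0, 0) with C0; ring |].
  rewrite Csum_S; simpl Cpown.
  replace (Cmul (Csub C1 q) (Cadd (Csum (Cpown q) n) (Cpown q n))) with
    (Cadd (Cmul (Csub C1 q) (Csum (Cpown q) n)) (Cmul (Csub C1 q) (Cpown q n))) by ring.
  rewrite IHn; ring.
Qed.

Lemma Cexp_2PI k : Cexp (0, 2 * PI * IZR k) = C1.
Proof.
  unfold Cexp; simpl; rewrite exp_0.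
  assert (Hs : sin (PI * IZR k) = 0) by (apply sin_eq_0_1; exists k; ring).
  replace (2 * PI * IZR k) with (2 * (PI * IZR k)) by ring.
  rewrite cos_2a_sin, sin_2a, Hs; unfold RtoC; f_equal; ring.
Qed.

Lemma Csum_const c n : Csum (fun _ => c) n = Cmul (RtoC (INR n)) c.
Proof. induction n; [simpl; change (0, 0) with C0; ring | rewrite Csum_S, IHn, RtoC_S; ring]. Qed.

Lemma node_sub t k K : node t (k - K) = Cadd (node t (- K)) (0, 2 * PI * IZR k).
Proof.
  apply Ceq; unfold node, Cadd; simpl; [ring |].
  unfold Z.sub; rewrite plus_IZR; ring.
Qed.

(** For k = -K, ..., K and L = 2K + 1 these are the L-th roots of e^(-t). As L grows, L (1 -
    [lroot t L k]) tends to [node t k]; the odd L makes the range of k symmetric. *)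
Definition lroot (t : R) (L : nat) (k : Z) : Cplx := Cexp (Copp (Cmul (node t k) (RtoC (/ INR L)))).

(** The powers form a geometric sum with ratio [om] = e^(-2 pi i j/L). Either L divides j and all
    terms agree, or [om] differs from 1 while its L-th power is 1, and the sum vanishes. *)
Lemma roots_filter t K j : let L := (2 * K + 1)%nat in
  Csum (fun i => Cpown (lroot t L (Z.of_nat i - Z.of_nat K)) j) L =
  if Nat.eq_dec (j mod L) 0 then Cmul (RtoC (INR L)) (RtoC (exp (- (INR (j / L) * t)))) else C0.
Proof.
  intros L.
  assert (HL : 0 < INR L) by (apply lt_0_INR; unfold L; lia).
  set (om := Cexp (0, - (2 * PI * INR j / INR L))).
  set (c := Cexp (Copp (Cmul (node t (- Z.of_nat K)) (RtoC (INR j / INR L))))).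
  assert (E : forall i, Cpown (lroot t L (Z.of_nat i - Z.of_nat K)) j = Cmul c (Cpown om i)).
  { intros i; unfold lroot, c, om; rewrite !Cpown_exp, <- Cexp_add; f_equal.
    rewrite node_sub, <- INR_IZR_INZ.
    apply Ceq; unfold Cadd, Cmul, Copp, node, RtoC; simpl; field; lra. }
  rewrite (Csum_ext _ (fun i => Cmul c (Cpown om i))) by (intros; apply E).
  rewrite Csum_scal.
  assert (HomL : Cpown om L = C1).
  { unfold om; rewrite Cpown_exp, <- (Cexp_2PI (- Z.of_nat j)); f_equal.
    rewrite opp_IZR, <- INR_IZR_INZ.
    apply Ceq; unfold Cmul, RtoC; simpl; field; lra. }
  destruct (Nat.eq_dec (j mod L) 0) as [H | H].
  - assert (Ej : j = (L * (j / L))%nat).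
    { pose proof (Nat.div_mod_eq j L); lia. }
    set (m := (j / L)%nat) in *.
    assert (EjR : INR j = INR L * INR m) by (rewrite Ej, mult_INR; reflexivity).
    assert (Hom : om = C1).
    { unfold om; rewrite <- (Cexp_2PI (- Z.of_nat m)); f_equal; f_equal.
      rewrite opp_IZR, <- INR_IZR_INZ, EjR; field; lra. }
    rewrite (Csum_ext _ (fun _ => C1)).
    2:{ intros i _; rewrite Hom, Cpown_RtoC, pow1; reflexivity. }
    rewrite Csum_const.
    assert (Hc : c = RtoC (exp (- (INR m * t)))).
    { unfold c; rewrite <- Cexp_RtoC.
      replace (Copp (Cmul (node t (- Z.of_nat K)) (RtoC (INR j / INR L)))) with
        (Cadd (RtoC (- (INR m * t))) (0, 2 * PI * IZR (Z.of_nat K * Z.of_nat m))).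
      - rewrite Cexp_add, Cexp_2PI; ring.
      - rewrite mult_IZR, EjR.
        apply Ceq; unfold Cadd, Cmul, Copp, node, RtoC; simpl; rewrite ?opp_IZR, <- ?INR_IZR_INZ;
          field; lra. }
    rewrite Hc; ring.
  - assert (Hom : Csub C1 om <> C0).
    { intros E1.
      assert (Eo : om = C1) by (replace om with (Csub C1 (Csub C1 om)) by ring; rewrite E1; ring).
      assert (Hc : cos (2 * (PI * INR j / INR L)) = 1).
      { apply (f_equal fst) in Eo; unfold om, Cexp, RtoC in Eo; simpl in Eo.
        rewrite exp_0, Rmult_1_l, cos_neg in Eo; rewrite <- Eo; f_equal; field; lra. }
      rewrite cos_2a_sin in Hc.
      assert (Hs : sin (PI * INR j / INR L) = 0) by nra.
      apply sin_eq_0_0 in Hs; destruct Hs as [k Hk].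
      assert (HjR : INR j = IZR k * INR L).
      { apply (Rmult_eq_reg_l PI); [| apply PI_neq0].
        apply (f_equal (fun x => x * INR L)) in Hk.
        replace (PI * INR j / INR L * INR L) with (PI * INR j) in Hk by (field; lra).
        rewrite Hk; ring. }
      rewrite !INR_IZR_INZ, <- mult_IZR in HjR; apply eq_IZR in HjR.
      apply H; apply Nat.Div0.mod_divides; exists (Z.to_nat k); unfold L in *; nia. }
    pose proof (geom_sum om L) as G; rewrite HomL in G.
    replace (Csub C1 C1) with C0 in G by ring.
    change (Csum (fun i => Cpown om i) L) with (Csum (Cpown om) L).
    replace (Csum (Cpown om) L) with (Cdiv (Cmul (Csub C1 om) (Csum (Cpown om) L)) (Csub C1 om))
      by (field; exact Hom).
    rewrite G; field; exact Hom.
Qed.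

Lemma Csum_multiples (f : nat -> Cplx) L n : (0 < L)%nat ->
  (forall j, (j mod L)%nat <> 0%nat -> f j = C0) ->
  Csum f (n * L) = Csum (fun m => f (m * L)%nat) n.
Proof.
  intros HL H; induction n; [reflexivity |].
  rewrite Csum_S, <- IHn; replace (S n * L)%nat with (n * L + L)%nat by lia.
  rewrite Csum_split; f_equal.
  destruct L as [| L']; [lia |].
  rewrite Csum_S_l, Nat.add_0_r.
  rewrite (Csum_ext _ (fun _ => C0)).
  - rewrite Csum_const; ring.
  - intros k Hk; apply H; rewrite Nat.add_comm, Nat.Div0.mod_add, Nat.mod_small; lia.
Qed.

Lemma Csum_symmetric (f : Z -> Cplx) K :
  Csum (fun i => f (Z.of_nat i - Z.of_nat K)%Z) (2 * K + 1) =
  Cadd (f 0%Z) (Csum (fun k => Cadd (f (Z.of_nat (S k))) (f (- Z.of_nat (S k))%Z)) K).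
Proof.
  assert (Hneg : Csum (fun i => f (Z.of_nat i - Z.of_nat K)%Z) K =
    Csum (fun k => f (- Z.of_nat (S k))%Z) K).
  { induction K; [reflexivity |].
    rewrite Csum_S_l, Csum_S, <- IHK.
    rewrite (Csum_ext _ (fun i => f (Z.of_nat i - Z.of_nat K)%Z)) by (intros; f_equal; lia).
    replace (Z.of_nat 0 - Z.of_nat (S K))%Z with (- Z.of_nat (S K))%Z by lia; ring. }
  replace (2 * K + 1)%nat with (K + S K)%nat by lia.
  rewrite Csum_split, Hneg, Csum_S_l, Csum_add.
  rewrite (Csum_ext (fun k => f (Z.of_nat (K + S k) - Z.of_nat K)%Z) (fun k => f (Z.of_nat (S k))))
    by (intros; f_equal; lia).
  replace (Z.of_nat (K + 0) - Z.of_nat K)%Z with 0%Z by lia; ring.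
Qed.

Lemma Cnorm_lroot t L k : 0 < t -> (0 < L)%nat -> Cnorm (lroot t L k) < 1.
Proof.
  intros Ht HL; unfold lroot; rewrite Cnorm_exp, <- exp_0; apply exp_increasing.
  unfold Copp, Cmul, node, RtoC; simpl.
  assert (0 < / INR L) by (apply Rinv_0_lt_compat, lt_0_INR; exact HL); nra.
Qed.

(** Adding the binomial series at all L roots keeps only the coefficients whose index is a multiple
    of L, by [roots_filter]. This is Lipschitz' formula before the passage to the limit. *)
Lemma roots_binomial z t K : 0 < t -> let L := (2 * K + 1)%nat in
  C_cv (Csum (fun m => Cmul (rising z (m * L)) (Cmul (RtoC (INR L)) (RtoC (exp (- (INR m * t)))))))
    (Csum (fun i => Cpow (Csub C1 (lroot t L (Z.of_nat i - Z.of_nat K))) (Copp z)) L).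
Proof.
  intros Ht L; assert (HL : (0 < L)%nat) by (unfold L; lia).
  set (f := fun j => Cmul (rising z j)
    (Csum (fun i => Cpown (lroot t L (Z.of_nat i - Z.of_nat K)) j) L)).
  assert (H : C_cv (Csum f)
    (Csum (fun i => Cpow (Csub C1 (lroot t L (Z.of_nat i - Z.of_nat K))) (Copp z)) L)).
  { apply (C_cv_ext (fun J => Csum (fun i => Csum (fun j => Cmul (rising z j)
      (Cpown (lroot t L (Z.of_nat i - Z.of_nat K)) j)) J) L)).
    - intros J; rewrite Csum_swap; apply Csum_ext; intros; unfold f; rewrite <- Csum_scal; reflexivity.
    - apply (C_cv_Csum (fun J i => Csum (fun j => Cmul (rising z j)
        (Cpown (lroot t L (Z.of_nat i - Z.of_nat K)) j)) J)
        (fun i => Cpow (Csub C1 (lroot t L (Z.of_nat i - Z.of_nat K))) (Copp z))).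
      intros i _; apply binomial_series, Cnorm_lroot; assumption. }
  apply (C_cv_ext (fun n => Csum f (n * L))).
  - intros n; rewrite Csum_multiples; [| exact HL |].
    + apply Csum_ext; intros m _; unfold f; f_equal.
      etransitivity; [apply roots_filter |]; fold L.
      rewrite Nat.Div0.mod_mul, Nat.div_mul by lia; reflexivity.
    + intros j Hj; unfold f.
      replace (Csum _ L) with C0; [ring |]; symmetry.
      etransitivity; [apply roots_filter |]; fold L.
      destruct (Nat.eq_dec (j mod L) 0); [contradiction | reflexivity].
  - apply (C_cv_subseq (Csum f)); [| exact H].
    intros M; destruct (INR_unbounded M) as [n0 Hn0]; exists n0; intros n Hn.
    eapply Rlt_le_trans; [exact Hn0 |]; apply le_INR; nia.
Qed.

Lemma ln_le_sub1 x : 0 < x -> ln x <= x - 1.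
Proof.
  intros Hx; pose proof (exp_ge_1_plus (ln x)) as H; rewrite exp_ln in H by exact Hx; lra.
Qed.

(** The constant is the maximum of x^p e^(-xt), attained at x = p/t. *)
Lemma exp_pow_bounded p t : 0 < p -> 0 < t -> exists C, 0 <= C /\
  forall x, 0 < x -> exp (p * ln x - x * t) <= C.
Proof.
  intros Hp Ht; exists (exp (- p - p * ln (t / p))); split; [left; apply exp_pos |].
  intros x Hx; apply exp_le.
  assert (Htp : 0 < t / p) by (apply Rdiv_lt_0_compat; assumption).
  pose proof (ln_le_sub1 (x * (t / p)) ltac:(nra)) as H.
  rewrite ln_mult in H by assumption.
  apply (Rmult_le_compat_l p) in H; [| lra].
  replace (p * (x * (t / p) - 1)) with (x * t - p) in H by (field; lra); lra.
Qed.

Lemma inv_sqr_exp x : 0 < x -> / x ^ 2 = exp (- (2 * ln x)).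
Proof.
  intros Hx; rewrite exp_Ropp; f_equal.
  replace (2 * ln x) with (ln x + ln x) by ring.
  rewrite exp_plus, exp_ln by exact Hx; ring.
Qed.

Definition lterm (z : Cplx) (t : R) (m : nat) : Cplx :=
  Cmul (Cpow (RtoC (INR (S m))) (Csub z C1)) (RtoC (exp (- (INR (S m) * t)))).

Lemma Cnorm_lterm z t m :
  Cnorm (lterm z t m) = exp ((fst z - 1) * ln (INR (S m)) - INR (S m) * t).
Proof.
  unfold lterm; rewrite Cnorm_mul, Cnorm_pow_RtoC, Cnorm_RtoC by (apply lt_0_INR; lia).
  rewrite Rabs_pos_eq by (left; apply exp_pos); rewrite <- exp_plus; f_equal.
Qed.

Lemma lterm_le_inv_sqr z t : 0 < fst z -> 0 < t -> exists C, 0 <= C /\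
  forall m, Cnorm (lterm z t m) <= C * / (INR m + 1) ^ 2.
Proof.
  intros Hz Ht; destruct (exp_pow_bounded (fst z + 1) t) as [C [HC H]]; [lra | exact Ht |].
  exists C; split; [exact HC |]; intros m.
  assert (Hm : 0 < INR (S m)) by (apply lt_0_INR; lia).
  rewrite Cnorm_lterm, <- S_INR, inv_sqr_exp by exact Hm.
  replace ((fst z - 1) * ln (INR (S m)) - INR (S m) * t) with
    ((fst z + 1) * ln (INR (S m)) - INR (S m) * t + - (2 * ln (INR (S m)))) by ring.
  rewrite exp_plus; apply Rmult_le_compat_r; [left; apply exp_pos | apply H, Hm].
Qed.

Lemma fst_one_minus_lroot_gt0 t L k : 0 < t -> (0 < L)%nat -> 0 < fst (Csub C1 (lroot t L k)).
Proof.
  intros Ht HL; pose proof (Cnorm_lroot t L k Ht HL) as H.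
  pose proof (fst_le_Cnorm (lroot t L k)); pose proof (Rle_abs (fst (lroot t L k))).
  change (fst (Csub C1 (lroot t L k))) with (1 + - fst (lroot t L k)); lra.
Qed.

Lemma fst_mul_RtoC x z : fst (Cmul (RtoC x) z) = x * fst z.
Proof. unfold Cmul, RtoC; simpl; ring. Qed.

Lemma fst_anode_gt0 t L k : 0 < t -> (0 < L)%nat ->
  0 < fst (Cmul (RtoC (INR L)) (Csub C1 (lroot t L k))).
Proof.
  intros Ht HL; rewrite fst_mul_RtoC; apply Rmult_lt_0_compat.
  - apply lt_0_INR, HL.
  - apply fst_one_minus_lroot_gt0; assumption.
Qed.

Lemma anode_cv t k : 0 < t ->
  C_cv (fun K => Cmul (RtoC (INR (2 * K + 1))) (Csub C1 (lroot t (2 * K + 1) k))) (node t k).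
Proof.
  intros Ht; set (w := node t k).
  apply (C_cv_le _ _ (fun K => Cnorm w ^ 2 / (INR K + 1))); [| apply Un_cv_inv_INR_S].
  exists 0%nat; intros K _; set (L := (2 * K + 1)%nat).
  pose proof (pos_INR K) as HK.
  assert (HL : INR K + 1 <= INR L).
  { unfold L; rewrite plus_INR, mult_INR; simpl; lra. }
  assert (Hi : 0 < / INR L) by (apply Rinv_0_lt_compat; lra).
  pose proof (Cnorm_one_minus_exp2 w (/ INR L) ltac:(unfold w, node; simpl; lra) ltac:(lra)) as H.
  replace (Csub _ w) with (Cmul (RtoC (INR L)) (Csub (Csub C1 (lroot t L k)) (Cmul w (RtoC (/ INR L))))).
  2:{ rewrite RtoC_inv by lra; field; apply RtoC_neq0; lra. }
  rewrite Cnorm_mul, Cnorm_RtoC, Rabs_pos_eq by lra.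
  apply (Rmult_le_compat_l (INR L)) in H; [| lra].
  eapply Rle_trans; [exact H |].
  replace (INR L * (Cnorm w ^ 2 * (/ INR L) ^ 2)) with (Cnorm w ^ 2 * / INR L) by (field; lra).
  apply Rmult_le_compat_l; [apply pow2_ge_0 | apply Rinv_le_contravar; lra].
Qed.

(** Lower bound uniform in K, as dominated convergence over the nodes requires. The root has
    argument of modulus 2 pi |k|/L <= pi, so [Cnorm_one_minus_polar] applies and gives pi |k|/4. *)
Lemma Cnorm_anode_ge t K k : (Z.abs k <= Z.of_nat K)%Z -> let L := (2 * K + 1)%nat in
  IZR (Z.abs k) / 2 <= Cnorm (Cmul (RtoC (INR L)) (Csub C1 (lroot t L k))).
Proof.
  intros Hk L.
  assert (HL : 0 < INR L) by (apply lt_0_INR; unfold L; lia).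
  set (th := - (2 * PI * IZR k / INR L)).
  pose proof PI_RGT_0 as Hpi; pose proof PI2_1 as Hpi2.
  assert (Hth : Rabs th = 2 * PI * IZR (Z.abs k) / INR L).
  { unfold th; rewrite Rabs_Ropp, abs_IZR; unfold Rdiv; rewrite !Rabs_mult.
    rewrite Rabs_inv, (Rabs_pos_eq (INR L)), (Rabs_pos_eq 2), (Rabs_pos_eq PI) by lra; reflexivity. }
  assert (HkL : 2 * IZR (Z.abs k) <= INR L).
  { apply IZR_le in Hk; rewrite <- INR_IZR_INZ in Hk; unfold L; rewrite plus_INR, mult_INR; simpl; lra. }
  assert (Habs : 0 <= IZR (Z.abs k)) by (apply IZR_le; lia).
  assert (H : Rabs th / 8 <= Cnorm (Csub C1 (lroot t L k))).
  { replace (lroot t L k) with (exp (- (t / INR L)) * cos th, exp (- (t / INR L)) * sin th).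
    - apply Cnorm_one_minus_polar; [apply exp_pos |].
      rewrite Hth; apply (Rmult_le_reg_r (INR L)); [exact HL |].
      unfold Rdiv; rewrite Rmult_assoc, Rinv_l by lra; nra.
    - unfold lroot, Cexp; replace (Copp (Cmul (node t k) (RtoC (/ INR L)))) with (- (t / INR L), th);
        [reflexivity | apply Ceq; unfold th, Copp, Cmul, node, RtoC; simpl; field; lra]. }
  rewrite Cnorm_mul, Cnorm_RtoC, Rabs_pos_eq by lra.
  apply (Rmult_le_compat_l (INR L)) in H; [| lra].
  rewrite Hth in H.
  replace (INR L * (2 * PI * IZR (Z.abs k) / INR L / 8)) with (PI / 2 * (IZR (Z.abs k) / 2)) in H
    by (field; lra).
  nra.
Qed.

Lemma Cnorm_pow_opp_le u z r : 0 < fst u -> 0 <= fst z -> 0 < r <= Cnorm u ->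
  Cnorm (Cpow u (Copp z)) <= exp (Rabs (snd z) * (PI / 2)) * exp (- (fst z * ln r)).
Proof.
  intros Hu Hz Hr; rewrite Cnorm_pow by exact Hu; rewrite <- exp_plus; apply exp_le.
  assert (Hl : ln r <= ln (Cnorm u)) by (apply ln_le; lra).
  assert (Ha : Rabs (atan (snd u / fst u)) <= PI / 2)
    by (pose proof (atan_bound (snd u / fst u)); apply Rabs_le; lra).
  pose proof (Rle_abs (snd z * atan (snd u / fst u))) as H; rewrite Rabs_mult in H.
  pose proof (Rmult_le_compat_l _ _ _ (Rabs_pos (snd z)) Ha).
  pose proof (Rmult_le_compat_l _ _ _ Hz Hl).
  unfold Copp; cbn [fst snd]; lra.
Qed.

(** Opposite nodes are grouped, which turns the sum over all non-zero integers into an ordinary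
    series. *)
Definition pair_term (z : Cplx) (t : R) (k : nat) : Cplx :=
  Cadd (Cpow (node t (Z.of_nat (S k))) (Copp z)) (Cpow (node t (- Z.of_nat (S k))) (Copp z)).

(** The condition 2 <= Re z of Lipschitz' formula comes from here: it makes the powers at the nodes
    decay like 1/k^2. *)
Lemma exp_neg_ln_half_le b x : 2 <= b -> 1 <= x ->
  exp (- (b * ln (x / 2))) <= exp (b * ln 2) * / x ^ 2.
Proof.
  intros Hb Hx; unfold Rdiv; rewrite ln_mult, ln_Rinv by lra.
  assert (Hl : 0 <= ln x) by (rewrite <- ln_1; apply ln_le; lra).
  rewrite inv_sqr_exp, <- exp_plus by lra; apply exp_le; nra.
Qed.

Lemma RtoC_pow_scale L z : 0 < L ->
  Cpow (RtoC L) (Csub C1 z) = Cmul (Cpow (RtoC L) (Copp z)) (RtoC L).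
Proof.
  intros HL; replace (Csub C1 z) with (Cadd (Copp z) C1) by ring.
  apply Cpow_add1; exact HL.
Qed.

(** With L = 2K + 1, the quantity L^(1-z) [rising z (mL)] is m^(z-1) times the normalized
    coefficient of index mL. Its limit in K and a bound uniform in K both follow from
    [rising_asymp]. *)
Lemma rising_scaled_eq z K m : (0 < m)%nat ->
  Cmul (Cpow (RtoC (INR (2 * K + 1))) (Csub C1 z)) (rising z (m * (2 * K + 1))) =
  Cmul (Cpow (RtoC (INR m)) (Csub z C1))
    (Cmul (Cpow (RtoC (INR (m * (2 * K + 1)))) (Csub C1 z)) (rising z (m * (2 * K + 1)))).
Proof.
  intros Hm; rewrite mult_INR, Cpow_RtoC_mul by (apply lt_0_INR; lia).
  replace (Csub z C1) with (Copp (Csub C1 z)) by ring.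
  assert (Hm0 : RtoC (INR m) <> C0) by (apply RtoC_neq0, not_0_INR; lia).
  rewrite Cpow_opp by exact Hm0; field; apply Cpow_neq0, Hm0.
Qed.

Lemma rising_scaled_cv z m : not_pole z -> (0 < m)%nat ->
  C_cv (fun K => Cmul (Cpow (RtoC (INR (2 * K + 1))) (Csub C1 z)) (rising z (m * (2 * K + 1))))
    (Cmul (Cpow (RtoC (INR m)) (Csub z C1)) (Cinv (Cgamma z))).
Proof.
  intros Hz Hm.
  apply (C_cv_ext (fun K => Cmul (Cpow (RtoC (INR m)) (Csub z C1))
    (Cmul (Cpow (RtoC (INR (m * (2 * K + 1)))) (Csub C1 z)) (rising z (m * (2 * K + 1)))))).
  - intros K; symmetry; apply rising_scaled_eq, Hm.
  - apply C_cv_scal.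
    apply (C_cv_subseq (fun j => Cmul (Cpow (RtoC (INR j)) (Csub C1 z)) (rising z j)));
      [| apply rising_asymp, Hz].
    intros M; destruct (INR_unbounded M) as [n0 Hn0]; exists n0; intros n Hn.
    eapply Rlt_le_trans; [exact Hn0 |]; apply le_INR; nia.
Qed.

Lemma rising_scaled_bound z : 1 <= fst z -> exists B, 0 <= B /\ forall K m, (0 < m)%nat ->
  Cnorm (Cmul (Cpow (RtoC (INR (2 * K + 1))) (Csub C1 z)) (rising z (m * (2 * K + 1)))) <=
  B * exp ((fst z - 1) * ln (INR m)).
Proof.
  intros Hz; assert (Hp : not_pole z) by (apply not_pole_gt0; lra).
  destruct (C_cv_bounded _ _ (rising_asymp z Hp)) as [B [HB H]].
  exists B; split; [exact HB |]; intros K m Hm.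
  rewrite rising_scaled_eq, Cnorm_mul, Cnorm_pow_RtoC by (exact Hm || apply lt_0_INR, Hm).
  rewrite Rmult_comm; apply Rmult_le_compat_r; [left; apply exp_pos | apply H].
Qed.

Lemma pow_RtoC_neg_cv0 z : 1 < fst z ->
  C_cv (fun K => Cpow (RtoC (INR (2 * K + 1))) (Csub C1 z)) C0.
Proof.
  intros Hz eps He.
  destruct (INR_unbounded (exp (- ln eps / (fst z - 1)))) as [K0 HK0]; exists K0; intros K HK.
  replace (Csub _ C0) with (Cpow (RtoC (INR (2 * K + 1))) (Csub C1 z)) by ring.
  assert (HL : INR K0 <= INR (2 * K + 1)) by (apply le_INR; lia).
  pose proof (exp_pos (- ln eps / (fst z - 1))).
  rewrite Cnorm_pow_RtoC by lra.
  rewrite <- (exp_ln eps) by exact He; apply exp_increasing.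
  assert (Hl : - ln eps / (fst z - 1) < ln (INR (2 * K + 1))).
  { rewrite <- (ln_exp (- ln eps / (fst z - 1))); apply ln_increasing; lra. }
  apply (Rmult_lt_compat_l (fst z - 1)) in Hl; [| lra].
  replace ((fst z - 1) * (- ln eps / (fst z - 1))) with (- ln eps) in Hl by (field; lra).
  change (fst (Csub C1 z)) with (1 + - fst z); lra.
Qed.

(* Lipschitz' formula, obtained from the binomial series at all [L]-th roots as [L] tends to infinity. *)
Lemma lipschitz z t Lam : 2 <= fst z -> 0 < t -> C_cv (Csum (lterm z t)) Lam ->
  C_cv (fun K => Cmul (Cgamma z) (Cadd (Cpow (RtoC t) (Copp z)) (Csum (pair_term z t) K))) Lam.
Proof.
  intros Hz Ht HLam.
  assert (Hp : not_pole z) by (apply not_pole_gt0; lra).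
  pose (L := fun K : nat => (2 * K + 1)%nat).
  assert (HL : forall K, (0 < L K)%nat) by (intros; unfold L; lia).
  assert (HLR : forall K, 0 < INR (L K)) by (intros; apply lt_0_INR, HL).
  pose (F := fun K k => Cpow (Cmul (RtoC (INR (L K))) (Csub C1 (lroot t (L K) k))) (Copp z)).
  assert (HF : forall k, C_cv (fun K => F K k) (Cpow (node t k) (Copp z))).
  { intros k; apply Cpow_cv; [exact Ht | apply anode_cv, Ht]. }
  pose (G := fun K k => Cadd (F K (Z.of_nat (S k))) (F K (- Z.of_nat (S k))%Z)).
  pose (D := 2 * (exp (Rabs (snd z) * (PI / 2)) * exp (fst z * ln 2))).
  assert (HD : 0 <= D).
  { unfold D; pose proof (exp_pos (Rabs (snd z) * (PI / 2))); pose proof (exp_pos (fst z * ln 2)); nra. }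
  assert (HGb : forall K k, (k < K)%nat -> Cnorm (G K k) <= D * / (INR k + 1) ^ 2).
  { intros K k Hk.
    assert (Hs : forall k', Z.abs k' = Z.of_nat (S k) ->
      Cnorm (F K k') <= exp (Rabs (snd z) * (PI / 2)) * exp (fst z * ln 2) * / (INR k + 1) ^ 2).
    { intros k' Hk'.
      pose proof (Cnorm_anode_ge t K k' ltac:(lia)) as Ha; cbv zeta in Ha.
      rewrite Hk', <- INR_IZR_INZ in Ha.
      assert (H1 : 1 <= INR (S k)) by (apply (le_INR 1); lia).
      unfold F; eapply Rle_trans.
      - apply (Cnorm_pow_opp_le _ z (INR (S k) / 2)); [apply fst_anode_gt0; [exact Ht | apply HL] | lra |].
        split; [lra | exact Ha].
      - rewrite Rmult_assoc, <- S_INR; apply Rmult_le_compat_l; [left; apply exp_pos |].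
        apply exp_neg_ln_half_le; lra. }
    eapply Rle_trans; [apply Cnorm_add |].
    pose proof (Hs (Z.of_nat (S k)) ltac:(lia)); pose proof (Hs (- Z.of_nat (S k))%Z ltac:(lia)).
    unfold D; lra. }
  assert (Hpair : forall k, C_cv (fun K => G K k) (pair_term z t k))
    by (intros k; apply C_cv_add; apply HF).
  assert (Hpb : forall k, Cnorm (pair_term z t k) <= D * / (INR k + 1) ^ 2).
  { intros k; eapply C_cv_norm_le; [| apply Hpair].
    exists (S k); intros K HK; apply HGb; lia. }
  destruct (series_inv_sqr_cv D HD) as [SD HSD].
  destruct (series_dominated (pair_term z t) _ SD Hpb HSD) as [l [Hl _]].
  pose (lhs := fun K => Cmul (Cgamma z) (Cadd (F K 0%Z) (Csum (G K) K))).
  assert (Hlhs : C_cv lhs (Cmul (Cgamma z) (Cadd (Cpow (RtoC t) (Copp z)) l))).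
  { apply C_cv_scal, C_cv_add.
    - replace (RtoC t) with (node t 0) by (unfold node, RtoC; f_equal; ring); apply HF.
    - apply (tannery_finite G (pair_term z t) (fun k => D * / (INR k + 1) ^ 2) SD); try assumption.
      intros k; apply Rmult_le_pos; [exact HD |].
      left; apply Rinv_0_lt_compat, pow_lt; pose proof (pos_INR k); lra. }
  (* After scaling by L^(-z) the filtered series is the sum of [b K m] over m. The term m = 0 is
     Gamma(z) L^(1-z) and tends to 0; the term m + 1 tends to [lterm z t m]. *)
  pose (b := fun K m => Cmul (Cgamma z) (Cmul (Cmul (Cpow (RtoC (INR (L K))) (Csub C1 z))
    (rising z (m * L K))) (RtoC (exp (- (INR m * t)))))).
  assert (Hsum : forall K, C_cv (Csum (fun m => b K (S m))) (Csub (lhs K) (b K 0%nat))).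
  { intros K.
    apply (C_cv_ext (fun n => Csub (Csum (b K) (S n)) (b K 0%nat))).
    { intros n; rewrite Csum_S_l; ring. }
    apply C_cv_sub; [| apply C_cv_const].
    unfold lhs, G; rewrite <- (Csum_symmetric (F K)).
    apply (C_cv_shift (Csum (b K))).
    apply (C_cv_ext (fun n => Cmul (Cmul (Cgamma z) (Cpow (RtoC (INR (L K))) (Copp z)))
      (Csum (fun m => Cmul (rising z (m * L K)) (Cmul (RtoC (INR (L K))) (RtoC (exp (- (INR m * t)))))) n))).
    { intros n; rewrite <- Csum_scal; apply Csum_ext; intros m _; unfold b.
      rewrite RtoC_pow_scale by apply HLR; ring. }
    replace (Cmul (Cgamma z) (Csum _ _)) with (Cmul (Cmul (Cgamma z) (Cpow (RtoC (INR (L K))) (Copp z)))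
      (Csum (fun i => Cpow (Csub C1 (lroot t (L K) (Z.of_nat i - Z.of_nat K))) (Copp z)) (L K))).
    { apply C_cv_scal, roots_binomial, Ht. }
    rewrite <- !Csum_scal; apply Csum_ext; intros i _; unfold F.
    rewrite Cpow_scale by first [apply HLR | apply fst_one_minus_lroot_gt0; [exact Ht | apply HL]]; ring. }
  destruct (lterm_le_inv_sqr z t ltac:(lra) Ht) as [C [HC Hlt]].
  destruct (rising_scaled_bound z ltac:(lra)) as [B [HB HBd]].
  assert (HCB : 0 <= Cnorm (Cgamma z) * B * C).
  { pose proof (Cnorm_ge0 (Cgamma z)); apply Rmult_le_pos; [apply Rmult_le_pos |]; assumption. }
  destruct (series_inv_sqr_cv _ HCB) as [SC HSC].
  assert (Hrhs : C_cv (fun K => Csub (lhs K) (b K 0%nat)) Lam).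
  { apply (tannery_series (fun K m => b K (S m)) (lterm z t)
      (fun k => Cnorm (Cgamma z) * B * C * / (INR k + 1) ^ 2) SC); try assumption.
    - intros m; unfold b, lterm.
      replace (Cmul (Cpow (RtoC (INR (S m))) (Csub z C1)) (RtoC (exp (- (INR (S m) * t))))) with
       (Cmul (Cgamma z) (Cmul (Cmul (Cpow (RtoC (INR (S m))) (Csub z C1)) (Cinv (Cgamma z)))
         (RtoC (exp (- (INR (S m) * t)))))) by (field; apply Cgamma_neq0, Hp).
      apply C_cv_scal, C_cv_mul; [| apply C_cv_const].
      apply rising_scaled_cv; [exact Hp | lia].
    - intros K m; unfold b.
      rewrite (Cnorm_mul (Cgamma z)), (Cnorm_mul _ (RtoC (exp _))), Cnorm_RtoC.
      rewrite Rabs_pos_eq by (left; apply exp_pos).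
      rewrite !Rmult_assoc; apply Rmult_le_compat_l; [apply Cnorm_ge0 |].
      pose proof (HBd K (S m) ltac:(lia)) as H1.
      pose proof (Hlt m) as H2; rewrite Cnorm_lterm in H2.
      eapply Rle_trans; [apply Rmult_le_compat_r; [left; apply exp_pos | exact H1] |].
      rewrite Rmult_assoc, <- exp_plus; apply Rmult_le_compat_l; [exact HB |].
      exact H2. }
  assert (Hb0 : C_cv (fun K => b K 0%nat) C0).
  { unfold b; replace C0 with (Cmul (Cgamma z) (Cmul C0 C1)) by ring.
    apply C_cv_scal, C_cv_mul.
    - apply (C_cv_ext (fun K => Cpow (RtoC (INR (L K))) (Csub C1 z))).
      + intros K; rewrite Nat.mul_0_l, rising_0; ring.
      + apply pow_RtoC_neg_cv0; lra.
    - apply (C_cv_ext (fun _ => C1)); [| apply C_cv_const].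
      intros K; simpl INR; rewrite Rmult_0_l, Ropp_0, exp_0; reflexivity. }
  (* One sequence in K evaluated in two ways: through the nodes and through the filtered series. *)
  assert (E : Lam = Cmul (Cgamma z) (Cadd (Cpow (RtoC t) (Copp z)) l)).
  { apply (C_cv_unique _ _ _ Hrhs).
    replace (Cmul (Cgamma z) (Cadd (Cpow (RtoC t) (Copp z)) l)) with
      (Csub (Cmul (Cgamma z) (Cadd (Cpow (RtoC t) (Copp z)) l)) C0) by ring.
    apply C_cv_sub; assumption. }
  rewrite E; apply C_cv_scal, C_cv_add; [apply C_cv_const | exact Hl].
Qed.

(** * The limit at zero *)

Lemma pow_le_fact_exp w y : 0 <= y -> y ^ w <= INR (fact w) * exp y.
Proof.
  revert y; induction w; intros y Hy.
  - simpl; pose proof (exp_ge_1_plus y); lra.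
  - assert (H : INR (fact (S w)) * exp 0 - 0 ^ S w <= INR (fact (S w)) * exp y - y ^ S w).
    { apply (incr_of_deriv (fun x => INR (fact (S w)) * exp x - x ^ S w)
        (fun x => INR (S w) * (INR (fact w) * exp x - x ^ w))); [exact Hy | |].
      - intros x _; auto_derive; [trivial |].
        change (match w with O => 1 | S _ => INR w + 1 end) with (INR (S w)).
        change (fact w + w * fact w)%nat with (fact (S w)).
        rewrite (fact_simpl w), mult_INR; simpl pred; ring.
      - intros x Hx; apply Rmult_le_pos; [apply pos_INR |]; specialize (IHw x ltac:(lra)); lra. }
    rewrite exp_0, pow_i in H by lia; pose proof (pos_INR (fact (S w))); lra.
Qed.

Lemma pow_exp_neg_le w y : 0 <= y -> y ^ w * exp (- y) <= INR (fact w).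
Proof.
  intros Hy; pose proof (pow_le_fact_exp w y Hy) as H; pose proof (exp_pos y) as Hp.
  rewrite exp_Ropp; apply (Rmult_le_reg_r (exp y)); [exact Hp |].
  rewrite Rmult_assoc, Rinv_l by lra; lra.
Qed.

(** The parameter t occurs only through xt. Since y^w e^(-y) <= w! for y >= 0, bounds in x hold
    uniformly for t >= 0, and t = 0 is an admissible value. *)
Definition mono (a : Cplx) (t : R) (w j : nat) (x : R) : Cplx :=
  Cmul (Cpow (RtoC x) (Csub a (RtoC (INR j)))) (RtoC ((x * t) ^ w * exp (- (x * t)))).

(* [mono_deriv k] is the [k]-th derivative of [mono]: differentiating lowers the power
   of [x] by one and produces the monomials of index [w] and [w + 1]. *)
Fixpoint mono_deriv (k : nat) (a : Cplx) (t : R) (w j : nat) (x : R) : Cplx :=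
  match k with
  | O => mono a t w j x
  | S k => Csub (Cmul (Cadd (Csub a (RtoC (INR j))) (RtoC (INR w))) (mono_deriv k a t w (S j) x))
                (mono_deriv k a t (S w) (S j) x)
  end.

Lemma Cderiv_mono a t w j x : 0 < x -> Cderiv (mono a t w j) x (mono_deriv 1 a t w j x).
Proof.
  intros Hx; unfold mono; eapply Cderiv_eq.
  - apply Cderiv_mul.
    + apply Cderiv_pow; [exact Hx | apply Cderiv_id].
    + apply Cderiv_RtoC.
      apply (is_derive_eq _ _ ((INR w * (x * t) ^ w - (x * t) ^ S w) * exp (- (x * t)) * / x)).
      * auto_derive; [trivial |]; destruct w; [simpl; field; lra |].
        simpl pred; change ((x * t) ^ S (S w)) with (x * t * (x * t * (x * t) ^ w)).
        change ((x * t) ^ S w) with (x * t * (x * t) ^ w); field; lra.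
      * reflexivity.
  - cbv beta; simpl mono_deriv; unfold mono.
    replace (Csub a (RtoC (INR (S j)))) with (Csub (Csub a (RtoC (INR j))) C1) by (rewrite RtoC_S; ring).
    rewrite Cpow_sub1 by exact Hx.
    rewrite !RtoC_mul, RtoC_sub, RtoC_inv, !RtoC_mul by lra.
    field; apply RtoC_neq0; lra.
Qed.

Lemma Cderiv_mono_deriv k a t w j x : 0 < x ->
  Cderiv (mono_deriv k a t w j) x (mono_deriv (S k) a t w j x).
Proof.
  intros Hx; revert w j; induction k; intros w j; [apply Cderiv_mono, Hx |].
  simpl mono_deriv at 1.
  apply (Cderiv_sub (fun y => Cmul _ (mono_deriv k a t w (S j) y))
    (fun y => mono_deriv k a t (S w) (S j) y)).
  - apply Cderiv_scal, IHk.
  - apply IHk.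
Qed.

Lemma mono_deriv_bound k a w j : exists C, 0 <= C /\ forall t x, 0 <= t -> 0 < x ->
  Cnorm (mono_deriv k a t w j x) <= C * exp ((fst a - INR j - INR k) * ln x).
Proof.
  revert w j; induction k; intros w j.
  - exists (INR (fact w)); split; [apply pos_INR |]; intros t x Ht Hx.
    simpl mono_deriv; unfold mono.
    rewrite Cnorm_mul, Cnorm_pow_RtoC, Cnorm_RtoC by exact Hx.
    assert (Hy : 0 <= x * t) by nra.
    rewrite Rabs_pos_eq by (apply Rmult_le_pos; [apply pow_le, Hy | left; apply exp_pos]).
    replace (fst (Csub a (RtoC (INR j)))) with (fst a - INR j - INR 0)
      by (unfold Csub, Cadd, Copp, RtoC; simpl; ring).
    rewrite Rmult_comm; apply Rmult_le_compat_r; [left; apply exp_pos | apply pow_exp_neg_le, Hy].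
  - destruct (IHk w (S j)) as [K1 [H1 HC1]]; destruct (IHk (S w) (S j)) as [K2 [H2 HC2]].
    set (c := Cadd (Csub a (RtoC (INR j))) (RtoC (INR w))).
    pose proof (Cnorm_ge0 c) as Hc.
    exists (Cnorm c * K1 + K2); split; [nra |]; intros t x Ht Hx.
    specialize (HC1 t x Ht Hx); specialize (HC2 t x Ht Hx).
    replace (fst a - INR (S j) - INR k) with (fst a - INR j - INR (S k)) in * by (rewrite !S_INR; ring).
    simpl mono_deriv; fold c.
    eapply Rle_trans; [apply Cnorm_sub |]; rewrite Cnorm_mul.
    apply (Rmult_le_compat_l _ _ _ Hc) in HC1; lra.
Qed.

Lemma mono_le_inv_sqr a t w j : 0 < t -> exists C, 0 <= C /\
  forall m, Cnorm (mono a t w j (INR (S m))) <= C * / (INR m + 1) ^ 2.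
Proof.
  intros Ht.
  destruct (exp_pow_bounded (Rabs (fst a - INR j) + INR w + 2) t) as [C [HC H]].
  { pose proof (Rabs_pos (fst a - INR j)); pose proof (pos_INR w); lra. }
  { exact Ht. }
  exists (t ^ w * C); split; [apply Rmult_le_pos; [apply pow_le; lra | exact HC] |].
  intros m; rewrite <- S_INR.
  assert (Hn : 1 <= INR (S m)) by (apply (le_INR 1); lia).
  set (x := INR (S m)) in *; unfold mono.
  rewrite Cnorm_mul, Cnorm_pow_RtoC, Cnorm_RtoC by lra.
  rewrite Rabs_pos_eq by (apply Rmult_le_pos; [apply pow_le; nra | left; apply exp_pos]).
  rewrite Rpow_mult_distr, <- (Rpower_pow w x) by lra; unfold Rpower.
  change (fst (Csub a (RtoC (INR j)))) with (fst a - INR j).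
  replace (exp ((fst a - INR j) * ln x) * (exp (INR w * ln x) * t ^ w * exp (- (x * t))))
    with (t ^ w * (exp ((fst a - INR j) * ln x) * exp (INR w * ln x) * exp (- (x * t)))) by ring.
  rewrite <- !exp_plus, inv_sqr_exp, Rmult_assoc by lra.
  apply Rmult_le_compat_l; [apply pow_le; lra |].
  assert (Hl : 0 <= ln x) by (rewrite <- ln_1; apply ln_le; lra).
  apply Rle_trans with (exp ((Rabs (fst a - INR j) + INR w + 2) * ln x - x * t) * exp (- (2 * ln x))).
  - rewrite <- exp_plus; apply exp_le.
    pose proof (Rmult_le_compat_r _ _ _ Hl (Rle_abs (fst a - INR j))); lra.
  - apply Rmult_le_compat_r; [left; apply exp_pos | apply H; lra].
Qed.

Lemma mono_deriv_cv0 k a t w j : 0 < t ->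
  C_cv (fun n => mono_deriv k a t w j (INR (S n))) C0.
Proof.
  intros Ht; revert w j; induction k; intros w j.
  - destruct (mono_le_inv_sqr a t w j Ht) as [C [HC H]].
    apply (C_cv_le _ _ (fun n => C / (INR n + 1))); [| apply Un_cv_inv_INR_S].
    exists 0%nat; intros n _.
    change (mono_deriv 0 a t w j (INR (S n))) with (mono a t w j (INR (S n))).
    replace (Csub (mono a t w j (INR (S n))) C0) with (mono a t w j (INR (S n))) by ring.
    eapply Rle_trans; [apply H |]; apply Rmult_le_compat_l; [exact HC |].
    pose proof (pos_INR n); apply Rinv_le_contravar; nra.
  - simpl mono_deriv.
    replace C0 with (Csub (Cmul (Cadd (Csub a (RtoC (INR j))) (RtoC (INR w))) C0) C0) by ring.
    apply C_cv_sub; [apply C_cv_scal, IHk | apply IHk].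
Qed.

Lemma mono_deriv_cv_t k a (t : nat -> R) w j x : Un_cv t 0 ->
  C_cv (fun i => mono_deriv k a (t i) w j x) (mono_deriv k a 0 w j x).
Proof.
  intros Ht; revert w j; induction k; intros w j.
  - simpl mono_deriv; unfold mono; apply C_cv_scal, C_cv_RtoC.
    assert (Hc : continuity_pt (fun u => (x * u) ^ w * exp (- (x * u))) 0).
    { apply derivable_continuous_pt; apply ex_derive_Reals_0.
      auto_derive; trivial. }
    apply (continuity_seq (fun u => (x * u) ^ w * exp (- (x * u)))); assumption.
  - simpl mono_deriv; apply C_cv_sub; [apply C_cv_scal, IHk | apply IHk].
Qed.

(** Here [f1] is the integrand and [f0] its primitive. The error E(h) on [x, x+h] and its derivative
    both vanish at h = 0, and E'' = (h/2) [f3](x+h); two mean value inequalities bound E(1). *)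
Lemma trapezoid_error (f0 f1 f2 f3 : R -> Cplx) x B :
  (forall y, x <= y <= x + 1 -> Cderiv f0 y (f1 y)) ->
  (forall y, x <= y <= x + 1 -> Cderiv f1 y (f2 y)) ->
  (forall y, x <= y <= x + 1 -> Cderiv f2 y (f3 y)) ->
  (forall y, x <= y <= x + 1 -> Cnorm (f3 y) <= B) ->
  Cnorm (Csub (Cmul (RtoC (/ 2)) (Cadd (f1 x) (f1 (x + 1)))) (Csub (f0 (x + 1)) (f0 x))) <= B.
Proof.
  intros H0 H1 H2 H3.
  assert (HB : 0 <= B) by (eapply Rle_trans; [apply Cnorm_ge0 | apply (H3 x); lra]).
  pose (E := fun h => Csub (Cmul (RtoC (h / 2)) (Cadd (f1 x) (f1 (x + h)))) (Csub (f0 (x + h)) (f0 x))).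
  pose (E1 := fun h => Cadd (Cmul (RtoC (/ 2)) (Csub (f1 x) (f1 (x + h)))) (Cmul (RtoC (h / 2)) (f2 (x + h)))).
  assert (Hsh : forall f h l, Cderiv f (x + h) l -> Cderiv (fun y => f (x + y)) h l).
  { intros f h l [Ha Hb]; split.
    - eapply is_derive_eq; [apply (is_derive_comp (fun y => fst (f y)) (fun y => x + y) h); [exact Ha |]|].
      + auto_derive; [trivial | reflexivity].
      + unfold scal; simpl; unfold mult; simpl; ring.
    - eapply is_derive_eq; [apply (is_derive_comp (fun y => snd (f y)) (fun y => x + y) h); [exact Hb |]|].
      + auto_derive; [trivial | reflexivity].
      + unfold scal; simpl; unfold mult; simpl; ring. }
  assert (Hhalf : forall h, Cderiv (fun y => RtoC (y / 2)) h (RtoC (/ 2))).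
  { intros h; apply Cderiv_RtoC; auto_derive; [trivial | field]. }
  assert (HE1 : forall h, 0 <= h <= 1 -> Cnorm (E1 h) <= B).
  { intros h Hh.
    replace (E1 h) with (Csub (E1 h) (E1 0)).
    2:{ unfold E1; rewrite Rplus_0_r; replace (0 / 2) with 0 by field; ring. }
    apply Rle_trans with (B * h - B * 0); [| nra].
    apply (mvt_cmp E1 (fun y => Cmul (RtoC (y / 2)) (f3 (x + y))) (fun y => B * y) (fun _ => B)); [lra | | |].
    - intros y Hy; eapply Cderiv_eq.
      + apply Cderiv_add; [apply Cderiv_scal, Cderiv_sub; [apply Cderiv_const |] |
          apply Cderiv_mul; [apply Hhalf |]]; apply Hsh; [apply H1 | apply H2]; lra.
      + cbv beta; ring.
    - intros y _; auto_derive; [trivial | ring].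
    - intros y Hy; rewrite Cnorm_mul, Cnorm_RtoC, Rabs_pos_eq by lra.
      specialize (H3 (x + y) ltac:(lra)); pose proof (Cnorm_ge0 (f3 (x + y))); nra. }
  replace (Csub (Cmul (RtoC (/ 2)) _) _) with (Csub (E 1) (E 0)).
  2:{ unfold E; rewrite Rplus_0_r; replace (0 / 2) with 0 by field.
      replace (1 / 2) with (/ 2) by field; ring. }
  replace B with (B * 1 - B * 0) by ring.
  apply (mvt_cmp E E1 (fun y => B * y) (fun _ => B)); [lra | | | exact HE1].
  - intros y Hy; eapply Cderiv_eq.
    + apply Cderiv_sub; [apply Cderiv_mul; [apply Hhalf | apply Cderiv_add; [apply Cderiv_const |]] |
        apply Cderiv_sub; [| apply Cderiv_const]]; apply Hsh; [apply H1 | apply H0]; lra.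
    + cbv beta; unfold E1.
      replace (RtoC (y / 2)) with (Cmul (RtoC y) (RtoC (/ 2))) by (rewrite <- RtoC_mul; reflexivity).
      replace (f1 (x + y)) with (Cmul (Cadd (RtoC (/ 2)) (RtoC (/ 2))) (f1 (x + y))) at 2
        by (rewrite <- RtoC_add; replace (/ 2 + / 2) with 1 by field; ring).
      ring.
  - intros y _; auto_derive; [trivial | ring].
Qed.

Definition qterm (s : Cplx) (v : nat) (t : R) (m : nat) : Cplx :=
  Cmul (Cpow (RtoC (INR (S m))) (Copp s)) (RtoC (Qinc v (INR (S m) * t))).

(* For [k = 0] this is [x^a Q(v, x t) / a], whose derivative is the summand of [Dsum]
   up to a multiple of [lterm]; [k] counts derivatives. *)
Definition psi (k : nat) (a : Cplx) (v : nat) (t x : R) : Cplx :=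
  Csum (fun w => Cmul (Cinv (Cmul (RtoC (INR (fact w))) a)) (mono_deriv k a t w 0 x)) v.

Lemma Cderiv_psi k a v t x : 0 < x -> Cderiv (psi k a v t) x (psi (S k) a v t x).
Proof.
  intros Hx; unfold psi.
  apply (Cderiv_Csum (fun w x => Cmul (Cinv (Cmul (RtoC (INR (fact w))) a)) (mono_deriv k a t w 0 x))
    (fun w x => Cmul (Cinv (Cmul (RtoC (INR (fact w))) a)) (mono_deriv (S k) a t w 0 x))).
  intros w _; apply Cderiv_scal, Cderiv_mono_deriv, Hx.
Qed.

Lemma psi_cv0 k a v t : 0 < t -> C_cv (fun n => psi k a v t (INR (S n))) C0.
Proof.
  intros Ht; unfold psi.
  replace C0 with (Csum (fun _ => C0) v) by (rewrite Csum_const; ring).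
  apply (C_cv_Csum (fun n w => Cmul (Cinv (Cmul (RtoC (INR (fact w))) a)) (mono_deriv k a t w 0 (INR (S n))))
    (fun _ => C0)).
  intros w _; replace C0 with (Cmul (Cinv (Cmul (RtoC (INR (fact w))) a)) C0) by ring.
  apply C_cv_scal, mono_deriv_cv0, Ht.
Qed.

Lemma psi_cv_t k a v (t : nat -> R) x : Un_cv t 0 -> C_cv (fun i => psi k a v (t i) x) (psi k a v 0 x).
Proof.
  intros Ht; unfold psi.
  apply (C_cv_Csum (fun i w => Cmul (Cinv (Cmul (RtoC (INR (fact w))) a)) (mono_deriv k a (t i) w 0 x))
    (fun w => Cmul (Cinv (Cmul (RtoC (INR (fact w))) a)) (mono_deriv k a 0 w 0 x))).
  intros w _; apply C_cv_scal, mono_deriv_cv_t, Ht.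
Qed.

(** The third derivative decays like x^(Re a - 3). For a = 1 - s the condition Re a <= 1 means Re s
    >= 0, and the trapezoidal errors are then summable, uniformly in t. *)
Lemma psi_bound a v : fst a <= 1 -> exists C, 0 <= C /\ forall t x, 0 <= t -> 1 <= x ->
  Cnorm (psi 3 a v t x) <= C * / x ^ 2.
Proof.
  intros Ha; unfold psi; induction v as [| v [C [HC IH]]].
  - exists 0; split; [lra |]; intros t x _ _; rewrite Csum_0, Cnorm_0; lra.
  - destruct (mono_deriv_bound 3 a v 0) as [D [HD H]].
    set (c := Cinv (Cmul (RtoC (INR (fact v))) a)).
    pose proof (Cnorm_ge0 c) as Hc.
    exists (C + Cnorm c * D); split; [nra |]; intros t x Ht Hx; rewrite Csum_S.
    eapply Rle_trans; [apply Cnorm_add |]; rewrite Rmult_plus_distr_r.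
    apply Rplus_le_compat; [apply IH; assumption |].
    fold c; rewrite Cnorm_mul, Rmult_assoc; apply Rmult_le_compat_l; [exact Hc |].
    eapply Rle_trans; [apply H; lra |]; apply Rmult_le_compat_l; [exact HD |].
    rewrite inv_sqr_exp by lra; apply exp_le.
    assert (Hl : 0 <= ln x) by (rewrite <- ln_1; apply ln_le; lra).
    simpl INR; nra.
Qed.

Lemma mono_deriv_1 a t w j x : mono_deriv 1 a t w j x =
  Csub (Cmul (Cadd (Csub a (RtoC (INR j))) (RtoC (INR w))) (mono a t w (S j) x)) (mono a t (S w) (S j) x).
Proof. reflexivity. Qed.

Lemma psi1_qterm s n t m : Csub C1 s <> C0 ->
  psi 1 (Csub C1 s) (S n) t (INR (S m)) =
  Csub (qterm s (S n) t m)
    (Cmul (Cdiv (RtoC (t ^ S n / INR (fact n))) (Csub C1 s))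
       (lterm (Cadd (Csub C1 s) (RtoC (INR (S n)))) t m)).
Proof.
  intros Ha; set (a := Csub C1 s) in *; set (x := INR (S m)).
  assert (Hx : 0 < x) by (apply lt_0_INR; lia).
  set (y := x * t); set (P := Cpow (RtoC x) (Copp s)).
  assert (Hm : forall w, mono a t w 1 x = Cmul P (RtoC (y ^ w * exp (- y)))).
  { intros w; unfold mono, P; f_equal; f_equal; unfold a; simpl INR; ring. }
  assert (Hf : forall k, INR (fact k) <> 0) by apply INR_fact_neq_0.
  assert (E : forall k, psi 1 a (S k) t x = Csub (Cmul P (RtoC (Qinc (S k) y)))
    (Cdiv (Cmul P (RtoC (y ^ S k / INR (fact k) * exp (- y)))) a)).
  { induction k.
    - unfold psi; rewrite Csum_S, Csum_0; simpl mono_deriv; rewrite !Hm.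
      replace (Qinc 1 y) with (exp (- y)) by (unfold Qinc; simpl; field).
      simpl fact; simpl pow; replace (y * 1 / INR 1 * exp (- y)) with (y * 1 * exp (- y)) by (simpl; field).
      replace (1 * exp (- y)) with (exp (- y)) by ring.
      simpl INR; field; repeat split; first [exact Ha | apply RtoC_neq0; lra].
    - unfold psi in *; rewrite Csum_S, IHk, mono_deriv_1, !Hm.
      unfold Qinc; rewrite (Rsum_S _ (S k)); fold (Qinc (S k) y).
      replace (y ^ S k / INR (fact k) * exp (- y)) with (y ^ S k * exp (- y) * / INR (fact k))
        by (field; apply Hf).
      replace (y ^ S k / INR (fact (S k)) * exp (- y)) with (y ^ S k * exp (- y) * / INR (fact (S k)))
        by (field; apply Hf).
      replace (y ^ S (S k) / INR (fact (S k)) * exp (- y)) with (y ^ S (S k) * exp (- y) * / INR (fact (S k)))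
        by (field; apply Hf).
      rewrite RtoC_add, (RtoC_mul (y ^ S k * exp (- y))), (RtoC_mul (y ^ S k * exp (- y))),
        (RtoC_mul (y ^ S (S k) * exp (- y))), !RtoC_inv by apply Hf.
      rewrite RtoC_fact_S, RtoC_S; simpl (INR 0).
      field; repeat split; first [exact Ha | apply RtoC_fact_neq0 | apply RtoC_S_neq0]. }
  rewrite E; unfold qterm, lterm; fold x y P; f_equal.
  assert (EP : Cpow (RtoC x) (Csub (Cadd a (RtoC (INR (S n)))) C1) = Cmul P (RtoC (x ^ S n))).
  { unfold P; rewrite <- Cpow_RtoC_INR, <- Cpow_add by (exact Hx || apply RtoC_neq0; lra).
    f_equal; unfold a; ring. }
  rewrite EP; fold y.
  replace (y ^ S n / INR (fact n) * exp (- y)) with (t ^ S n / INR (fact n) * (x ^ S n * exp (- y)))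
    by (unfold y; rewrite Rpow_mult_distr; field; apply Hf).
  rewrite !RtoC_mul; field; exact Ha.
Qed.

Definition trap_err (a : Cplx) (v : nat) (t : R) (m : nat) : Cplx :=
  Csub (Cmul (RtoC (/ 2)) (Cadd (psi 1 a v t (INR (S m))) (psi 1 a v t (INR (S (S m))))))
    (Csub (psi 0 a v t (INR (S (S m)))) (psi 0 a v t (INR (S m)))).

Lemma trap_err_sum a v t J :
  Csum (fun m => psi 1 a v t (INR (S m))) (S J) =
  Cadd (Csum (trap_err a v t) J)
    (Cadd (Cmul (RtoC (/ 2)) (Cadd (psi 1 a v t 1) (psi 1 a v t (INR (S J)))))
      (Csub (psi 0 a v t (INR (S J))) (psi 0 a v t 1))).
Proof.
  assert (E2 : forall z, z = Cmul (Cadd (RtoC (/ 2)) (RtoC (/ 2))) z).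
  { intros z; rewrite <- RtoC_add; replace (/ 2 + / 2) with 1 by field; ring. }
  induction J.
  - rewrite Csum_S, !Csum_0; cbv beta; change (INR 1) with 1.
    rewrite (E2 (psi 1 a v t 1)) at 1; ring.
  - rewrite Csum_S, IHJ, (Csum_S _ J); cbv beta; unfold trap_err at 3.
    rewrite (E2 (psi 1 a v t (INR (S (S J))))) at 1; ring.
Qed.

Lemma trap_err_bound a v : fst a <= 1 -> exists C, 0 <= C /\ forall t m, 0 <= t ->
  Cnorm (trap_err a v t m) <= C * / (INR m + 1) ^ 2.
Proof.
  intros Ha; destruct (psi_bound a v Ha) as [C [HC H]]; exists C; split; [exact HC |].
  intros t m Ht; unfold trap_err; rewrite <- (S_INR m), !(S_INR (S m)).
  assert (Hm : 1 <= INR (S m)) by (apply (le_INR 1); lia).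
  apply (trapezoid_error _ _ (psi 2 a v t) (psi 3 a v t)); try (intros; apply Cderiv_psi; lra).
  intros y Hy; eapply Rle_trans; [apply H; lra |].
  apply Rmult_le_compat_l; [exact HC |]; apply Rinv_le_contravar; [apply pow_lt; lra |].
  apply pow_incr; lra.
Qed.

Lemma psi_at_0 k s n x : Csub C1 s <> C0 -> 0 < x ->
  psi k (Csub C1 s) (S n) 0 x = Cdiv (mono_deriv k (Csub C1 s) 0 0 0 x) (Csub C1 s).
Proof.
  intros Ha Hx; unfold psi; rewrite Csum_S_l.
  assert (Hz : forall k w j, (0 < w)%nat -> mono_deriv k (Csub C1 s) 0 w j x = C0).
  { induction k0; intros w j Hw.
    - simpl; unfold mono; rewrite Rmult_0_r, pow_i, Rmult_0_l by exact Hw; ring.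
    - simpl; rewrite !IHk0 by lia; ring. }
  rewrite (Csum_ext _ (fun _ => C0)).
  - rewrite Csum_const; simpl (INR (fact 0)); field; repeat split; first [exact Ha | apply RtoC_neq0; lra].
  - intros w _; rewrite Hz by lia; ring.
Qed.

Lemma psi0_at_0 s n x : Csub C1 s <> C0 -> 0 < x ->
  psi 0 (Csub C1 s) (S n) 0 x = Cdiv (Cpow (RtoC x) (Csub C1 s)) (Csub C1 s).
Proof.
  intros Ha Hx; rewrite psi_at_0 by assumption; simpl; unfold mono.
  rewrite Rmult_0_r, Ropp_0, exp_0; simpl.
  replace (Csub (Csub C1 s) C0) with (Csub C1 s) by ring.
  replace (1 * 1) with 1 by ring; field; exact Ha.
Qed.

Lemma psi1_at_0 s n x : Csub C1 s <> C0 -> 0 < x ->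
  psi 1 (Csub C1 s) (S n) 0 x = Cpow (RtoC x) (Copp s).
Proof.
  intros Ha Hx; rewrite psi_at_0 by assumption; simpl; unfold mono.
  rewrite Rmult_0_r, Ropp_0, exp_0; simpl.
  replace (Csub (Csub C1 s) C1) with (Copp s) by ring.
  replace (0 * 1 * 1) with 0 by ring; replace (1 * 1) with 1 by ring; field; exact Ha.
Qed.

(** At t = 0 one has Q = 1, and the two subtractions in the definition of [zeta] are the primitive
    and half the integrand at the right end point. Its defining sequence is thus the sum of
    trapezoidal errors plus constants from x = 1. *)
Lemma zeta_trap s n : 0 <= fst s -> Csub C1 s <> C0 ->
  exists E, C_cv (Csum (trap_err (Csub C1 s) (S n) 0)) E /\ zeta s = Cadd E (Csub (Cmul (RtoC (/ 2)) (psi 1 (Csub C1 s) (S n) 0 1)) (psi 0 (Csub C1 s) (S n) 0 1)).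
Proof.
  intros Hs Ha.
  assert (Ha1 : fst (Csub C1 s) <= 1) by (change (fst (Csub C1 s)) with (1 + - fst s); lra).
  destruct (trap_err_bound (Csub C1 s) (S n) Ha1) as [C [HC H]].
  destruct (series_inv_sqr_cv C HC) as [S0 HS0].
  destruct (series_dominated (trap_err (Csub C1 s) (S n) 0) _ S0 (fun m => H 0 m (Rle_refl 0)) HS0)
    as [E [HE _]].
  exists E; split; [exact HE |]; apply Clim_eq, C_cv_unshift.
  apply (C_cv_ext (fun J => Cadd (Csum (trap_err (Csub C1 s) (S n) 0) J)
    (Csub (Cmul (RtoC (/ 2)) (psi 1 (Csub C1 s) (S n) 0 1)) (psi 0 (Csub C1 s) (S n) 0 1)))).
  - intros J; assert (HJ : 0 < INR (S J)) by (apply lt_0_INR; lia).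
    rewrite (Csum_ext (fun k => Cpow (RtoC (INR (S k))) (Copp s))
      (fun m => psi 1 (Csub C1 s) (S n) 0 (INR (S m)))).
    + rewrite trap_err_sum, <- (psi0_at_0 s n (INR (S J))), <- (psi1_at_0 s n (INR (S J))) by assumption.
      ring.
    + intros m _; rewrite psi1_at_0; [reflexivity | exact Ha | apply lt_0_INR; lia].
  - apply C_cv_add; [exact HE | apply C_cv_const].
Qed.

(** For t > 0 the contributions of the right end point vanish at infinity, leaving trapezoidal
    errors and boundary values at x = 1. Both converge to their values at t = 0, the errors by
    dominated convergence. *)
Lemma zeta_limit s n (t : nat -> R) (D Lam : nat -> Cplx) :
  0 <= fst s -> Csub C1 s <> C0 -> (forall i, 0 < t i) -> Un_cv t 0 ->
  (forall i, C_cv (Csum (qterm s (S n) (t i))) (D i)) ->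
  (forall i, C_cv (Csum (lterm (Cadd (Csub C1 s) (RtoC (INR (S n)))) (t i))) (Lam i)) ->
  C_cv (fun i => Csub (D i) (Cmul (Cdiv (RtoC (t i ^ S n / INR (fact n))) (Csub C1 s)) (Lam i))) (zeta s).
Proof.
  intros Hs Ha Ht Ht0 HD HL; set (a := Csub C1 s) in *.
  assert (Ha1 : fst a <= 1) by (change (fst a) with (1 + - fst s); lra).
  destruct (zeta_trap s n Hs Ha) as [E [HE Hz]]; fold a in HE, Hz.
  destruct (trap_err_bound a (S n) Ha1) as [C [HC H]].
  destruct (series_inv_sqr_cv C HC) as [S0 HS0].
  set (X := fun i => Csub (D i) (Cmul (Cdiv (RtoC (t i ^ S n / INR (fact n))) a) (Lam i))).
  assert (HX : forall i, C_cv (Csum (trap_err a (S n) (t i)))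
    (Csub (X i) (Csub (Cmul (RtoC (/ 2)) (psi 1 a (S n) (t i) 1)) (psi 0 a (S n) (t i) 1)))).
  { intros i.
    assert (H1 : C_cv (Csum (fun m => psi 1 a (S n) (t i) (INR (S m)))) (X i)).
    { apply (C_cv_ext (fun J => Csub (Csum (qterm s (S n) (t i)) J)
        (Cmul (Cdiv (RtoC (t i ^ S n / INR (fact n))) a)
          (Csum (lterm (Cadd a (RtoC (INR (S n)))) (t i)) J)))).
      - intros J; rewrite <- Csum_scal, <- Csum_sub; apply Csum_ext; intros m _.
        symmetry; apply psi1_qterm, Ha.
      - apply C_cv_sub; [apply HD | apply C_cv_scal, HL]. }
    apply (C_cv_ext (fun J => Csub (Csum (fun m => psi 1 a (S n) (t i) (INR (S m))) (S J))
      (Cadd (Cmul (RtoC (/ 2)) (Cadd (psi 1 a (S n) (t i) 1) (psi 1 a (S n) (t i) (INR (S J)))))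
        (Csub (psi 0 a (S n) (t i) (INR (S J))) (psi 0 a (S n) (t i) 1))))).
    { intros J; rewrite trap_err_sum; ring. }
    replace (Csub (Cmul (RtoC (/ 2)) (psi 1 a (S n) (t i) 1)) (psi 0 a (S n) (t i) 1)) with
      (Cadd (Cmul (RtoC (/ 2)) (Cadd (psi 1 a (S n) (t i) 1) C0)) (Csub C0 (psi 0 a (S n) (t i) 1))) by ring.
    apply C_cv_sub; [apply (C_cv_shift _ _ H1) |].
    apply C_cv_add.
    - apply C_cv_scal, C_cv_add; [apply C_cv_const | apply psi_cv0, Ht].
    - apply C_cv_sub; [apply psi_cv0, Ht | apply C_cv_const]. }
  assert (HT : C_cv (fun i => Csub (X i) (Csub (Cmul (RtoC (/ 2)) (psi 1 a (S n) (t i) 1))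
     (psi 0 a (S n) (t i) 1))) E).
  { apply (tannery_series (fun i => trap_err a (S n) (t i)) (trap_err a (S n) 0)
      (fun m => C * / (INR m + 1) ^ 2) S0); try assumption.
    - intros m; apply C_cv_sub; [apply C_cv_scal, C_cv_add | apply C_cv_sub]; apply psi_cv_t, Ht0.
    - intros i m; apply H; left; apply Ht. }
  apply (C_cv_ext (fun i => Cadd (Csub (X i) (Csub (Cmul (RtoC (/ 2)) (psi 1 a (S n) (t i) 1))
     (psi 0 a (S n) (t i) 1))) (Csub (Cmul (RtoC (/ 2)) (psi 1 a (S n) (t i) 1)) (psi 0 a (S n) (t i) 1)))).
  { intros i; fold (X i); ring. }
  rewrite Hz; apply C_cv_add; [exact HT |].
  apply C_cv_sub; [apply C_cv_scal |]; apply psi_cv_t, Ht0.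
Qed.

Lemma qterm_series_cv s v t : 0 < t -> exists D, C_cv (Csum (qterm s v t)) D.
Proof.
  intros Ht.
  assert (H : exists C, 0 <= C /\ forall m, Cnorm (qterm s v t m) <= C * / (INR m + 1) ^ 2).
  { induction v as [| v [C [HC IH]]].
    - exists 0; split; [lra |]; intros m; unfold qterm, Qinc; simpl Rsum.
      rewrite Cnorm_mul, Cnorm_0; lra.
    - destruct (mono_le_inv_sqr (Copp s) t v 0 Ht) as [D [HD H]].
      exists (C + D); split; [lra |]; intros m.
      replace (qterm s (S v) t m) with (Cadd (qterm s v t m)
        (Cmul (RtoC (/ INR (fact v))) (mono (Copp s) t v 0 (INR (S m))))).
      + eapply Rle_trans; [apply Cnorm_add |]; rewrite Rmult_plus_distr_r.
        apply Rplus_le_compat; [apply IH |].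
        assert (Hf : 1 <= INR (fact v)) by (apply (le_INR 1), lt_O_fact).
        assert (Hi : / INR (fact v) <= 1) by (rewrite <- Rinv_1; apply Rinv_le_contravar; lra).
        assert (0 < / INR (fact v)) by (apply Rinv_0_lt_compat; lra).
        rewrite Cnorm_mul, Cnorm_RtoC, Rabs_pos_eq by lra.
        specialize (H m); pose proof (Cnorm_ge0 (mono (Copp s) t v 0 (INR (S m)))); nra.
      + unfold qterm, mono, Qinc; rewrite Rsum_S; simpl (INR 0).
        replace (Csub (Copp s) C0) with (Copp s) by ring.
        replace ((INR (S m) * t) ^ v / INR (fact v) * exp (- (INR (S m) * t))) with
          (/ INR (fact v) * ((INR (S m) * t) ^ v * exp (- (INR (S m) * t))))
          by (field; apply INR_fact_neq_0).
        rewrite (RtoC_add (Rsum _ v)), (RtoC_mul (/ INR (fact v))); ring. }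
  destruct H as [C [HC H]]; destruct (series_inv_sqr_cv C HC) as [S0 HS].
  destruct (series_dominated _ _ _ H HS) as [D [HD _]]; exists D; exact HD.
Qed.

(** * The total derivative *)

(** The derivatives of consecutive summands telescope, and only the last one survives. *)
Lemma is_derive_Qinc_S n y : is_derive (Qinc (S n)) y (- (y ^ n / INR (fact n) * exp (- y))).
Proof.
  assert (Hf : forall k, INR (fact k) <> 0) by apply INR_fact_neq_0.
  induction n.
  - apply (is_derive_ext (fun x => exp (- x))).
    + intros x; unfold Qinc; simpl; field.
    + auto_derive; [trivial | simpl; field].
  - eapply is_derive_eq.
    + apply (is_derive_plus (V := R_NormedModule) (Qinc (S n))
        (fun x => x ^ S n / INR (fact (S n)) * exp (- x))); [exact IHn |].
      apply (is_derive_eq _ _ ((INR (S n) * y ^ n - y ^ S n) / INR (fact (S n)) * exp (- y))).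
      * auto_derive; [trivial |].
        change (match n with O => 1 | S _ => INR n + 1 end) with (INR (S n)).
        change (fact n + n * fact n)%nat with (fact (S n)); simpl pred.
        simpl pow; field; apply Hf.
      * reflexivity.
    + assert (Hr : - (y ^ n / INR (fact n) * exp (- y)) +
        (INR (S n) * y ^ n - y ^ S n) / INR (fact (S n)) * exp (- y) =
        - (y ^ S n / INR (fact (S n)) * exp (- y))); [| exact Hr].
      rewrite (fact_simpl n), mult_INR; field; split; [apply Hf | apply not_0_INR; lia].
Qed.

Lemma is_derive_mul_l c t : is_derive (fun u => c * u) t c.
Proof. auto_derive; [trivial | ring]. Qed.

Definition zpar (s : Cplx) (n : nat) : Cplx := Cadd (Csub C1 s) (RtoC (INR (S n))).

Lemma pow_zpar s n x : 0 < x ->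
  Cpow (RtoC x) (Csub (zpar s n) C1) = Cmul (Cpow (RtoC x) (Copp s)) (RtoC (x ^ S n)).
Proof.
  intros Hx; rewrite <- Cpow_RtoC_INR, <- Cpow_add by (exact Hx || apply RtoC_neq0; lra).
  f_equal; unfold zpar; ring.
Qed.

Lemma Cderiv_qterm s n t m :
  Cderiv (fun t => qterm s (S n) t m) t
    (Copp (Cmul (RtoC (t ^ n / INR (fact n))) (lterm (zpar s n) t m))).
Proof.
  set (x := INR (S m)); assert (Hx : 0 < x) by (apply lt_0_INR; lia).
  unfold qterm; eapply Cderiv_eq.
  - apply Cderiv_scal, Cderiv_RtoC.
    apply (is_derive_eq _ _ (x * - ((x * t) ^ n / INR (fact n) * exp (- (x * t))))); [| reflexivity].
    apply (is_derive_comp (V := R_NormedModule) (Qinc (S n)) (fun t => x * t)).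
    + apply is_derive_Qinc_S.
    + apply is_derive_mul_l.
  - unfold lterm; fold x; rewrite pow_zpar by exact Hx.
    replace (x * - ((x * t) ^ n / INR (fact n) * exp (- (x * t)))) with
      (- (t ^ n / INR (fact n) * (x ^ S n * exp (- (x * t)))))
      by (rewrite Rpow_mult_distr; simpl; field; apply INR_fact_neq_0).
    rewrite RtoC_opp, !RtoC_mul; ring.
Qed.

Definition gterm (s : Cplx) (n : nat) (t : R) : Cplx :=
  Cmul (Cdiv (Cgamma (zpar s n)) (Cmul (Csub C1 s) (RtoC (INR (fact n)))))
    (Cpow (RtoC t) (Copp (Csub C1 s))).

(** In this form the Gamma term is the k = 0 term of Lipschitz' formula with the very factor that
    multiplies the [lterm] sum in [zeta_limit]; the parts that may diverge as t tends to 0 therefore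
    cancel. *)
Lemma gterm_eq s n t : 0 < t -> Csub C1 s <> C0 ->
  gterm s n t = Cmul (Cdiv (RtoC (t ^ S n / INR (fact n))) (Csub C1 s))
    (Cmul (Cgamma (zpar s n)) (Cpow (RtoC t) (Copp (zpar s n)))).
Proof.
  intros Ht Ha; unfold gterm.
  replace (Cpow (RtoC t) (Copp (Csub C1 s))) with
    (Cmul (RtoC (t ^ S n)) (Cpow (RtoC t) (Copp (zpar s n)))).
  - rewrite RtoC_div by apply INR_fact_neq_0; field; split; first [exact Ha | apply RtoC_fact_neq0].
  - rewrite <- Cpow_RtoC_INR, <- Cpow_add by (exact Ht || apply RtoC_neq0; lra).
    f_equal; unfold zpar; ring.
Qed.

Lemma Cderiv_gterm s n t : 0 < t -> Csub C1 s <> C0 ->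
  Cderiv (gterm s n) t (Copp (Cmul (RtoC (t ^ n / INR (fact n)))
    (Cmul (Cgamma (zpar s n)) (Cpow (RtoC t) (Copp (zpar s n)))))).
Proof.
  intros Ht Ha; unfold gterm; eapply Cderiv_eq.
  - apply Cderiv_scal, Cderiv_pow; [exact Ht | apply Cderiv_id].
  - replace (Cpow (RtoC t) (Csub (Copp (Csub C1 s)) C1)) with
      (Cmul (RtoC (t ^ n)) (Cpow (RtoC t) (Copp (zpar s n)))).
    + rewrite RtoC_div by apply INR_fact_neq_0; field; split; first [exact Ha | apply RtoC_fact_neq0].
    + rewrite <- Cpow_RtoC_INR, <- Cpow_add by (exact Ht || apply RtoC_neq0; lra).
      f_equal; unfold zpar; rewrite RtoC_S; ring.
Qed.

Definition neg_terms (z : Cplx) (M : nat) (t : R) : Cplx :=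
  Csum (fun m => Cpow (node t (- Z.of_nat (S m))) (Copp z)) M.

Lemma lterm_series_cv z t : 0 < fst z -> 0 < t -> exists Lam, C_cv (Csum (lterm z t)) Lam.
Proof.
  intros Hz Ht; destruct (lterm_le_inv_sqr z t Hz Ht) as [C [HC H]].
  destruct (series_inv_sqr_cv C HC) as [S0 HS].
  destruct (series_dominated _ _ _ H HS) as [l [Hl _]]; exists l; exact Hl.
Qed.

Lemma lipschitz_tail z t Lam M W : 2 <= fst z -> 0 < t -> C_cv (Csum (lterm z t)) Lam ->
  (forall K, (M <= K)%nat -> Cnorm (Csub (Csum (pair_term z t) K) (neg_terms z M t)) <= W) ->
  Cnorm (Csub Lam (Cmul (Cgamma z) (Cadd (Cpow (RtoC t) (Copp z)) (neg_terms z M t)))) <=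
  Cnorm (Cgamma z) * W.
Proof.
  intros Hz Ht HL HW.
  pose proof (C_cv_sub _ _ _ _ (lipschitz z t Lam Hz Ht HL)
    (C_cv_const (Cmul (Cgamma z) (Cadd (Cpow (RtoC t) (Copp z)) (neg_terms z M t))))) as H.
  eapply C_cv_norm_le; [| exact H]; exists M; intros K HK; cbv beta.
  match goal with |- Cnorm ?u <= _ =>
    replace u with (Cmul (Cgamma z) (Csub (Csum (pair_term z t) K) (neg_terms z M t))) by ring end.
  rewrite Cnorm_mul; apply Rmult_le_compat_l; [apply Cnorm_ge0 | apply HW, HK].
Qed.

(** * Comparison of t = 0 with t = 1/N for an abstract correction [E] *)

Section MainEstimate.
Variables (s : Cplx) (n M : nat) (W W0 : R) (E : R -> Cplx).
Let z := zpar s n.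
Hypothesis Hs : 0 <= fst s.
Hypothesis Ha : Csub C1 s <> C0.
Hypothesis Hz : 2 <= fst z.
Hypothesis HW : forall t K, 0 < t -> (M <= K)%nat ->
  Cnorm (Csub (Csum (pair_term z t) K) (neg_terms z M t)) <= W.
Hypothesis HW0 : forall t K, 0 < t -> Cnorm (Csum (pair_term z t) K) <= W0.
Hypothesis HE : forall t, 0 < t ->
  Cderiv E t (Cmul (RtoC (t ^ n / INR (fact n))) (Cmul (Cgamma z) (neg_terms z M t))).
Hypothesis HE0 : forall t : nat -> R, Un_cv t 0 -> C_cv (fun i => E (t i)) C0.

(** Only the first J terms of the series are differentiated. The missing part of the Lipschitz sum
    is at most [r J], the tail of a majorant taken at [eps]; as the terms decrease in t, it serves
    the whole interval. The weight t^(v-1)/(v-1)! integrates to at most alpha^v/v!. [E] will be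
    [e1_total] for tau > 0, and 0 with M = 0 for tau = 0. *)
Lemma partial_increment alpha eps : 0 < eps <= alpha -> exists r, Un_cv r 0 /\ forall J,
  Cnorm (Csub (Cadd (Csub (Csum (qterm s (S n) alpha) J) (gterm s n alpha)) (E alpha))
              (Cadd (Csub (Csum (qterm s (S n) eps) J) (gterm s n eps)) (E eps)))
  <= (Cnorm (Cgamma z) * W + r J) * (alpha ^ S n / INR (fact (S n))).
Proof.
  intros He.
  destruct (lterm_le_inv_sqr z eps ltac:(lra) ltac:(lra)) as [C [HC Hl]].
  destruct (series_inv_sqr_cv C HC) as [SC HSC].
  exists (fun J => SC - Rsum (fun k => C * / (INR k + 1) ^ 2) J); split.
  { pose proof (CV_minus (fun _ => SC) _ _ _ (Un_cv_const SC) HSC) as H.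
    rewrite Rminus_diag in H; exact H. }
  intros J; set (B := Cnorm (Cgamma z) * W + _).
  assert (Hpt : forall t, eps <= t <= alpha ->
    Cnorm (Csub (Cmul (Cgamma z) (Cadd (Cpow (RtoC t) (Copp z)) (neg_terms z M t)))
      (Csum (lterm z t) J)) <= B).
  { intros t Ht; destruct (lterm_series_cv z t) as [Lam HL]; [lra | lra |].
    pose proof (lipschitz_tail z t Lam M W Hz ltac:(lra) HL (fun K HK => HW t K ltac:(lra) HK)) as H1.
    assert (H2 : Cnorm (Csub Lam (Csum (lterm z t) J)) <= SC - Rsum (fun k => C * / (INR k + 1) ^ 2) J).
    { apply (series_tail (lterm z t)); [| exact HSC | exact HL].
      intros k; eapply Rle_trans; [| apply Hl]; rewrite !Cnorm_lterm; apply exp_le.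
      pose proof (pos_INR (S k)); nra. }
    rewrite Cnorm_sub_sym in H1.
    eapply Rle_trans; [apply (Cnorm_sub3 _ Lam) |]; unfold B; lra. }
  assert (HB : 0 <= B) by (eapply Rle_trans; [apply Cnorm_ge0 | apply (Hpt eps); lra]).
  assert (Hfp : 0 < INR (fact (S n))) by apply INR_fact_lt_0.
  apply Rle_trans with (B / INR (fact (S n)) * alpha ^ S n - B / INR (fact (S n)) * eps ^ S n).
  2:{ assert (0 <= B / INR (fact (S n)) * eps ^ S n).
      { apply Rmult_le_pos; [apply Rdiv_le_0_compat; lra | apply pow_le; lra]. }
      unfold Rdiv in *; lra. }
  apply (mvt_cmp (fun t => Cadd (Csub (Csum (qterm s (S n) t) J) (gterm s n t)) (E t))
    (fun t => Cmul (RtoC (t ^ n / INR (fact n))) (Csub (Cmul (Cgamma z)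
      (Cadd (Cpow (RtoC t) (Copp z)) (neg_terms z M t))) (Csum (lterm z t) J)))
    (fun t => B / INR (fact (S n)) * t ^ S n) (fun t => t ^ n / INR (fact n) * B)); [lra | | |].
  - intros t Ht; eapply Cderiv_eq.
    + apply Cderiv_add; [apply Cderiv_sub |].
      * apply (Cderiv_Csum (fun m t => qterm s (S n) t m)
          (fun m t => Copp (Cmul (RtoC (t ^ n / INR (fact n))) (lterm z t m)))).
        intros; apply Cderiv_qterm.
      * apply Cderiv_gterm; [lra | exact Ha].
      * apply HE; lra.
    + rewrite (Csum_ext _ (fun m => Cmul (Copp (RtoC (t ^ n / INR (fact n)))) (lterm z t m)))
        by (intros; ring).
      rewrite Csum_scal; fold z; ring.
  - intros t _; auto_derive; [trivial |].
    change (match n with O => 1 | S _ => INR n + 1 end) with (INR (S n)).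
    change (fact n + n * fact n)%nat with (fact (S n)); simpl pred.
    rewrite (fact_simpl n), mult_INR; field; split; first [apply INR_fact_neq_0 | apply not_0_INR; lia].
  - intros t Ht; assert (Hc : 0 <= t ^ n / INR (fact n)).
    { apply Rdiv_le_0_compat; [apply pow_le; lra | apply INR_fact_lt_0]. }
    rewrite Cnorm_mul, Cnorm_RtoC, Rabs_pos_eq by exact Hc.
    apply Rmult_le_compat_l; [exact Hc | apply Hpt, Ht].
Qed.

Lemma full_increment alpha eps D De : 0 < eps <= alpha ->
  C_cv (Csum (qterm s (S n) alpha)) D -> C_cv (Csum (qterm s (S n) eps)) De ->
  Cnorm (Csub (Cadd (Csub D (gterm s n alpha)) (E alpha)) (Cadd (Csub De (gterm s n eps)) (E eps)))
  <= Cnorm (Cgamma z) * W * (alpha ^ S n / INR (fact (S n))).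
Proof.
  intros He HD HDe; destruct (partial_increment alpha eps He) as [r [Hr H]].
  eapply (Un_cv_le _ _ _ _ (ex_intro _ 0%nat (fun J _ => H J))).
  - apply C_cv_norm, C_cv_sub; (apply C_cv_add; [apply C_cv_sub; [eassumption | apply C_cv_const] |
      apply C_cv_const]).
  - pose proof (CV_plus _ _ _ _ (Un_cv_const (Cnorm (Cgamma z) * W)) Hr) as H1.
    rewrite Rplus_0_r in H1; apply (CV_mult _ _ _ _ H1 (Un_cv_const _)).
Qed.

(** Replaces the [lterm] sum in [zeta_limit] by its k = 0 term. The other nodes contribute at most
    |Gamma(z)| [W0], and the factor t^v sends this to 0. *)
Lemma zeta_limit_gterm (t : nat -> R) (D : nat -> Cplx) : (forall i, 0 < t i) -> Un_cv t 0 ->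
  (forall i, C_cv (Csum (qterm s (S n) (t i))) (D i)) ->
  C_cv (fun i => Csub (D i) (gterm s n (t i))) (zeta s).
Proof.
  intros Ht Ht0 HD.
  assert (HL : exists Lam, forall i, C_cv (Csum (lterm z (t i))) (Lam i)).
  { exists (fun i => Clim (Csum (lterm z (t i)))); intros i.
    destruct (lterm_series_cv z (t i) ltac:(lra) (Ht i)) as [l Hl]; rewrite (Clim_eq _ _ Hl); exact Hl. }
  destruct HL as [Lam HL].
  pose proof (zeta_limit s n t D Lam Hs Ha Ht Ht0 HD HL) as H.
  set (c := Cdiv (RtoC (/ INR (fact n))) (Csub C1 s)).
  assert (Hc : C_cv (fun i => Cmul c (Cmul (RtoC (t i ^ S n))
    (Csub (Lam i) (Cmul (Cgamma z) (Cpow (RtoC (t i)) (Copp z)))))) C0).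
  { replace C0 with (Cmul c C0) by ring; apply C_cv_scal.
    apply (C_cv_le _ _ (fun i => (Cnorm (Cgamma z) * W0) * (t i ^ S n))).
    - exists 0%nat; intros i _; specialize (Ht i).
      assert (Hp : 0 <= t i ^ S n) by (apply pow_le; lra).
      match goal with |- Cnorm (Csub ?u C0) <= _ => replace (Csub u C0) with u by ring end.
      rewrite Cnorm_mul, Cnorm_RtoC, Rabs_pos_eq, Rmult_comm by exact Hp.
      apply Rmult_le_compat_r; [exact Hp |].
      replace (Cpow (RtoC (t i)) (Copp z)) with (Cadd (Cpow (RtoC (t i)) (Copp z)) (neg_terms z 0 (t i)))
        by (unfold neg_terms; rewrite Csum_0; ring).
      apply lipschitz_tail; try assumption; [apply HL |].
      intros K _; unfold neg_terms; rewrite Csum_0.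
      replace (Csub (Csum (pair_term z (t i)) K) C0) with (Csum (pair_term z (t i)) K) by ring.
      apply HW0, Ht.
    - replace 0 with (Cnorm (Cgamma z) * W0 * 0) by ring; apply Un_cv_scal.
      replace 0 with (0 ^ S n) by (apply pow_i; lia).
      apply (continuity_seq (fun u => u ^ S n)); [apply derivable_continuous_pt, derivable_pt_pow | exact Ht0]. }
  pose proof (C_cv_add _ _ _ _ H Hc) as HH.
  replace (Cadd (zeta s) C0) with (zeta s) in HH by ring.
  apply (C_cv_ext _ _ _ (fun i => eq_refl)) in HH.
  eapply C_cv_ext; [| exact HH]; intros i; cbv beta.
  rewrite gterm_eq by (apply Ht || exact Ha).
  unfold c; rewrite RtoC_div, RtoC_inv by apply INR_fact_neq_0; fold z.
  field; split; first [exact Ha | apply RtoC_fact_neq0].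
Qed.

Lemma zeta_increment alpha D : 0 < alpha -> C_cv (Csum (qterm s (S n) alpha)) D ->
  Cnorm (Csub (Cadd (Csub D (gterm s n alpha)) (E alpha)) (zeta s))
  <= Cnorm (Cgamma z) * W * (alpha ^ S n / INR (fact (S n))).
Proof.
  intros Hal HD.
  (* A sequence of lower end points tending to 0, along which the left-hand bracket tends to
     [zeta s]. *)
  set (t := fun i => alpha / (INR i + 1)).
  assert (Ht : forall i, 0 < t i <= alpha).
  { intros i; pose proof (pos_INR i); unfold t; split; [apply Rdiv_lt_0_compat; lra |].
    apply (Rmult_le_reg_r (INR i + 1)); [lra |]; unfold Rdiv; rewrite Rmult_assoc, Rinv_l by lra; nra. }
  assert (HDi : forall i, C_cv (Csum (qterm s (S n) (t i))) (Clim (Csum (qterm s (S n) (t i))))).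
  { intros i; destruct (qterm_series_cv s (S n) (t i) (proj1 (Ht i))) as [l Hl].
    rewrite (Clim_eq _ _ Hl); exact Hl. }
  pose proof (zeta_limit_gterm t _ (fun i => proj1 (Ht i)) (Un_cv_inv_INR_S alpha) HDi) as H.
  pose proof (C_cv_add _ _ _ _ H (HE0 t (Un_cv_inv_INR_S alpha))) as H1.
  replace (Cadd (zeta s) C0) with (zeta s) in H1 by ring.
  eapply C_cv_norm_le.
  2:{ apply C_cv_sub; [apply C_cv_const | exact H1]. }
  exists 0%nat; intros i _; cbv beta; apply full_increment; [apply Ht | exact HD | apply HDi].
Qed.
End MainEstimate.

(** * The correction term *)

Lemma Cderiv_pown f x l n : Cderiv f x l ->
  Cderiv (fun t => Cpown (f t) n) x (Cmul (Cmul (RtoC (INR n)) (Cpown (f x) (pred n))) l).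
Proof.
  intros H; induction n.
  - simpl; eapply Cderiv_eq; [apply (Cderiv_const C1) | ring].
  - eapply Cderiv_eq; [apply (Cderiv_mul _ _ _ _ _ H IHn) |].
    rewrite RtoC_S; simpl pred; destruct n; simpl Cpown; simpl pred.
    + simpl INR; ring.
    + ring.
Qed.

Lemma Cbinom_0 z : Cbinom z 0 = C1.
Proof. unfold Cbinom; simpl; change (1, 0) with C1; field; apply RtoC_neq0; lra. Qed.

Lemma Cbinom_S z w :
  Cmul (Cadd (RtoC (INR w)) C1) (Cbinom z (S w)) = Cmul (Csub z (RtoC (INR w))) (Cbinom z w).
Proof.
  unfold Cbinom; rewrite RtoC_fact_S, Cprod_S.
  field; split; first [apply RtoC_fact_neq0 | apply RtoC_S_neq0].
Qed.

Definition shift (t : R) : Cplx := (0, t / (2 * PI)).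

(* [E1m] as a function of [t = 1 / N] and of a positive real in place of [m]. *)
Definition e1 (s : Cplx) (v : nat) (x t : R) : Cplx :=
  let s1 := Csub s C1 in
  Csub (Cpow (RtoC x) s1)
    (Csum (fun w => Cmul (Cmul (Cbinom s1 w) (Cpow (Cadd (RtoC x) (shift t)) (Csub s1 (RtoC (INR w)))))
      (Cpown (Copp (shift t)) w)) v).

Lemma E1m_e1 s v N m : N <> 0 -> E1m s v N m = e1 s v (INR m) (/ N).
Proof.
  intros HN; unfold E1m, e1, shift; pose proof PI_neq0.
  replace (1 / (2 * PI * N)) with (/ N / (2 * PI)) by (field; split; assumption).
  reflexivity.
Qed.

Lemma Cderiv_shift t : Cderiv shift t (0, / (2 * PI)).
Proof.
  split; unfold shift; simpl.
  - apply (is_derive_const (V := R_NormedModule)).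
  - pose proof PI_neq0; auto_derive; [trivial | field; assumption].
Qed.

Definition e1_deriv (s : Cplx) (n : nat) (x t : R) : Cplx :=
  Copp (Cmul (0, / (2 * PI)) (Cmul (Cmul (Cmul (RtoC (INR (S n))) (Cbinom (Csub s C1) (S n)))
      (Cpow (Cadd (RtoC x) (shift t)) (Copp (zpar s n)))) (Cpown (Copp (shift t)) n))).

(* The derivatives of the summands telescope. *)
Lemma Cderiv_e1 s n x t : 0 < x ->
  Cderiv (e1 s (S n) x) t
    (e1_deriv s n x t).
Proof.
  intros Hx; unfold e1_deriv; set (s1 := Csub s C1); set (kap := (0, / (2 * PI)) : Cplx).
  set (y := Cadd (RtoC x) (shift t)).
  assert (Hy : 0 < fst y) by (unfold y, Cadd, RtoC, shift; simpl; lra).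
  set (U := fun w => Cmul kap (Cmul (Cmul (Cmul (RtoC (INR w)) (Cbinom s1 w))
    (Cpow y (Csub s1 (RtoC (INR w))))) (Cpown (Copp (shift t)) (pred w)))).
  assert (HT : forall v, Cderiv (fun u => Csum (fun w => Cmul (Cmul (Cbinom s1 w)
      (Cpow (Cadd (RtoC x) (shift u)) (Csub s1 (RtoC (INR w))))) (Cpown (Copp (shift u)) w)) v) t (U v)).
  { induction v.
    - eapply Cderiv_eq; [apply (Cderiv_const C0) | unfold U; simpl INR; ring].
    - eapply Cderiv_eq.
      + apply Cderiv_add; [exact IHv |].
        apply Cderiv_mul.
        * apply Cderiv_scal, Cderiv_pow; [exact Hy |].
          apply Cderiv_add; [apply Cderiv_const | apply Cderiv_shift].
        * apply Cderiv_pown, Cderiv_opp, Cderiv_shift.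
      + cbv beta; unfold U; fold y kap.
        replace (Csub s1 (RtoC (INR (S v)))) with (Csub (Csub s1 (RtoC (INR v))) C1)
          by (rewrite RtoC_S; ring).
        rewrite (RtoC_S v).
        replace (Cmul (Cadd (RtoC (INR v)) C1) (Cbinom s1 (S v))) with
          (Cmul (Csub s1 (RtoC (INR v))) (Cbinom s1 v)) by (symmetry; apply Cbinom_S).
        simpl (pred (S v)); ring. }
  eapply Cderiv_eq.
  - unfold e1; fold s1; apply Cderiv_sub; [apply Cderiv_const | apply HT].
  - unfold U; simpl (pred (S n)).
    replace (Csub s1 (RtoC (INR (S n)))) with (Copp (zpar s n)) by (unfold zpar, s1; ring).
    ring.
Qed.

Lemma e1_at_0 s n x : 0 < x -> e1 s (S n) x 0 = C0.
Proof.
  intros Hx; unfold e1.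
  assert (E : shift 0 = C0) by (unfold shift, RtoC; f_equal; unfold Rdiv; ring).
  rewrite E, Csum_S_l, Cbinom_0.
  rewrite (Csum_ext _ (fun _ => C0)) by (intros; simpl Cpown; ring).
  rewrite Csum_const; simpl Cpown; change (1, 0) with C1; simpl (INR 0).
  replace (Cadd (RtoC x) C0) with (RtoC x) by ring.
  replace (Csub (Csub s C1) C0) with (Csub s C1) by ring; ring.
Qed.

Lemma atan_opp_inv_arg x t : 0 < x -> 0 < t ->
  atan (- (2 * PI * x) / t) = atan (t / (2 * PI) / x) - PI / 2.
Proof.
  intros Hx Ht; pose proof PI_RGT_0.
  assert (Hu : 0 < t / (2 * PI) / x) by (apply Rdiv_lt_0_compat; [apply Rdiv_lt_0_compat |]; lra).
  replace (- (2 * PI * x) / t) with (- / (t / (2 * PI) / x)) by (field; lra).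
  rewrite atan_opp, atan_inv by exact Hu; ring.
Qed.

(** One has t - 2 pi i k = 2 pi e^(-i pi/2) (k + it/(2 pi)). The last factor has its argument in (0,
    pi/2), so subtracting pi/2 stays on the principal branch. This produces the factor e^(i pi
    (1-s)/2) of E_1. *)
Lemma Cpow_node_neg z k t : 0 < t -> (0 < k)%nat ->
  Cpow (node t (- Z.of_nat k)) (Copp z) =
  Cmul (Cmul (Cpow (RtoC (2 * PI)) (Copp z)) (Cexp (Cmul (0, PI / 2) z)))
    (Cpow (Cadd (RtoC (INR k)) (shift t)) (Copp z)).
Proof.
  intros Ht Hk; pose proof PI_RGT_0 as Hpi.
  assert (Hx : 0 < INR k) by (apply lt_0_INR, Hk).
  set (y := Cadd (RtoC (INR k)) (shift t)).
  assert (Hy : 0 < fst y) by (unfold y, Cadd, RtoC, shift; simpl; lra).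
  assert (Hnode : node t (- Z.of_nat k) = Cmul (Cmul (RtoC (2 * PI)) (0, - (1))) y).
  { apply Ceq; unfold node, y, shift, Cadd, Cmul, RtoC; simpl; rewrite ?opp_IZR, <- ?INR_IZR_INZ;
      field; lra. }
  assert (Hn : Cnorm (node t (- Z.of_nat k)) = 2 * PI * Cnorm y).
  { rewrite Hnode, !Cnorm_mul, Cnorm_RtoC, Rabs_pos_eq by lra.
    replace (Cnorm (0, - (1))) with 1; [ring |].
    symmetry; apply Cnorm_unique; simpl; lra. }
  assert (Hlog : Clog (node t (- Z.of_nat k)) = Cadd (Csub (RtoC (ln (2 * PI))) (0, PI / 2)) (Clog y)).
  { unfold Clog at 1; rewrite Hn, ln_mult, Carg_pos by
      (first [exact Ht | lra | apply Cnorm_gt0, fst_gt0_neq0, Hy]).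
    unfold Clog; rewrite (Carg_pos y) by exact Hy.
    replace (snd (node t (- Z.of_nat k)) / fst (node t (- Z.of_nat k))) with (- (2 * PI * INR k) / t)
      by (unfold node; simpl; rewrite opp_IZR, <- INR_IZR_INZ; field; lra).
    rewrite atan_opp_inv_arg by assumption.
    replace (snd y / fst y) with (t / (2 * PI) / INR k)
      by (unfold y, Cadd, RtoC, shift; simpl; field; lra).
    apply Ceq; unfold Cadd, Csub, Copp, RtoC; simpl; ring. }
  rewrite !Cpow_exp, Hlog, (Clog_RtoC (2 * PI)), <- !Cexp_add by
    (first [lra | apply RtoC_neq0; lra | apply fst_gt0_neq0; first [exact Hy | exact Ht]]).
  f_equal; ring.
Qed.

Definition e1_pref (s : Cplx) : Cplx :=
  Cmul (Cmul (Cpow (RtoC (2 * PI)) (Copp (Csub C1 s))) (Cgamma (Csub C1 s)))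
    (Cexp (Cmul (0, PI / 2) (Csub C1 s))).

Lemma Cpown_opp1 n : Cpown (Copp C1) n = RtoC ((-1) ^ n).
Proof. rewrite <- Cpown_RtoC; f_equal; rewrite <- RtoC_opp; f_equal; ring. Qed.

Lemma Cexp_quarter_turns n : Cexp (Cmul (0, PI / 2) (RtoC (INR n))) = Cpown Ci n.
Proof.
  replace Ci with (Cexp (0, PI / 2)).
  - rewrite Cpown_exp; f_equal; ring.
  - unfold Cexp, Ci; simpl; rewrite exp_0, cos_PI2, sin_PI2; f_equal; ring.
Qed.

Lemma Cprod_sub_opp a n :
  Cprod (fun j => Csub (Copp a) (RtoC (INR j))) n =
  Cmul (RtoC ((-1) ^ n)) (Cprod (fun j => Cadd a (RtoC (INR j))) n).
Proof.
  induction n; [simpl; change (1, 0) with C1; ring |].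
  rewrite !Cprod_S, IHn; simpl pow; rewrite RtoC_mul.
  replace (RtoC (-1)) with (Copp C1) by (rewrite <- RtoC_opp; f_equal; ring); ring.
Qed.

(** The falling product of s-1 is, up to sign, the rising product of 1-s, which turns Gamma(1-s)
    into Gamma(z). The remaining signs and powers of i combine to i^v, as in e^(i pi z/2). *)
Lemma e1_deriv_node s n k t : 0 < t -> (0 < k)%nat -> not_pole (Csub C1 s) ->
  Cmul (e1_pref s)
    (e1_deriv s n (INR k) t) =
  Cmul (RtoC (t ^ n / INR (fact n)))
    (Cmul (Cgamma (zpar s n)) (Cpow (node t (- Z.of_nat k)) (Copp (zpar s n)))).
Proof.
  intros Ht Hk Hp; pose proof PI_RGT_0 as Hpi; unfold e1_deriv.
  rewrite Cpow_node_neg by assumption.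
  set (Y := Cpow (Cadd (RtoC (INR k)) (shift t)) (Copp (zpar s n))).
  unfold zpar; rewrite Cgamma_add_INR by exact Hp.
  set (a := Csub C1 s); set (Pr := Cprod (fun j => Cadd a (RtoC (INR j))) (S n)).
  assert (Hb : Cmul (RtoC (INR (S n))) (Cbinom (Csub s C1) (S n)) =
    Cmul (RtoC ((-1) ^ S n)) (Cdiv Pr (RtoC (INR (fact n))))).
  { unfold Cbinom; replace (Csub s C1) with (Copp a) by (unfold a; ring).
    rewrite Cprod_sub_opp, RtoC_fact_S, (RtoC_S n); fold Pr.
    field; split; first [apply RtoC_fact_neq0 | apply RtoC_S_neq0]. }
  rewrite Hb.
  assert (H2 : Cpow (RtoC (2 * PI)) (Copp (Cadd a (RtoC (INR (S n))))) =
    Cmul (Cpow (RtoC (2 * PI)) (Copp a)) (RtoC (/ (2 * PI) ^ S n))).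
  { replace (Copp (Cadd a (RtoC (INR (S n))))) with (Cadd (Copp a) (Copp (RtoC (INR (S n))))) by ring.
    rewrite Cpow_add, (Cpow_opp _ (RtoC (INR (S n)))), Cpow_RtoC_INR, <- RtoC_inv
      by (first [lra | apply RtoC_neq0; lra | apply pow_nonzero; lra]); reflexivity. }
  assert (H3 : Cexp (Cmul (0, PI / 2) (Cadd a (RtoC (INR (S n))))) =
    Cmul (Cexp (Cmul (0, PI / 2) a)) (Cpown Ci (S n))).
  { rewrite <- Cexp_quarter_turns, <- Cexp_add; f_equal; ring. }
  rewrite H2, H3; unfold e1_pref; fold a.
  assert (H4 : Cpown (Copp (shift t)) n =
    Cmul (RtoC ((-1) ^ n)) (Cmul (Cpown Ci n) (RtoC (t ^ n / (2 * PI) ^ n)))).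
  { replace (Copp (shift t)) with (Cmul (Copp C1) (Cmul Ci (RtoC (t / (2 * PI)))))
      by (apply Ceq; unfold shift, Cmul, Copp, Ci, RtoC; simpl; ring).
    rewrite !Cpown_mul, Cpown_opp1, Cpown_RtoC; do 3 f_equal.
    unfold Rdiv; rewrite Rpow_mult_distr, pow_inv; reflexivity. }
  rewrite H4.
  assert (H5 : ((0, / (2 * PI)) : Cplx) = Cmul Ci (RtoC (/ (2 * PI))))
    by (apply Ceq; unfold Cmul, Ci, RtoC; simpl; ring).
  rewrite H5; simpl (Cpown Ci (S n)).
  assert (Hsg : (-1) ^ S n = - (-1) ^ n) by (simpl; ring).
  assert (Hsg2 : Cmul (RtoC ((-1) ^ n)) (RtoC ((-1) ^ n)) = C1).
  { rewrite <- RtoC_mul, <- Rpow_mult_distr; f_equal.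
    replace (-1 * -1) with 1 by ring; apply pow1. }
  rewrite Hsg, RtoC_opp.
  assert (Hpn : (2 * PI) ^ n <> 0) by (apply pow_nonzero; lra).
  replace (RtoC (/ (2 * PI) ^ S n)) with (Cmul (RtoC (/ (2 * PI))) (RtoC (/ (2 * PI) ^ n)))
    by (rewrite <- RtoC_mul; f_equal; simpl; field; lra).
  replace (RtoC (t ^ n / (2 * PI) ^ n)) with (Cmul (RtoC (t ^ n)) (RtoC (/ (2 * PI) ^ n)))
    by (rewrite <- RtoC_mul; reflexivity).
  rewrite RtoC_div by apply INR_fact_neq_0.
  set (e := RtoC ((-1) ^ n)) in *.
  set (F := RtoC (INR (fact n))).
  assert (HF : F <> C0) by apply RtoC_fact_neq0.
  (* The left side carries the sign (-1)^n twice; inserting its square on the right lets [field]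
     treat it as an atom. *)
  match goal with |- ?l = ?r =>
    transitivity (Cmul (Cmul e e) r); [field; exact HF | rewrite Hsg2; ring] end.
Qed.

Lemma Cderiv_cv f t0 l (t : nat -> R) : Cderiv f t0 l -> Un_cv t t0 -> C_cv (fun i => f (t i)) (f t0).
Proof.
  intros [H1 H2] Ht.
  assert (Hc : forall g : R -> R, ex_derive g t0 -> Un_cv (fun i => g (t i)) (g t0)).
  { intros g Hg; apply (continuity_seq g); [| exact Ht].
    apply derivable_continuous_pt, ex_derive_Reals_0, Hg. }
  pose proof (Hc _ (ex_intro _ _ H1)) as K1; pose proof (Hc _ (ex_intro _ _ H2)) as K2.
  intros eps He.
  destruct (K1 (eps / 2)) as [n1 Hn1]; [lra |]; destruct (K2 (eps / 2)) as [n2 Hn2]; [lra |].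
  exists (n1 + n2)%nat; intros n Hn.
  specialize (Hn1 n ltac:(lia)); specialize (Hn2 n ltac:(lia)).
  eapply Rle_lt_trans; [apply Cnorm_le_abs |].
  unfold Rdist, Csub, Cadd, Copp, Rminus in *; simpl in *; lra.
Qed.

Definition e1_total (s : Cplx) (v M : nat) (t : R) : Cplx :=
  Cmul (e1_pref s) (Csum (fun k => e1 s v (INR (S k)) t) M).

Lemma Cderiv_e1_total s n M t : 0 < t -> not_pole (Csub C1 s) ->
  Cderiv (e1_total s (S n) M) t
    (Cmul (RtoC (t ^ n / INR (fact n))) (Cmul (Cgamma (zpar s n)) (neg_terms (zpar s n) M t))).
Proof.
  intros Ht Hp; eapply Cderiv_eq.
  - apply Cderiv_scal.
    apply (Cderiv_Csum (fun k t => e1 s (S n) (INR (S k)) t) (fun k t => e1_deriv s n (INR (S k)) t)).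
    intros k _; apply Cderiv_e1, lt_0_INR; lia.
  - cbv beta; unfold neg_terms; rewrite <- !Csum_scal; apply Csum_ext; intros k _.
    apply e1_deriv_node; [exact Ht | lia | exact Hp].
Qed.

Lemma e1_total_cv0 s n M (t : nat -> R) : Un_cv t 0 -> C_cv (fun i => e1_total s (S n) M (t i)) C0.
Proof.
  intros Ht.
  replace C0 with (Cmul (e1_pref s) (Csum (fun _ => C0) M)) by (rewrite Csum_const; ring).
  apply C_cv_scal, (C_cv_Csum (fun i k => e1 s (S n) (INR (S k)) (t i)) (fun _ => C0)).
  intros k _; assert (Hk : 0 < INR (S k)) by (apply lt_0_INR; lia).
  rewrite <- (e1_at_0 s n (INR (S k)) Hk).
  eapply Cderiv_cv; [apply Cderiv_e1, Hk | exact Ht].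
Qed.

(** * Bounds for the Gamma function *)

(** Equal to ln |u + i tau| - ln u: the gain of one complex factor of the Gauss product over the
    real one. *)
Definition gln (tau u : R) : R := / 2 * ln (1 + tau * tau / (u * u)).

Lemma gln_arg_ge1 tau u : 0 < u -> 1 <= 1 + tau * tau / (u * u).
Proof.
  intros Hu; assert (0 <= tau * tau / (u * u)) by (apply Rdiv_le_0_compat; nra); lra.
Qed.

Lemma gln_ge0 tau u : 0 < u -> 0 <= gln tau u.
Proof.
  intros Hu; unfold gln; pose proof (gln_arg_ge1 tau u Hu).
  assert (0 <= ln (1 + tau * tau / (u * u))) by (rewrite <- ln_1; apply ln_le; lra); lra.
Qed.

Lemma Cnorm_gln u tau : 0 < u -> Cnorm (u, tau) = u * exp (gln tau u).
Proof.
  intros Hu; apply Cnorm_unique.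
  - apply Rmult_le_pos; [lra | left; apply exp_pos].
  - replace (u * exp (gln tau u) * (u * exp (gln tau u))) with
      (u * u * exp (gln tau u + gln tau u)) by (rewrite exp_plus; ring).
    replace (gln tau u + gln tau u) with (ln (1 + tau * tau / (u * u))) by (unfold gln; field).
    pose proof (gln_arg_ge1 tau u Hu); rewrite exp_ln by lra; simpl; field; lra.
Qed.

Lemma Cnorm_Cprod_gln b tau n : 0 < b ->
  Cnorm (Cprod (fun k => Cadd (b, tau) (RtoC (INR k))) n) =
  Cnorm (Cprod (fun k => Cadd (RtoC b) (RtoC (INR k))) n) * exp (Rsum (fun k => gln tau (b + INR k)) n).
Proof.
  intros Hb; induction n.
  - simpl Cprod; simpl Rsum; rewrite exp_0; ring.
  - assert (Hu : 0 < b + INR n) by (pose proof (pos_INR n); lra).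
    rewrite !Cprod_S, !Cnorm_mul, IHn, Rsum_S, exp_plus.
    replace (Cadd (b, tau) (RtoC (INR n))) with ((b + INR n, tau) : Cplx)
      by (apply Ceq; unfold Cadd, RtoC; simpl; ring).
    rewrite Cnorm_gln by exact Hu.
    rewrite <- RtoC_add, Cnorm_RtoC, Rabs_pos_eq by lra; ring.
Qed.

Lemma Cnorm_gauss b tau n : 0 < b -> (0 < n)%nat ->
  Cnorm (gauss (b, tau) n) =
  Cnorm (gauss (RtoC b) n) * exp (- Rsum (fun k => gln tau (b + INR k)) (S n)).
Proof.
  intros Hb Hn; assert (HI : 0 < INR n) by (apply lt_0_INR, Hn).
  assert (Hp1 : Cprod (fun k => Cadd (b, tau) (RtoC (INR k))) (S n) <> C0)
    by (apply Cprod_not_pole, not_pole_gt0; exact Hb).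
  assert (Hp2 : Cprod (fun k => Cadd (RtoC b) (RtoC (INR k))) (S n) <> C0)
    by (apply Cprod_not_pole, not_pole_gt0; exact Hb).
  unfold gauss; rewrite !Cnorm_div, !Cnorm_mul, !Cnorm_pow_RtoC by assumption.
  rewrite Cnorm_Cprod_gln, exp_Ropp by exact Hb; simpl fst.
  pose proof (exp_pos (Rsum (fun k => gln tau (b + INR k)) (S n))).
  pose proof (Cnorm_gt0 _ Hp2); field; lra.
Qed.

(** A primitive of [gln tau]. Its limit at infinity is pi tau/2, the source of the decay e^(-pi
    tau/2). *)
Definition gprim (tau u : R) : R := u * gln tau u + tau * atan (u / tau).

Lemma is_derive_gln tau u : 0 < u ->
  is_derive (gln tau) u (- (tau * tau / (u * (u * u + tau * tau)))).
Proof.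
  intros Hu; unfold gln; pose proof (gln_arg_ge1 tau u Hu).
  auto_derive.
  - split; [nra | split; [lra | trivial]].
  - field; repeat split; nra.
Qed.

Lemma is_derive_gprim tau u : 0 < tau -> 0 < u -> is_derive (gprim tau) u (gln tau u).
Proof.
  intros Ht Hu; assert (Hq : 0 < tau * tau + u * u) by nra.
  assert (E : (1 * gln tau u + u * - (tau * tau / (u * (u * u + tau * tau)))) +
    tau * (/ tau * / (1 + (u / tau) * (u / tau))) = gln tau u) by (field; repeat split; nra).
  rewrite <- E at 1; unfold gprim; apply (is_derive_plus (V := R_NormedModule) (fun u => u * gln tau u)).
  - apply is_derive_Rmult; [apply (is_derive_id (K := R_AbsRing)) | apply is_derive_gln, Hu].
  - auto_derive; [trivial | unfold Rsqr; field; split; lra].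
Qed.

Lemma gln_deriv_incr tau u1 u2 : 0 < u1 <= u2 ->
  - (tau * tau / (u1 * (u1 * u1 + tau * tau))) <= - (tau * tau / (u2 * (u2 * u2 + tau * tau))).
Proof.
  intros Hu; assert (H1 : 0 < u1 * u1) by nra; assert (H2 : u1 * u1 <= u2 * u2) by nra.
  pose proof (Rle_0_sqr tau) as H0; unfold Rsqr in H0.
  apply Ropp_le_contravar; unfold Rdiv; apply Rmult_le_compat_l; [exact H0 |].
  apply Rinv_le_contravar; [apply Rmult_lt_0_compat; lra |].
  apply Rmult_le_compat; lra.
Qed.

(* The trapezoidal rule overestimates the integral of the convex function [gln tau]. *)
Lemma gprim_trapezoid tau u : 0 < tau -> 0 < u ->
  gprim tau (u + 1) - gprim tau u <= / 2 * (gln tau u + gln tau (u + 1)).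
Proof.
  intros Ht Hu.
  set (g' := fun y => - (tau * tau / (y * (y * y + tau * tau)))).
  assert (Hsh : forall (f : R -> R) (h l : R), is_derive f (u + h) l -> is_derive (fun y => f (u + y)) h l).
  { intros f h l Hf; apply (is_derive_eq _ _ (1 * l)); [| ring].
    apply (is_derive_comp (V := R_NormedModule) f (fun y => u + y) h); [exact Hf |].
    auto_derive; [trivial | ring]. }
  assert (Htan : forall h, 0 <= h <= 1 -> gln tau (u + h) - gln tau u <= h * g' (u + h)).
  { intros h Hh.
    assert (H : 0 * g' (u + h) - gln tau (u + 0) <= h * g' (u + h) - gln tau (u + h)).
    { apply (incr_of_deriv (fun y => y * g' (u + h) - gln tau (u + y))
        (fun y => g' (u + h) - g' (u + y))); [lra | |].
      - intros y Hy; apply (is_derive_minus (V := R_NormedModule) (fun y => y * g' (u + h))).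
        + auto_derive; [trivial | ring].
        + apply Hsh, is_derive_gln; lra.
      - intros y Hy; unfold g'; pose proof (gln_deriv_incr tau (u + y) (u + h) ltac:(lra)); lra. }
    rewrite Rplus_0_r in H; lra. }
  assert (H : 0 / 2 * (gln tau u + gln tau (u + 0)) - (gprim tau (u + 0) - gprim tau u) <=
    1 / 2 * (gln tau u + gln tau (u + 1)) - (gprim tau (u + 1) - gprim tau u)).
  { apply (incr_of_deriv (fun h => h / 2 * (gln tau u + gln tau (u + h)) - (gprim tau (u + h) - gprim tau u))
      (fun h => (/ 2 * (gln tau u + gln tau (u + h)) + h / 2 * (0 + g' (u + h))) - (gln tau (u + h) - 0))); [lra | |].
    - intros h Hh.
      apply (is_derive_minus (V := R_NormedModule) (fun h => h / 2 * (gln tau u + gln tau (u + h)))).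
      + apply (is_derive_Rmult (fun h => h / 2) (fun h => gln tau u + gln tau (u + h)) h (/ 2)
          (0 + g' (u + h))); [auto_derive; [trivial | field] |].
        apply (is_derive_plus (V := R_NormedModule) (fun _ => gln tau u));
          [apply (is_derive_const (V := R_NormedModule)) | apply Hsh, is_derive_gln; lra].
      + apply (is_derive_minus (V := R_NormedModule) (fun h => gprim tau (u + h)) (fun _ => gprim tau u));
          [apply Hsh, is_derive_gprim; lra | apply (is_derive_const (V := R_NormedModule))].
    - intros h Hh; pose proof (Htan h Hh); lra. }
  rewrite Rplus_0_r in H; lra.
Qed.

Lemma Rsum_gln_ge tau b n : 0 < tau -> 0 < b ->
  gprim tau (b + INR n) - gprim tau b + / 2 * gln tau b + / 2 * gln tau (b + INR n) <=
  Rsum (fun k => gln tau (b + INR k)) (S n).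
Proof.
  intros Ht Hb; induction n.
  - rewrite Rsum_S; simpl; rewrite Rplus_0_r; lra.
  - rewrite Rsum_S; pose proof (pos_INR n).
    pose proof (gprim_trapezoid tau (b + INR n) Ht ltac:(lra)) as H1.
    rewrite S_INR; replace (b + (INR n + 1)) with (b + INR n + 1) by ring.
    lra.
Qed.

Lemma atan_le x : 0 <= x -> atan x <= x.
Proof.
  intros Hx.
  assert (H : 0 - atan 0 <= x - atan x); [| rewrite atan_0 in H; lra].
  apply (incr_of_deriv (fun y => y - atan y) (fun y => 1 - / (1 + y * y))); [exact Hx | |].
  - intros y _; auto_derive; [trivial | unfold Rsqr; field; nra].
  - intros y _; assert (/ (1 + y * y) <= / 1) by (apply Rinv_le_contravar; nra).
    rewrite Rinv_1 in *; lra.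
Qed.

Lemma Cgamma_norm_le_real b tau : 0 < b -> Cnorm (Cgamma (b, tau)) <= Cnorm (Cgamma (RtoC b)).
Proof.
  intros Hb.
  apply (Un_cv_le (fun n => Cnorm (gauss (b, tau) n)) (fun n => Cnorm (gauss (RtoC b) n)));
    [| apply C_cv_norm, Cgamma_cv, not_pole_gt0, Hb ..].
  exists 1%nat; intros n Hn; rewrite Cnorm_gauss by (exact Hb || lia).
  pose proof (Cnorm_ge0 (gauss (RtoC b) n)).
  assert (exp (- Rsum (fun k => gln tau (b + INR k)) (S n)) <= 1).
  { rewrite <- exp_0; apply exp_le.
    assert (0 <= Rsum (fun k => gln tau (b + INR k)) (S n)); [| lra].
    apply Rsum_ge0; intros k _; apply gln_ge0; pose proof (pos_INR k); lra. }
  nra.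
Qed.

Lemma Cnorm_conj_gauss b tau n : 0 < b -> (0 < n)%nat ->
  Cnorm (gauss (b, - tau) n) = Cnorm (gauss (b, tau) n).
Proof.
  intros Hb Hn; rewrite !Cnorm_gauss by assumption; do 3 f_equal.
  apply Rsum_ext; intros k _; unfold gln; do 4 f_equal; ring.
Qed.

(** The trapezoidal lower bound for the sum of [gln] is pi tau/2 minus the value of [gprim] at b,
    plus half of [gln] at b, in the limit. Then atan x <= x bounds [gprim tau b] by b [gln] + b, and
    1 + x^2 <= (1+x)^2 bounds [gln] by ln(1 + tau/b). *)
Lemma Cgamma_norm_le b tau : / 2 <= b -> 0 < tau ->
  Cnorm (Cgamma (b, - tau)) * exp (PI / 2 * tau) <=
  Cnorm (Cgamma (RtoC b)) * exp ((b - / 2) * ln (1 + tau / b) + b).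
Proof.
  intros Hb Ht; assert (Hb0 : 0 < b) by lra.
  set (B := exp ((b - / 2) * ln (1 + tau / b) + b)).
  (* Bounds the defect of [gprim] at b + n from pi tau/2; the defect is at most tau^2/(b+n), and b
     >= 1/2. *)
  set (w := fun n => tau * tau * (2 / (INR n + 1))).
  assert (Hw : Un_cv (fun n => exp (w n)) 1).
  { rewrite <- exp_0; apply (continuity_seq exp); [apply derivable_continuous_pt, derivable_pt_exp |].
    replace 0 with (tau * tau * 0) by ring; apply Un_cv_scal, Un_cv_inv_INR_S. }
  apply (Un_cv_le (fun n => Cnorm (gauss (b, - tau) n) * exp (PI / 2 * tau))
    (fun n => (Cnorm (gauss (RtoC b) n) * B) * exp (w n))).
  2:{ apply CV_mult; [apply C_cv_norm, Cgamma_cv, not_pole_gt0, Hb0 | apply Un_cv_const]. }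
  2:{ replace (Cnorm (Cgamma (RtoC b)) * B) with (Cnorm (Cgamma (RtoC b)) * B * 1) by ring.
      apply (CV_mult (fun n => Cnorm (gauss (RtoC b) n) * B)); [| exact Hw].
      apply CV_mult; [apply C_cv_norm, Cgamma_cv, not_pole_gt0, Hb0 | apply Un_cv_const]. }
  exists 1%nat; intros n Hn; rewrite Cnorm_conj_gauss, Cnorm_gauss by (exact Hb0 || lia).
  rewrite !Rmult_assoc; apply Rmult_le_compat_l; [apply Cnorm_ge0 |].
  unfold B; rewrite <- !exp_plus; apply exp_le.
  pose proof (Rsum_gln_ge tau b n Ht Hb0) as H.
  pose proof (pos_INR n) as Hn0.
  pose proof (gln_ge0 tau (b + INR n) ltac:(lra)) as Hg.
  assert (H1 : PI / 2 * tau - w n <= gprim tau (b + INR n)).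
  { unfold gprim.
    assert (Hu : 0 < (b + INR n) / tau) by (apply Rdiv_lt_0_compat; lra).
    assert (Hiv : 0 < / ((b + INR n) / tau)) by (apply Rinv_0_lt_compat, Hu).
    pose proof (atan_inv ((b + INR n) / tau) Hu) as Ha.
    pose proof (atan_le (/ ((b + INR n) / tau)) ltac:(lra)) as Hb'.
    assert (Hc : tau * / ((b + INR n) / tau) <= w n).
    { unfold w; replace (tau * / ((b + INR n) / tau)) with (tau * tau * / (b + INR n)) by (field; lra).
      apply Rmult_le_compat_l; [nra |].
      replace (2 / (INR n + 1)) with (/ ((INR n + 1) / 2)) by (field; lra).
      apply Rinv_le_contravar; lra. }
    pose proof (Rmult_le_pos (b + INR n) _ ltac:(lra) Hg) as Hp.
    rewrite Ha in Hb'.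
    apply (Rmult_le_compat_l tau) in Hb'; [| lra]; lra. }
  assert (H2 : gprim tau b <= b * gln tau b + b).
  { unfold gprim; pose proof (atan_le (b / tau) ltac:(apply Rdiv_le_0_compat; lra)) as Ha.
    apply (Rmult_le_compat_l tau) in Ha; [| lra].
    replace (tau * (b / tau)) with b in Ha by (field; lra); lra. }
  assert (H3 : gln tau b <= ln (1 + tau / b)).
  { unfold gln; assert (Hd : 0 < tau / b) by (apply Rdiv_lt_0_compat; lra).
    pose proof (gln_arg_ge1 tau b Hb0).
    assert (Hl : ln (1 + tau * tau / (b * b)) <= ln ((1 + tau / b) * (1 + tau / b))).
    { apply ln_le; [lra |].
      replace (tau * tau / (b * b)) with (tau / b * (tau / b)) by (field; lra); nra. }
    rewrite ln_mult in Hl by lra; lra. }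
  assert (H4 : (b - / 2) * gln tau b <= (b - / 2) * ln (1 + tau / b)) by (apply Rmult_le_compat_l; lra).
  lra.
Qed.

(** * Log-convexity of Gamma on the positive reals *)

Lemma ln_concave th p q : 0 <= th <= 1 -> 0 < p -> 0 < q ->
  th * ln p + (1 - th) * ln q <= ln (th * p + (1 - th) * q).
Proof.
  intros Hth Hp Hq; set (m := th * p + (1 - th) * q).
  assert (Hm : 0 < m) by (unfold m; destruct (Req_dec th 0) as [-> | Hne]; nra).
  assert (Hl : forall x, 0 < x -> ln x <= ln m + (x / m - 1)).
  { intros x Hx; pose proof (ln_le_sub1 (x / m) ltac:(apply Rdiv_lt_0_compat; assumption)) as H.
    unfold Rdiv in H at 1; rewrite ln_mult, ln_Rinv in H by (try apply Rinv_0_lt_compat; assumption); lra. }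
  pose proof (Rmult_le_compat_l th _ _ ltac:(lra) (Hl p Hp)).
  pose proof (Rmult_le_compat_l (1 - th) _ _ ltac:(lra) (Hl q Hq)).
  assert (E : th * (p / m - 1) + (1 - th) * (q / m - 1) = 0).
  { replace (th * (p / m - 1) + (1 - th) * (q / m - 1)) with ((th * p + (1 - th) * q) / m - 1)
      by (field; lra).
    fold m; field; lra. }
  lra.
Qed.

Definition ln_gauss (b : R) (m : nat) : R :=
  b * ln (INR m) + ln (INR (fact m)) - Rsum (fun k => ln (b + INR k)) (S m).

Lemma Cnorm_gauss_real b m : 0 < b -> (0 < m)%nat ->
  Cnorm (gauss (RtoC b) m) = exp (ln_gauss b m).
Proof.
  intros Hb Hm; unfold gauss, ln_gauss.
  assert (E : forall j, Cnorm (Cprod (fun k => Cadd (RtoC b) (RtoC (INR k))) j) =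
    exp (Rsum (fun k => ln (b + INR k)) j)).
  { induction j; [simpl Cprod; simpl Rsum; rewrite exp_0; apply Cnorm_1 |].
    pose proof (pos_INR j).
    rewrite Cprod_S, Cnorm_mul, IHj, Rsum_S, exp_plus, exp_ln, <- RtoC_add, Cnorm_RtoC,
      Rabs_pos_eq by lra; reflexivity. }
  rewrite Cnorm_div, E, Cnorm_mul, Cnorm_pow_RtoC, Cnorm_RtoC, Rabs_pos_eq by
    (first [apply pos_INR | apply lt_0_INR, Hm | apply Cprod_not_pole, not_pole_gt0; exact Hb]).
  unfold Rminus; rewrite !exp_plus, exp_ln, exp_Ropp by apply INR_fact_lt_0; reflexivity.
Qed.

(** In b, the logarithm of the Gauss product is an affine function minus a sum of concave
    logarithms. *)
Lemma ln_gauss_convex th p q m : 0 <= th <= 1 -> 0 < p -> 0 < q ->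
  ln_gauss (th * p + (1 - th) * q) m <= th * ln_gauss p m + (1 - th) * ln_gauss q m.
Proof.
  intros Hth Hp Hq; unfold ln_gauss.
  assert (H : th * Rsum (fun k => ln (p + INR k)) (S m) + (1 - th) * Rsum (fun k => ln (q + INR k)) (S m)
    <= Rsum (fun k => ln (th * p + (1 - th) * q + INR k)) (S m)).
  { rewrite <- !Rsum_scal, <- Rsum_add; apply Rsum_le; intros k _; pose proof (pos_INR k).
    replace (th * p + (1 - th) * q + INR k) with (th * (p + INR k) + (1 - th) * (q + INR k)) by ring.
    apply ln_concave; lra. }
  lra.
Qed.

(** By log-convexity Gamma(b) is at most the larger of Gamma(n) and Gamma(n+2) = (n+1)!. With v = n
    + 1 the window [n, n+2] contains v + 1 - sigma for all sigma in [0,2]. The slack [eps] allows a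
    bound on the finite products before the limit. *)
Lemma Cgamma_real_le_fact b n : (0 < n)%nat -> INR n <= b <= INR n + 2 ->
  Cnorm (Cgamma (RtoC b)) <= INR (fact (S n)).
Proof.
  intros Hn Hb; assert (Hn0 : 0 < INR n) by (apply lt_0_INR, Hn).
  set (q := INR (S (S n))).
  assert (Eq : q = INR n + 2) by (unfold q; rewrite !S_INR; ring).
  set (th := (q - b) / 2).
  assert (Hth : 0 <= th <= 1) by (unfold th; lra).
  assert (Eb : b = th * INR n + (1 - th) * q) by (unfold th; rewrite Eq; field).
  assert (Gp : Cnorm (Cgamma (RtoC (INR n))) <= INR (fact (S n))).
  { destruct n as [| n]; [lia |]; rewrite Cgamma_INR_S, Cnorm_RtoC, Rabs_pos_eq by apply pos_INR.
    apply le_INR, fact_le; lia. }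
  assert (Gq : Cnorm (Cgamma (RtoC q)) <= INR (fact (S n))).
  { unfold q; rewrite Cgamma_INR_S, Cnorm_RtoC, Rabs_pos_eq by apply pos_INR; lra. }
  apply le_epsilon; intros eps He.
  destruct (C_cv_norm _ _ (Cgamma_cv (RtoC (INR n)) (not_pole_gt0 (RtoC (INR n)) Hn0)) eps He) as [n1 H1].
  destruct (C_cv_norm _ _ (Cgamma_cv (RtoC q) (not_pole_gt0 (RtoC q) ltac:(simpl; lra))) eps He) as [n2 H2].
  eapply C_cv_norm_le; [| apply Cgamma_cv, not_pole_gt0; simpl; lra].
  exists (S (n1 + n2)); intros m Hm.
  specialize (H1 m ltac:(lia)); specialize (H2 m ltac:(lia)); unfold Rdist in *.
  apply Rabs_def2 in H1; apply Rabs_def2 in H2.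
  rewrite Cnorm_gauss_real in H1, H2 |- * by (lra || lia).
  set (B := INR (fact (S n)) + eps).
  assert (HB : 0 < B) by (pose proof (INR_fact_lt_0 (S n)); unfold B; lra).
  assert (L1 : ln_gauss (INR n) m <= ln B).
  { rewrite <- (ln_exp (ln_gauss (INR n) m)); apply ln_le; [apply exp_pos | unfold B; lra]. }
  assert (L2 : ln_gauss q m <= ln B).
  { rewrite <- (ln_exp (ln_gauss q m)); apply ln_le; [apply exp_pos | unfold B; lra]. }
  rewrite <- (exp_ln B HB); apply exp_le.
  rewrite Eb; eapply Rle_trans; [apply ln_gauss_convex; lra |].
  pose proof (Rmult_le_compat_l th _ _ ltac:(lra) L1).
  pose proof (Rmult_le_compat_l (1 - th) _ _ ltac:(lra) L2); lra.
Qed.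

(** * Remainder estimates *)

(** Integral comparison for the decreasing function y^(-b) on [k, k+1]. *)
Lemma neg_pow_le_increment b k : 1 < b -> 1 <= k ->
  exp (- (b * ln (k + 1))) <= (exp ((1 - b) * ln k) - exp ((1 - b) * ln (k + 1))) / (b - 1).
Proof.
  intros Hb Hk; set (e := exp (- (b * ln (k + 1)))).
  assert (H : - exp ((1 - b) * ln k) / (b - 1) - e * k <= - exp ((1 - b) * ln (k + 1)) / (b - 1) - e * (k + 1)).
  { apply (incr_of_deriv (fun y => - exp ((1 - b) * ln y) / (b - 1) - e * y)
      (fun y => exp (- (b * ln y)) - e)); [lra | |].
    - intros y Hy.
      assert (E : exp ((1 - b) * ln y) = y * exp (- (b * ln y))).
      { rewrite <- (exp_ln y) at 2 by lra; rewrite <- exp_plus; f_equal; ring. }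
      auto_derive; [lra |]; rewrite E; field; lra.
    - intros y Hy; assert (exp (- (b * ln (k + 1))) <= exp (- (b * ln y))); [| unfold e; lra].
      apply exp_le; assert (ln y <= ln (k + 1)) by (apply ln_le; lra); nra. }
  unfold Rdiv in *; lra.
Qed.

Lemma neg_pow_sum_tail b M K : 1 < b -> (1 <= M <= K)%nat ->
  Rsum (fun k => exp (- (b * ln (INR k + 1)))) K - Rsum (fun k => exp (- (b * ln (INR k + 1)))) M
  <= exp ((1 - b) * ln (INR M)) / (b - 1).
Proof.
  intros Hb HM; set (f := fun k => exp (- (b * ln (INR k + 1)))).
  assert (H : Rsum f K - Rsum f M <=
    (exp ((1 - b) * ln (INR M)) - exp ((1 - b) * ln (INR K))) / (b - 1)).
  { replace K with (M + (K - M))%nat by lia; generalize (K - M)%nat as i; induction i as [| j IH].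
    - rewrite Nat.add_0_r; unfold Rdiv; lra.
    - rewrite Nat.add_succ_r, Rsum_S.
      pose proof (neg_pow_le_increment b (INR (M + j)) Hb ltac:(apply (le_INR 1); lia)).
      unfold f in *; rewrite S_INR; unfold Rdiv in *; lra. }
  eapply Rle_trans; [exact H |]; unfold Rdiv; apply Rmult_le_compat_r.
  - left; apply Rinv_0_lt_compat; lra.
  - pose proof (exp_pos ((1 - b) * ln (INR K))); lra.
Qed.

Lemma neg_pow_sum_le b K : 1 < b ->
  Rsum (fun k => exp (- (b * ln (INR k + 1)))) K <= 1 + / (b - 1).
Proof.
  intros Hb; assert (Hi : 0 < / (b - 1)) by (apply Rinv_0_lt_compat; lra).
  destruct K as [| K]; [simpl; lra |].
  pose proof (neg_pow_sum_tail b 1 (S K) Hb ltac:(lia)) as H.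
  rewrite (Rsum_S _ 0) in H; change (Rsum _ 0) with 0 in H.
  change (INR 1) with 1 in H; change (INR 0) with 0 in H.
  rewrite !Rplus_0_l, ln_1, !Rmult_0_r, Ropp_0, exp_0 in H.
  unfold Rdiv in H; lra.
Qed.

Lemma Cnorm_node_ge t k : Rabs (2 * PI * IZR k) <= Cnorm (node t k).
Proof. apply (snd_le_Cnorm (node t k)). Qed.

Definition node_bound (b : R) (k : nat) : R := exp (- (b * ln (2 * PI))) * exp (- (b * ln (INR k + 1))).

Lemma node_bound_eq b k : exp (- (b * ln (2 * PI * INR (S k)))) = node_bound b k.
Proof.
  pose proof PI_RGT_0; unfold node_bound.
  rewrite ln_mult, <- exp_plus, S_INR by (lra || apply lt_0_INR; lia); f_equal; ring.
Qed.

Lemma node_radius_le t k j : Z.abs j = Z.of_nat (S k) -> 0 < 2 * PI * INR (S k) <= Cnorm (node t j).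
Proof.
  intros Hj; pose proof PI_RGT_0; assert (0 < INR (S k)) by (apply lt_0_INR; lia).
  split; [apply Rmult_lt_0_compat; lra |].
  eapply Rle_trans; [| apply Cnorm_node_ge].
  rewrite Rabs_mult, <- abs_IZR, Hj, <- INR_IZR_INZ, Rabs_pos_eq by lra; lra.
Qed.

Lemma Cnorm_node_neg_le b tau t k : 0 < b -> 0 <= tau -> 0 < t ->
  Cnorm (Cpow (node t (- Z.of_nat (S k))) (Copp (b, - tau))) <= exp (PI / 2 * tau) * node_bound b k.
Proof.
  intros Hb Htau Ht; rewrite <- node_bound_eq.
  replace (PI / 2 * tau) with (Rabs (snd ((b, - tau) : Cplx)) * (PI / 2))
    by (simpl; rewrite Rabs_Ropp, Rabs_pos_eq by exact Htau; ring).
  change (exp (- (b * ln (2 * PI * INR (S k))))) with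
    (exp (- (fst ((b, - tau) : Cplx) * ln (2 * PI * INR (S k))))).
  apply Cnorm_pow_opp_le; [exact Ht | simpl; lra | apply node_radius_le; lia].
Qed.

(** Here the argument of the node is non-negative and the imaginary part of -z is tau >= 0, so the
    angular factor is at most 1. At the opposite node it can reach e^(pi tau/2), which is why only
    negative nodes need the correction E_1. *)
Lemma Cnorm_node_pos_le b tau t k : 0 < b -> 0 <= tau -> 0 < t ->
  Cnorm (Cpow (node t (Z.of_nat (S k))) (Copp (b, - tau))) <= node_bound b k.
Proof.
  intros Hb Htau Ht; rewrite <- node_bound_eq, Cnorm_pow by exact Ht.
  apply exp_le; destruct (node_radius_le t k (Z.of_nat (S k)) ltac:(lia)) as [H0 H1].
  assert (Hl : ln (2 * PI * INR (S k)) <= ln (Cnorm (node t (Z.of_nat (S k))))) by (apply ln_le; lra).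
  assert (Ha : 0 <= atan (snd (node t (Z.of_nat (S k))) / fst (node t (Z.of_nat (S k))))).
  { rewrite <- atan_0; destruct (Req_dec 0 (snd (node t (Z.of_nat (S k))) / fst (node t (Z.of_nat (S k)))))
      as [<- | Hne]; [lra |]; left; apply atan_increasing.
    unfold node in *; simpl fst in *; cbn [snd] in *; rewrite <- INR_IZR_INZ in *.
    apply Rdiv_lt_0_compat; lra. }
  pose proof (Rmult_le_compat_l b _ _ ltac:(lra) Hl).
  pose proof (Rmult_le_pos _ _ Htau Ha).
  unfold Copp; cbn [fst snd]; rewrite Ropp_involutive; lra.
Qed.

Lemma node_bound_sum b K : Rsum (node_bound b) K =
  exp (- (b * ln (2 * PI))) * Rsum (fun k => exp (- (b * ln (INR k + 1)))) K.
Proof. apply Rsum_scal. Qed.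

Lemma pair_tail_bound b tau t M K : 1 < b -> 0 <= tau -> 0 < t -> (1 <= M <= K)%nat ->
  Cnorm (Csub (Csum (pair_term (b, - tau) t) K) (neg_terms (b, - tau) M t)) <=
  exp (- (b * ln (2 * PI))) * (exp (PI / 2 * tau) * (exp ((1 - b) * ln (INR M)) / (b - 1)) + (1 + / (b - 1))).
Proof.
  intros Hb Htau Ht HM; set (z := (b, - tau) : Cplx).
  set (e := exp (- (b * ln (2 * PI)))); assert (He : 0 < e) by apply exp_pos.
  replace (Csub (Csum (pair_term z t) K) (neg_terms z M t)) with
    (Cadd (Csum (fun k => Cpow (node t (Z.of_nat (S k))) (Copp z)) K)
      (Csub (neg_terms z K t) (neg_terms z M t)))
    by (unfold pair_term, neg_terms; rewrite Csum_add; ring).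
  eapply Rle_trans; [apply Cnorm_add |]; rewrite Rmult_plus_distr_l, Rplus_comm; apply Rplus_le_compat.
  - unfold neg_terms; eapply Rle_trans.
    + apply (Csum_diff_le _ (fun k => exp (PI / 2 * tau) * node_bound b k)); [lia |].
      intros k _; apply Cnorm_node_neg_le; lra.
    + rewrite !Rsum_scal, !node_bound_sum; fold e.
      pose proof (neg_pow_sum_tail b M K Hb HM) as H.
      pose proof (exp_pos (PI / 2 * tau)) as Hp.
      apply (Rmult_le_compat_l (e * exp (PI / 2 * tau))) in H; [lra | nra].
  - eapply Rle_trans.
    + apply (Cnorm_Csum_le _ (node_bound b)); intros k _; apply Cnorm_node_pos_le; lra.
    + rewrite node_bound_sum; apply Rmult_le_compat_l; [lra | apply neg_pow_sum_le, Hb].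
Qed.

Lemma pair_sum_bound b tau t K : 1 < b -> 0 <= tau -> 0 < t ->
  Cnorm (Csum (pair_term (b, - tau) t) K) <=
  exp (- (b * ln (2 * PI))) * ((exp (PI / 2 * tau) + 1) * (1 + / (b - 1))).
Proof.
  intros Hb Htau Ht; set (e := exp (- (b * ln (2 * PI)))); assert (He : 0 < e) by apply exp_pos.
  pose proof (exp_pos (PI / 2 * tau)) as Hp.
  eapply Rle_trans.
  - apply (Cnorm_Csum_le _ (fun k => (exp (PI / 2 * tau) + 1) * node_bound b k)); intros k _.
    unfold pair_term; eapply Rle_trans; [apply Cnorm_add |].
    pose proof (Cnorm_node_neg_le b tau t k ltac:(lra) Htau Ht).
    pose proof (Cnorm_node_pos_le b tau t k ltac:(lra) Htau Ht); lra.
  - rewrite Rsum_scal, node_bound_sum; fold e.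
    pose proof (neg_pow_sum_le b K Hb) as H.
    apply (Rmult_le_compat_l (e * (exp (PI / 2 * tau) + 1))) in H; [lra | nra].
Qed.

(** * The truncation error of D *)

Lemma Qinc_at_0 n : Qinc (S n) 0 = 1.
Proof.
  unfold Qinc; induction n.
  - simpl; rewrite Ropp_0, exp_0; field.
  - rewrite Rsum_S, IHn, pow_i by lia; unfold Rdiv; ring.
Qed.

Lemma Qinc_le1 n y : 0 <= y -> Qinc (S n) y <= 1.
Proof.
  intros Hy; rewrite <- (Qinc_at_0 n).
  assert (H : - Qinc (S n) 0 <= - Qinc (S n) y); [| lra].
  apply (incr_of_deriv (fun x => - Qinc (S n) x)
    (fun x => - - (x ^ n / INR (fact n) * exp (- x)))); [exact Hy | |].
  - intros x _; apply (is_derive_opp (V := R_NormedModule)), is_derive_Qinc_S.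
  - intros x Hx; rewrite Ropp_involutive; apply Rmult_le_pos; [| left; apply exp_pos].
    apply Rdiv_le_0_compat; [apply pow_le; lra | apply INR_fact_lt_0].
Qed.

Lemma exp_taylor_le n y : 0 <= y -> Rsum (fun w => y ^ w / INR (fact w)) (S n) <= exp y.
Proof.
  intros Hy; pose proof (Qinc_le1 n y Hy) as H; pose proof (exp_pos y) as Hp.
  assert (E : Qinc (S n) y = exp (- y) * Rsum (fun w => y ^ w / INR (fact w)) (S n)).
  { unfold Qinc; rewrite <- Rsum_scal; apply Rsum_ext; intros; ring. }
  rewrite E in H; apply (Rmult_le_compat_l (exp y)) in H; [| lra].
  rewrite <- Rmult_assoc, <- exp_plus, Rplus_opp_r, exp_0 in H; lra.
Qed.

(** The property behind the choice of lambda: lambda - ln lambda >= 2 gives lambda^v e^(v - lambda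
    v) <= e^(-v). *)
Lemma ln_lambda_le : ln 3.151 <= 3.151 - 2.
Proof.
  rewrite <- (ln_exp (3.151 - 2)); apply ln_le; [lra |].
  eapply Rle_trans; [| apply (exp_taylor_le 5); lra].
  simpl; lra.
Qed.

(** For y >= lambda v and w < v, the inequality ln x <= x - 1 gives y^w <= (lambda v)^w e^((y -
    lambda v)/lambda). Replacing lambda^w by lambda^(v-1) leaves a partial sum of e^v, and
    [ln_lambda_le] finishes. *)
Lemma Qinc_tail_le n y : let v := INR (S n) in 3.151 * v <= y ->
  Qinc (S n) y <= / 3.151 * exp (- v - (1 - / 3.151) * (y - 3.151 * v)).
Proof.
  intros v Hy; set (l := 3.151) in *.
  assert (Hl : l = 3.151) by reflexivity.
  assert (Hv : 1 <= v) by (apply (le_INR 1); lia).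
  assert (HY : 0 < l * v) by nra.
  set (g := exp ((y - l * v) / l - y)).
  assert (Hterm : forall w, (w < S n)%nat ->
    y ^ w / INR (fact w) * exp (- y) <= l ^ n * g * (v ^ w / INR (fact w))).
  { intros w Hw; pose proof (INR_fact_lt_0 w) as Hf.
    assert (H1 : y ^ w <= (l * v) ^ w * exp ((y - l * v) / l)).
    { rewrite <- !Rpower_pow by lra; unfold Rpower; rewrite <- exp_plus; apply exp_le.
      pose proof (ln_le_sub1 (y / (l * v)) ltac:(apply Rdiv_lt_0_compat; lra)) as Hln.
      unfold Rdiv in Hln at 1; rewrite ln_mult, ln_Rinv in Hln by (try apply Rinv_0_lt_compat; lra).
      assert (Hwv : INR w <= v) by (apply le_INR; lia).
      pose proof (Rmult_le_compat_l (INR w) _ _ (pos_INR w) Hln).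
      assert (H2 : INR w * (y / (l * v) - 1) <= v * (y / (l * v) - 1)).
      { apply Rmult_le_compat_r; [| exact Hwv].
        apply (Rmult_le_reg_r (l * v)); [exact HY |].
        replace ((y / (l * v) - 1) * (l * v)) with (y - l * v) by (field; lra); lra. }
      replace (v * (y / (l * v) - 1)) with ((y - l * v) / l) in H2 by (field; lra).
      lra. }
    assert (H3 : l ^ w <= l ^ n) by (apply Rle_pow; [lra | lia]).
    rewrite Rpow_mult_distr in H1.
    replace (l ^ n * g * (v ^ w / INR (fact w))) with
      (l ^ n * (v ^ w * exp ((y - l * v) / l)) / INR (fact w) * exp (- y)).
    2:{ unfold g, Rminus; rewrite exp_plus; field; lra. }
    apply Rmult_le_compat_r; [left; apply exp_pos |].
    unfold Rdiv; apply Rmult_le_compat_r; [left; apply Rinv_0_lt_compat, Hf |].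
    eapply Rle_trans; [exact H1 |]; rewrite Rmult_assoc; apply Rmult_le_compat_r; [| exact H3].
    apply Rmult_le_pos; [apply pow_le; lra | left; apply exp_pos]. }
  eapply Rle_trans; [apply (Rsum_le _ _ (S n) Hterm) |].
  rewrite Rsum_scal.
  assert (Hg : 0 < l ^ n * g) by (apply Rmult_lt_0_compat; [apply pow_lt; lra | apply exp_pos]).
  eapply Rle_trans; [apply Rmult_le_compat_l; [lra | apply (exp_taylor_le n v); lra] |].
  replace (l ^ n) with (/ l * exp (v * ln l)).
  2:{ unfold v; change (exp (INR (S n) * ln l)) with (Rpower l (INR (S n))).
      rewrite Rpower_pow by lra; simpl; field; lra. }
  rewrite !Rmult_assoc; apply Rmult_le_compat_l; [left; apply Rinv_0_lt_compat; lra |].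
  unfold g; rewrite <- !exp_plus; apply exp_le.
  pose proof ln_lambda_le as HL; fold l in HL.
  pose proof (Rmult_le_compat_l v _ _ ltac:(lra) HL).
  replace ((y - l * v) / l - y + v) with (- ((1 - / l) * (y - l * v)) - l * v + v) by (field; lra).
  lra.
Qed.

Lemma geom_Rsum_le q j : 0 <= q < 1 -> Rsum (fun i => q ^ S i) j <= q / (1 - q).
Proof.
  intros Hq.
  assert (H : Rsum (fun i => q ^ S i) j = q / (1 - q) - q ^ S j / (1 - q)).
  { induction j; [simpl; field; lra | rewrite Rsum_S, IHj; simpl; field; lra]. }
  assert (0 <= q ^ S j / (1 - q)) by (apply Rdiv_le_0_compat; [apply pow_le |]; lra); lra.
Qed.

(** Beyond the cut n^(-sigma) <= N^(-sigma), and the values of Q are dominated by a geometric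
    sequence of ratio e^(-kap/N), whose sum is at most N/kap. Since lambda kap = lambda - 1, the
    divisor is 2.151. *)
Lemma Dsum_tail s n N K D : 0 <= fst s -> 1 <= N -> 3.151 * INR (S n) * N <= INR K ->
  C_cv (Csum (qterm s (S n) (/ N))) D ->
  Cnorm (Csub D (Csum (qterm s (S n) (/ N)) K)) <=
  exp ((1 - fst s) * ln N) * exp (- INR (S n)) / 2.151.
Proof.
  intros Hs HN HK HD; set (v := INR (S n)) in *; set (kap := 1 - / 3.151).
  assert (Hkap : 0 < kap) by (unfold kap; lra).
  assert (Hv : 1 <= v) by (apply (le_INR 1); lia).
  set (q := exp (- (kap / N))).
  assert (HkN : 0 < kap / N) by (apply Rdiv_lt_0_compat; lra).
  assert (Hq : 0 <= q < 1).
  { split; [left; apply exp_pos |]; rewrite <- exp_0; apply exp_increasing; lra. }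
  set (A := exp (- (fst s * ln N)) * (/ 3.151 * exp (- v))).
  assert (HA : 0 < A).
  { unfold A; apply Rmult_lt_0_compat; [apply exp_pos |].
    apply Rmult_lt_0_compat; [lra | apply exp_pos]. }
  assert (Hterm : forall i, Cnorm (qterm s (S n) (/ N) (K + i)) <= A * q ^ S i).
  { intros i; set (x := INR (S (K + i))).
    assert (Ex : x = INR K + INR (S i)) by (unfold x; rewrite <- plus_INR; f_equal; lia).
    assert (Hi : 0 < INR (S i)) by (apply lt_0_INR; lia).
    assert (HvN : N <= 3.151 * v * N) by nra.
    unfold qterm; fold x; rewrite Cnorm_mul, Cnorm_pow_RtoC, Cnorm_RtoC by lra.
    assert (Hyy : 3.151 * v + INR (S i) / N <= x * / N).
    { apply (Rmult_le_reg_r N); [lra |].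
      replace ((3.151 * v + INR (S i) / N) * N) with (3.151 * v * N + INR (S i)) by (field; lra).
      replace (x * / N * N) with x by (field; lra); lra. }
    assert (HiN : 0 < INR (S i) / N) by (apply Rdiv_lt_0_compat; lra).
    pose proof (Qinc_tail_le n (x * / N) ltac:(fold v; lra)) as HQ; fold v kap in HQ.
    assert (HQ0 : 0 <= Qinc (S n) (x * / N)).
    { apply Rsum_ge0; intros w _; apply Rmult_le_pos; [| left; apply exp_pos].
      apply Rdiv_le_0_compat; [apply pow_le; nra | apply INR_fact_lt_0]. }
    rewrite Rabs_pos_eq by exact HQ0.
    unfold A; rewrite Rmult_assoc; apply Rmult_le_compat; [left; apply exp_pos | exact HQ0 | |].
    - apply exp_le; change (fst (Copp s)) with (- fst s).
      assert (ln N <= ln x) by (apply ln_le; lra); nra.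
    - eapply Rle_trans; [exact HQ |]; rewrite Rmult_assoc; apply Rmult_le_compat_l; [lra |].
      unfold q; rewrite <- (Rpower_pow (S i)) by apply exp_pos; unfold Rpower; rewrite ln_exp.
      rewrite <- exp_plus; apply exp_le.
      apply (Rmult_le_compat_l kap) in Hyy; [| lra].
      replace (INR (S i) * - (kap / N)) with (- (kap * (INR (S i) / N))) by (field; lra); lra. }
  assert (Hsum : Cnorm (Csub D (Csum (qterm s (S n) (/ N)) K)) <= A * (q / (1 - q))).
  { eapply C_cv_norm_le; [| apply C_cv_sub; [exact HD | apply C_cv_const]].
    exists K; intros J HJ; cbv beta; replace J with (K + (J - K))%nat by lia; rewrite Csum_split.
    match goal with |- Cnorm (Csub (Cadd ?a ?b) ?c) <= _ => replace (Csub (Cadd a b) c) with b by ring end.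
    eapply Rle_trans; [apply (Cnorm_Csum_le _ (fun i => A * q ^ S i)); intros; apply Hterm |].
    rewrite Rsum_scal; apply Rmult_le_compat_l; [lra | apply geom_Rsum_le, Hq]. }
  eapply Rle_trans; [exact Hsum |].
  assert (Hgeo : q / (1 - q) <= N / kap).
  { assert (Hqe : (1 + kap / N) * q <= 1).
    { pose proof (exp_ge_1_plus (kap / N)) as H.
      apply (Rmult_le_compat_r q) in H; [| lra].
      unfold q in H at 2; rewrite <- exp_plus, Rplus_opp_r, exp_0 in H; exact H. }
    apply (Rmult_le_reg_r (1 - q)); [lra |].
    unfold Rdiv at 1; rewrite Rmult_assoc, Rinv_l, Rmult_1_r by lra.
    apply (Rmult_le_reg_l (kap / N)); [exact HkN |].
    replace (kap / N * (N / kap * (1 - q))) with (1 - q) by (field; lra); lra. }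
  apply (Rmult_le_compat_l A) in Hgeo; [| lra].
  eapply Rle_trans; [exact Hgeo |]; right.
  replace ((1 - fst s) * ln N) with (- (fst s * ln N) + ln N) by ring.
  rewrite exp_plus, exp_ln by lra; unfold A, kap.
  replace 3.151 with (3151 / 1000) by lra; replace 2.151 with (2151 / 1000) by lra; field.
Qed.

(** * Numerical constants *)

Lemma exp_64th : exp (/ 64) <= 64 / 63.
Proof.
  pose proof (exp_ge_1_plus (- / 64)) as H; rewrite exp_Ropp in H.
  pose proof (exp_pos (/ 64)) as Hp.
  apply (Rmult_le_compat_l (exp (/ 64))) in H; [| lra].
  rewrite Rinv_r in H by lra; lra.
Qed.

Lemma exp_double x a b : exp x <= a -> a * a <= b -> exp (2 * x) <= b.
Proof.
  intros H1 H2; replace (2 * x) with (x + x) by ring; rewrite exp_plus.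
  pose proof (exp_pos x); nra.
Qed.

(** Six squarings of the bound on e^(1/64), each rounded up. *)
Lemma exp_1_le : exp 1 <= 2.7413.
Proof.
  pose proof exp_64th as H.
  apply (exp_double _ _ 1.03201) in H; [| lra]; apply (exp_double _ _ 1.06505) in H; [| lra].
  apply (exp_double _ _ 1.13434) in H; [| lra]; apply (exp_double _ _ 1.28673) in H; [| lra].
  apply (exp_double _ _ 1.65568) in H; [| lra]; apply (exp_double _ _ 2.7413) in H; [| lra].
  replace (2 * (2 * (2 * (2 * (2 * (2 * / 64)))))) with 1 in H by field; exact H.
Qed.

(** From 1 - 2 sin^2(pi/12) = cos(pi/6) = sqrt(3)/2 and sin x <= x. *)
Lemma PI_ge_3_1 : 3.1 <= PI.
Proof.
  pose proof PI_RGT_0 as Hpi.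
  assert (Hs : sin (PI / 12) <= PI / 12) by (left; apply sin_lt_x; lra).
  assert (Hs0 : 0 <= sin (PI / 12)) by (apply sin_ge_0; lra).
  assert (Hc : cos (PI / 6) = 1 - 2 * sin (PI / 12) * sin (PI / 12)).
  { rewrite <- cos_2a_sin; f_equal; field. }
  rewrite cos_PI6 in Hc.
  assert (H3 : sqrt 3 <= 1.7321).
  { rewrite <- (sqrt_square 1.7321) by lra; apply sqrt_le_1_alt; lra. }
  nra.
Qed.

(** * Accuracy and cost *)

Lemma Rceil_nat_bounds x : 0 < x -> x <= INR (Z.to_nat (Rceil x)) < x + 1.
Proof.
  intros Hx; unfold Rceil; destruct (archimed (- x)) as [H1 H2].
  assert (Hz : (0 <= 1 - up (- x))%Z).
  { apply Z.lt_pred_le, lt_IZR; rewrite <- Z.sub_1_r, minus_IZR, minus_IZR; lra. }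
  rewrite INR_IZR_INZ, Z2Nat.id, minus_IZR by exact Hz; lra.
Qed.

Lemma exp_pow_le k x a : exp x <= a -> exp (INR k * x) <= a ^ k.
Proof.
  intros H; rewrite <- (Rpower_pow k a) by (pose proof (exp_pos x); lra); unfold Rpower.
  apply exp_le, Rmult_le_compat_l; [apply pos_INR |].
  rewrite <- (ln_exp x); apply ln_le; [apply exp_pos | exact H].
Qed.

Lemma le_ln_of_exp x y : exp x <= y -> x <= ln y.
Proof. intros H; rewrite <- (ln_exp x); apply ln_le; [apply exp_pos | exact H]. Qed.

(** As 160 = 8/0.05, this is the bound L > 5 for every admissible delta. *)
Lemma ln_160 : 5 < ln 160.
Proof.
  apply Rle_lt_trans with (ln 155); [| apply ln_increasing; lra].
  apply le_ln_of_exp; pose proof (exp_pow_le 5 1 _ exp_1_le) as H.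
  replace (INR 5 * 1) with 5 in H by (simpl; ring); lra.
Qed.

Lemma ln_2PI_ge : 1.5 <= ln (2 * PI).
Proof.
  pose proof PI_ge_3_1 as Hpi; assert (H : 3 <= ln (2 * PI * (2 * PI))).
  { apply le_ln_of_exp; pose proof (exp_pow_le 3 1 _ exp_1_le) as H1.
    replace (INR 3 * 1) with 3 in H1 by (simpl; ring).
    assert (6.2 * 6.2 <= 2 * PI * (2 * PI)) by (apply Rmult_le_compat; lra); lra. }
  rewrite ln_mult in H by lra; lra.
Qed.

(** The origin of the factor 1.11 in N: 2 pi 1.11^2 >= e^2. *)
Lemma two_le_ln_2PI : 2 <= ln (2 * PI) + ln 1.2321.
Proof.
  pose proof PI_ge_3_1; rewrite <- ln_mult by lra; apply le_ln_of_exp.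
  pose proof (exp_pow_le 2 1 _ exp_1_le) as H1.
  replace (INR 2 * 1) with 2 in H1 by (simpl; ring); lra.
Qed.

Lemma Cpow_RtoC_inv x w : 0 < x -> Cpow (RtoC (/ x)) (Copp w) = Cpow (RtoC x) w.
Proof.
  intros Hx; assert (Hi : 0 < / x) by (apply Rinv_0_lt_compat, Hx).
  rewrite !Cpow_exp by (apply RtoC_neq0; lra); rewrite !Clog_RtoC by assumption.
  rewrite ln_Rinv, RtoC_opp by exact Hx; f_equal; ring.
Qed.

Lemma Rmax_half_bounds sigma : 0 <= sigma <= 2 -> 0 <= Rmax ((1 - sigma) / 2) 0 <= / 2.
Proof. intros H; split; [apply Rmax_r | apply Rmax_lub; lra]. Qed.

Section Estimates.
Variables (sigma tau : R) (n : nat).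
Let v := INR (S n).
Let b := v + 1 - sigma.
Let rho := 1 + (1 / 2 + tau) / v.
Let N := 1.11 * sqrt rho.
Let c := Rmax ((1 - sigma) / 2) 0.
(** The common unit of all error bounds. It is the exponential of minus the left side of the
    equation for x_0, taken at v. *)
Let X := exp (- v + c * ln (1 / 2 + v + tau)).
Hypothesis Hsigma : 0 <= sigma <= 2.
Hypothesis Htau : 0 <= tau.
Hypothesis Hv : 6 <= v.

Lemma rho_ge1 : 1 <= rho.
Proof. unfold rho; assert (0 <= (1 / 2 + tau) / v) by (apply Rdiv_le_0_compat; lra); lra. Qed.

Lemma ln_rho_bounds : 0 <= ln rho <= ln (1 / 2 + v + tau).
Proof.
  pose proof rho_ge1; split; [rewrite <- ln_1; apply ln_le; lra |].
  apply ln_le; [lra |]; unfold rho.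
  assert ((1 / 2 + tau) / v <= 1 / 2 + tau); [| lra].
  apply (Rmult_le_reg_r v); [lra |]; unfold Rdiv; rewrite Rmult_assoc, Rinv_l by lra; nra.
Qed.

Lemma N_ge : 1.11 <= N.
Proof.
  pose proof rho_ge1; assert (1 <= sqrt rho) by (rewrite <- sqrt_1; apply sqrt_le_1_alt; lra).
  unfold N; lra.
Qed.

Lemma ln_N_eq : 2 * ln N = ln 1.2321 + ln rho.
Proof.
  pose proof rho_ge1; pose proof N_ge.
  replace (2 * ln N) with (ln N + ln N) by ring; rewrite <- !ln_mult by lra; f_equal.
  unfold N; replace (1.11 * sqrt rho * (1.11 * sqrt rho)) with (1.11 * 1.11 * (sqrt rho * sqrt rho)) by ring.
  rewrite sqrt_sqrt by lra; lra.
Qed.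

Lemma ln_12321_ge0 : 0 <= ln 1.2321.
Proof. rewrite <- ln_1; apply ln_le; lra. Qed.

Lemma c_cases : (sigma <= 1 /\ c = (1 - sigma) / 2) \/ (1 < sigma /\ c = 0).
Proof.
  destruct (Rle_lt_dec sigma 1); [left | right]; (split; [assumption |]).
  - apply Rmax_left; lra.
  - apply Rmax_right; lra.
Qed.

Lemma c_bounds : 0 <= c <= / 2.
Proof. exact (Rmax_half_bounds sigma Hsigma). Qed.

(* For [sigma > 1] the ratio of [1 + tau / b] to [rho] exceeds [1], but its power stays bounded. *)
Lemma exponent_bound : (b - / 2) * ln (1 + tau / b) + b - b * ln (2 * PI) + (1 - b - v) * ln N
  <= - v + c * ln rho + ln (2 * PI) + ln 1.2321.
Proof.
  pose proof ln_2PI_ge as Hl; pose proof two_le_ln_2PI as H2; pose proof ln_12321_ge0 as Hh.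
  pose proof ln_rho_bounds as [Hr _]; pose proof ln_N_eq as HN; pose proof rho_ge1 as Hrho.
  assert (Hb : 5 <= b) by (unfold b; lra).
  set (l := ln (2 * PI)) in *; set (h := ln 1.2321) in *; set (r := ln rho) in *.
  assert (EN : (1 - b - v) * ln N = - ((v - sigma / 2) * (h + r))).
  { rewrite <- HN; unfold b; field. }
  rewrite EN.
  assert (Htb : 0 <= tau / b) by (apply Rdiv_le_0_compat; lra).
  (* The decisive gain: 2 pi 1.11^2 >= e^2, raised to the power v, turns the factor e^v into e^(-v).
     What remains is to compare the powers of 1 + tau/b and of [rho]. *)
  assert (Hvl : 0 <= v * (l + h - 2)) by (apply Rmult_le_pos; lra).
  destruct c_cases as [[Hs ->] | [Hs ->]].
  - assert (Hu : ln (1 + tau / b) <= r).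
    { apply ln_le; [lra |]; unfold rho; apply Rplus_le_compat_l.
      apply (Rmult_le_reg_r (b * v)); [apply Rmult_lt_0_compat; lra |].
      replace (tau / b * (b * v)) with (tau * v) by (field; lra).
      replace ((1 / 2 + tau) / v * (b * v)) with ((1 / 2 + tau) * b) by (field; lra).
      unfold b; nra. }
    pose proof (Rmult_le_compat_l (b - / 2) _ _ ltac:(lra) Hu) as H1.
    assert (H3 : 0 <= (1 - sigma) * (l - 1)) by (apply Rmult_le_pos; lra).
    assert (H4 : 0 <= (1 - sigma / 2) * h) by (apply Rmult_le_pos; lra).
    unfold b in *; nra.
  - assert (Hu : ln (1 + tau / b) <= r + (sigma - 1) / b).
    { assert (Hq : 0 < (1 + tau / b) / rho) by (apply Rdiv_lt_0_compat; lra).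
      pose proof (ln_le_sub1 _ Hq) as H1; unfold Rdiv at 1 in H1.
      rewrite ln_mult, ln_Rinv in H1 by (try apply Rinv_0_lt_compat; lra).
      assert (H3 : (1 + tau / b) / rho <= 1 + (sigma - 1) / b); [| unfold r; lra].
      apply (Rmult_le_reg_r rho); [lra |].
      unfold Rdiv at 1; rewrite Rmult_assoc, Rinv_l, Rmult_1_r by lra.
      replace (1 + (sigma - 1) / b) with (v / b) by (unfold b in *; field; lra).
      unfold rho; apply (Rmult_le_reg_r b); [lra |].
      replace ((1 + tau / b) * b) with (b + tau) by (field; lra).
      replace (v / b * (1 + (1 / 2 + tau) / v) * b) with (v + (1 / 2 + tau)) by (field; lra).
      unfold b; lra. }
    pose proof (Rmult_le_compat_l (b - / 2) _ _ ltac:(lra) Hu) as H1.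
    assert (H5 : (b - / 2) * ((sigma - 1) / b) <= sigma - 1).
    { replace ((b - / 2) * ((sigma - 1) / b)) with ((sigma - 1) - (sigma - 1) / b / 2) by (field; lra).
      assert (0 <= (sigma - 1) / b) by (apply Rdiv_le_0_compat; lra); lra. }
    assert (H3 : 0 <= (2 - sigma) * l) by (apply Rmult_le_pos; lra).
    assert (H4 : 0 <= (1 - sigma / 2) * h) by (apply Rmult_le_pos; lra).
    assert (H6 : 0 <= (sigma - 1) * r) by (apply Rmult_le_pos; lra).
    unfold b in *; nra.
Qed.

Lemma X_ge : exp (- v + c * ln rho) <= X.
Proof.
  apply exp_le; pose proof ln_rho_bounds; pose proof c_bounds.
  assert (c * ln rho <= c * ln (1 / 2 + v + tau)) by (apply Rmult_le_compat_l; lra); lra.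
Qed.

Lemma exp_neg_v_le_X : exp (- v) <= X.
Proof.
  eapply Rle_trans; [| apply X_ge]; apply exp_le.
  pose proof ln_rho_bounds; pose proof c_bounds.
  assert (0 <= c * ln rho) by (apply Rmult_le_pos; lra); lra.
Qed.

Lemma alpha_pow : (/ N) ^ S n = exp (- (v * ln N)).
Proof.
  pose proof N_ge; rewrite <- Rpower_pow by (apply Rinv_0_lt_compat; lra); unfold Rpower.
  rewrite ln_Rinv by lra; f_equal; unfold v; ring.
Qed.

Lemma Cgamma_b_le : Cnorm (Cgamma (RtoC b)) <= INR (fact (S n)).
Proof.
  apply Cgamma_real_le_fact; unfold b, v in *; rewrite ?S_INR in *; [| lra].
  apply INR_lt; simpl; lra.
Qed.

(** The negative nodes beyond M. The factor v! bounding Gamma(b) cancels, [exponent_bound] controls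
    the rest, and 1/(b-1) <= 1/4 with pi <= 4 gives 2 pi 1.2321/4 <= 2.5. *)
Lemma main_part_bound M : 0 < tau -> N <= INR M ->
  Cnorm (Cgamma (b, - tau)) * (exp (- (b * ln (2 * PI))) *
    (exp (PI / 2 * tau) * (exp ((1 - b) * ln (INR M)) / (b - 1)))) * ((/ N) ^ S n / INR (fact (S n)))
  <= 2.5 * X.
Proof.
  intros Ht HM; assert (Hb : 5 <= b) by (unfold b; lra).
  pose proof N_ge as HN; pose proof (INR_fact_lt_0 (S n)) as Hf.
  set (F := INR (fact (S n))) in *; set (u := (b - / 2) * ln (1 + tau / b) + b).
  assert (HG : Cnorm (Cgamma (b, - tau)) * exp (PI / 2 * tau) <= F * exp u).
  { eapply Rle_trans; [apply Cgamma_norm_le; lra |].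
    apply Rmult_le_compat_r; [left; apply exp_pos | apply Cgamma_b_le]. }
  assert (HMN : exp ((1 - b) * ln (INR M)) <= exp ((1 - b) * ln N)).
  { apply exp_le; assert (ln N <= ln (INR M)) by (apply ln_le; lra); nra. }
  assert (Hi : / (b - 1) <= / 4) by (apply Rinv_le_contravar; unfold b; lra).
  assert (Hi0 : 0 < / (b - 1)) by (apply Rinv_0_lt_compat; lra).
  rewrite alpha_pow; set (e1 := exp (- (b * ln (2 * PI)))); set (e2 := exp (- (v * ln N))).
  set (e3 := exp ((1 - b) * ln (INR M))) in *.
  assert (He : 0 < e1 * e2) by (apply Rmult_lt_0_compat; apply exp_pos).
  assert (He3 : 0 < e3) by apply exp_pos.
  apply Rle_trans with ((F * exp u) * (exp ((1 - b) * ln N) * / 4) * (e1 * e2 / F)).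
  - replace (Cnorm (Cgamma (b, - tau)) * (e1 * (exp (PI / 2 * tau) * (e3 / (b - 1)))) * (e2 / F)) with
      ((Cnorm (Cgamma (b, - tau)) * exp (PI / 2 * tau)) * (e3 * / (b - 1)) * (e1 * e2 / F))
      by (field; lra).
    apply Rmult_le_compat_r; [left; apply Rdiv_lt_0_compat; lra |].
    apply Rmult_le_compat; [| nra | exact HG | apply Rmult_le_compat; lra].
    apply Rmult_le_pos; [apply Cnorm_ge0 | left; apply exp_pos].
  - replace (F * exp u * (exp ((1 - b) * ln N) * / 4) * (e1 * e2 / F)) with
      (/ 4 * (exp u * exp ((1 - b) * ln N) * e1 * e2)) by (field; lra).
    unfold e1, e2; rewrite <- !exp_plus.
    apply Rle_trans with (/ 4 * (exp (- v + c * ln rho) * (2 * PI * 1.2321))).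
    + apply Rmult_le_compat_l; [lra |].
      pose proof PI_RGT_0; rewrite <- (exp_ln (2 * PI * 1.2321)), (ln_mult (2 * PI) 1.2321), <- exp_plus by lra.
      apply exp_le; pose proof exponent_bound; unfold u; lra.
    + pose proof X_ge; pose proof PI_4; pose proof PI_RGT_0.
      pose proof (exp_pos (- v + c * ln rho)); nra.
Qed.

(** The positive nodes. Without e^(pi tau/2) the trivial bound |Gamma(b - i tau)| <= v! suffices,
    because (2 pi)^(-b) <= e^(-1.5 (v-1)) <= e^(-v). The constant is 1 + 1/(b-1) <= 1.25. *)
Lemma small_part_bound :
  Cnorm (Cgamma (b, - tau)) * (exp (- (b * ln (2 * PI))) * (1 + / (b - 1))) *
    ((/ N) ^ S n / INR (fact (S n))) <= 1.25 * X.
Proof.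
  assert (Hb : 5 <= b) by (unfold b; lra).
  pose proof N_ge as HN; pose proof (INR_fact_lt_0 (S n)) as Hf.
  set (F := INR (fact (S n))) in *.
  assert (HG : Cnorm (Cgamma (b, - tau)) <= F).
  { eapply Rle_trans; [apply Cgamma_norm_le_real; lra | apply Cgamma_b_le]. }
  assert (Hi : / (b - 1) <= / 4) by (apply Rinv_le_contravar; lra).
  assert (Hi0 : 0 < / (b - 1)) by (apply Rinv_0_lt_compat; lra).
  rewrite alpha_pow; set (e1 := exp (- (b * ln (2 * PI)))); set (e2 := exp (- (v * ln N))).
  assert (He1 : 0 < e1) by apply exp_pos; assert (He2 : 0 < e2) by apply exp_pos.
  assert (He : e1 * e2 <= X).
  { eapply Rle_trans; [| apply exp_neg_v_le_X]; unfold e1, e2; rewrite <- exp_plus; apply exp_le.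
    pose proof ln_2PI_ge; assert (0 <= ln N) by (rewrite <- ln_1; apply ln_le; lra).
    assert (0 <= v * ln N) by (apply Rmult_le_pos; lra).
    assert ((v - 1) * 1.5 <= b * ln (2 * PI)) by (apply Rmult_le_compat; unfold b; lra); lra. }
  replace (Cnorm (Cgamma (b, - tau)) * (e1 * (1 + / (b - 1))) * (e2 / F)) with
    (Cnorm (Cgamma (b, - tau)) / F * ((1 + / (b - 1)) * (e1 * e2))) by (field; lra).
  assert (HGF : 0 <= Cnorm (Cgamma (b, - tau)) / F <= 1).
  { split; [apply Rdiv_le_0_compat; [apply Cnorm_ge0 | exact Hf] |].
    apply (Rmult_le_reg_r F); [exact Hf |]; unfold Rdiv; rewrite Rmult_assoc, Rinv_l by lra; lra. }
  assert (H0 : 0 <= (1 + / (b - 1)) * (e1 * e2)) by (apply Rmult_le_pos; [lra | apply Rmult_le_pos; lra]).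
  apply Rle_trans with (1 * ((1 + / (b - 1)) * (e1 * e2))); [apply Rmult_le_compat_r; lra |].
  rewrite Rmult_1_l; apply Rmult_le_compat; [lra | apply Rmult_le_pos; lra | lra | exact He].
Qed.

(** N^(1-sigma) is at most (1.2321 [rho])^c and c <= 1/2 < 1, so 1.2321/2.151 <= 0.6 suffices. *)
Lemma Dsum_tail_bound : exp ((1 - sigma) * ln N) * exp (- v) / 2.151 <= 0.6 * X.
Proof.
  pose proof ln_N_eq as HN; pose proof ln_12321_ge0 as Hh; pose proof ln_rho_bounds as [Hr _].
  rewrite <- exp_plus.
  apply Rle_trans with (exp (- v + c * ln rho) * 1.2321 / 2.151).
  - unfold Rdiv; apply Rmult_le_compat_r; [lra |].
    rewrite <- (exp_ln 1.2321), <- exp_plus by lra; apply exp_le.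
    destruct c_cases as [[Hs ->] | [Hs ->]].
    + replace ((1 - sigma) * ln N) with ((1 - sigma) / 2 * (ln 1.2321 + ln rho)) by (rewrite <- HN; field).
      nra.
    + assert (0 <= (sigma - 1) * ln N) by (apply Rmult_le_pos; lra); lra.
  - pose proof X_ge; pose proof (exp_pos (- v + c * ln rho)); lra.
Qed.

Lemma zpar_eq : zpar (sigma, tau) n = (b, - tau).
Proof. apply Ceq; unfold zpar, Csub, Cadd, Copp, RtoC, b, v; cbn [fst snd]; ring. Qed.

Lemma Gterm_eq : Csub C1 (sigma, tau) <> C0 -> Gterm (sigma, tau) (S n) N = gterm (sigma, tau) n (/ N).
Proof.
  intros Ha; pose proof N_ge; unfold Gterm, gterm; cbv zeta.
  rewrite Cgamma_INR_S; fold (zpar (sigma, tau) n); f_equal.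
  symmetry; apply Cpow_RtoC_inv; lra.
Qed.

Lemma Dsum_eq K : Dsum (sigma, tau) (S n) N K = Csum (qterm (sigma, tau) (S n) (/ N)) K.
Proof. reflexivity. Qed.

Lemma E1M_eq M : E1M (sigma, tau) (S n) N M = e1_total (sigma, tau) (S n) M (/ N).
Proof.
  pose proof N_ge; unfold E1M, e1_total; cbv zeta; unfold e1_pref; f_equal.
  apply Csum_ext; intros k _; apply E1m_e1; lra.
Qed.

(** The budget is 2.5 for negative nodes beyond M, 1.25 for positive nodes and 0.6 for the
    truncation of D. *)
Lemma accuracy_complex M K : 0 < tau -> N <= INR M -> 3.151 * v * N <= INR K ->
  Cnorm (Csub (zeta (sigma, tau)) (Csub (Cadd (Dsum (sigma, tau) (S n) N K)
    (E1M (sigma, tau) (S n) N M)) (Gterm (sigma, tau) (S n) N))) <= 4.35 * X.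
Proof.
  intros Ht HM HK; set (s := (sigma, tau) : Cplx).
  assert (Hb : 5 <= b) by (unfold b; lra).
  pose proof N_ge as HN; assert (HiN : 0 < / N) by (apply Rinv_0_lt_compat; lra).
  assert (Hnp : not_pole (Csub C1 s)).
  { intros k E; apply (f_equal snd) in E; unfold Csub, Cadd, Copp, RtoC, s in E; simpl in E; lra. }
  assert (Ha : Csub C1 s <> C0).
  { intros E; apply (Hnp 0%nat); rewrite E; simpl INR; ring. }
  assert (HM1 : (1 <= M)%nat) by (apply INR_le; simpl; lra).
  unfold s; rewrite Gterm_eq, E1M_eq, Dsum_eq by exact Ha; fold s.
  destruct (qterm_series_cv s (S n) (/ N) HiN) as [D HD].
  pose proof (Dsum_tail s n N K D ltac:(unfold s; simpl; lra) ltac:(lra) HK HD) as H1.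
  change (fst s) with sigma in H1; fold v in H1; pose proof Dsum_tail_bound as H2.
  pose proof (zeta_increment s n M _ _ (e1_total s (S n) M) ltac:(unfold s; simpl; lra) Ha
    ltac:(unfold s; rewrite zpar_eq; simpl; lra)
    ltac:(intros t k Htt Hk; unfold s; rewrite zpar_eq; apply pair_tail_bound; lra || lia)
    ltac:(intros t k Htt; unfold s; rewrite zpar_eq; apply pair_sum_bound; lra)
    (fun t Htt => Cderiv_e1_total s n M t Htt Hnp) (e1_total_cv0 s n M) (/ N) D HiN HD) as H3.
  unfold s in H3; rewrite zpar_eq in H3; fold s in H3.
  pose proof (main_part_bound M Ht HM) as H4; pose proof small_part_bound as H5.
  rewrite !Rmult_plus_distr_l, Rmult_plus_distr_r in H3.
  set (T := e1_total s (S n) M (/ N)) in *; set (G := gterm s n (/ N)) in *.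
  set (DK := Csum (qterm s (S n) (/ N)) K) in *.
  replace (Csub (zeta s) (Csub (Cadd DK T) G)) with
    (Cadd (Csub (zeta s) (Cadd (Csub D G) T)) (Csub D DK)) by ring.
  eapply Rle_trans; [apply Cnorm_add |]; rewrite Cnorm_sub_sym.
  rewrite Rmult_plus_distr_l in H5; lra.
Qed.

(** At tau = 0 the factor e^(pi tau/2) is 1, so both families of nodes obey the small bound and no
    correction is made: 2 times 1.25 plus 0.6 stays below 4.35. *)
Lemma accuracy_real K : tau = 0 -> sigma <> 1 -> 3.151 * v * N <= INR K ->
  Cnorm (Csub (zeta (sigma, tau)) (Csub (Dsum (sigma, tau) (S n) N K) (Gterm (sigma, tau) (S n) N)))
  <= 4.35 * X.
Proof.
  intros Ht Hs1 HK; set (s := (sigma, tau) : Cplx).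
  assert (Hb : 5 <= b) by (unfold b; lra).
  pose proof N_ge as HN; assert (HiN : 0 < / N) by (apply Rinv_0_lt_compat; lra).
  assert (Ha : Csub C1 s <> C0).
  { intros E; apply (f_equal fst) in E; unfold Csub, Cadd, Copp, RtoC, s in E; simpl in E; lra. }
  unfold s; rewrite Gterm_eq, Dsum_eq by exact Ha; fold s.
  destruct (qterm_series_cv s (S n) (/ N) HiN) as [D HD].
  pose proof (Dsum_tail s n N K D ltac:(unfold s; simpl; lra) ltac:(lra) HK HD) as H1.
  change (fst s) with sigma in H1; fold v in H1; pose proof Dsum_tail_bound as H2.
  assert (HW : forall t k, 0 < t -> Cnorm (Csum (pair_term (zpar s n) t) k) <=
    exp (- (b * ln (2 * PI))) * ((exp (PI / 2 * tau) + 1) * (1 + / (b - 1)))).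
  { intros t k Htt; unfold s; rewrite zpar_eq; apply pair_sum_bound; lra. }
  assert (HE : forall t, 0 < t -> Cderiv (fun _ => C0) t (Cmul (RtoC (t ^ n / INR (fact n)))
    (Cmul (Cgamma (zpar s n)) (neg_terms (zpar s n) 0 t)))).
  { intros t _; eapply Cderiv_eq; [apply Cderiv_const | unfold neg_terms; rewrite Csum_0; ring]. }
  pose proof (zeta_increment s n 0 _ _ (fun _ => C0) ltac:(unfold s; simpl; lra) Ha
    ltac:(unfold s; rewrite zpar_eq; simpl; lra)
    ltac:(intros t k Htt _; unfold neg_terms; rewrite Csum_0;
      replace (Csub (Csum (pair_term (zpar s n) t) k) C0) with (Csum (pair_term (zpar s n) t) k) by ring;
      apply HW, Htt) HW HE (fun _ _ => C_cv_const C0) (/ N) D HiN HD) as H3.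
  cbv beta in H3; unfold s in H3; rewrite zpar_eq in H3; fold s in H3.
  pose proof small_part_bound as H5.
  assert (HP : exp (PI / 2 * tau) = 1) by (rewrite Ht, Rmult_0_r; apply exp_0).
  rewrite HP in H3.
  set (G := gterm s n (/ N)) in *; set (DK := Csum (qterm s (S n) (/ N)) K) in *.
  replace (Csub (zeta s) (Csub DK G)) with
    (Cadd (Csub (zeta s) (Cadd (Csub D G) C0)) (Csub D DK)) by ring.
  eapply Rle_trans; [apply Cnorm_add |]; rewrite Cnorm_sub_sym.
  pose proof (exp_pos (- v + c * ln (1 / 2 + v + tau))) as HX; fold X in HX; lra.
Qed.

(** Since v + 1/2 <= tau, v^2 [rho] <= 2 v tau, hence vN <= 1.11 sqrt(2 v tau) <= 1.571 q with q =
    sqrt(v tau). With N <= vN/6 and v <= q, the count 4.151 vN + N + v + 2 is below 8q + 2. *)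
Lemma count_bound M K S0 : INR M <= N + 1 -> INR K <= 3.151 * v * N + 1 -> v + / 2 <= tau ->
  v <= S0 -> INR (K + (S n + 1) * M) <= 2 + 8 * sqrt S0 * sqrt tau.
Proof.
  intros HM HK Hvt HS; rewrite plus_INR, mult_INR, plus_INR; fold v; simpl (INR 1).
  set (q := sqrt (v * tau)).
  assert (Hqq : q * q = v * tau) by (apply sqrt_sqrt; nra).
  assert (Hq0 : 0 <= q) by apply sqrt_pos.
  assert (Hvq : v <= q) by nra.
  assert (HqS : q <= sqrt S0 * sqrt tau).
  { unfold q; rewrite <- sqrt_mult by lra; apply sqrt_le_1_alt; nra. }
  assert (HvN : v * N <= 1.571 * q).
  { pose proof rho_ge1; assert (Hsr : sqrt rho * sqrt rho = rho) by (apply sqrt_sqrt; lra).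
    pose proof (sqrt_pos rho) as Hs0.
    assert (Hvr : v * v * rho <= 2 * (v * tau)).
    { unfold rho; replace (v * v * (1 + (1 / 2 + tau) / v)) with (v * (v + (1 / 2 + tau))) by (field; lra).
      nra. }
    apply Rsqr_incr_0_var; [| lra].
    unfold N, Rsqr; replace (v * (1.11 * sqrt rho) * (v * (1.11 * sqrt rho))) with
      (1.11 * 1.11 * (v * v * (sqrt rho * sqrt rho))) by ring.
    rewrite Hsr; replace (1.571 * q * (1.571 * q)) with (1.571 * 1.571 * (q * q)) by ring.
    assert (0 <= v * tau) by (apply Rmult_le_pos; lra).
    rewrite Hqq; lra. }
  assert (HN6 : 6 * N <= v * N) by (apply Rmult_le_compat_r; [pose proof N_ge; lra | lra]).
  assert (HvM : (v + 1) * INR M <= (v + 1) * (N + 1)) by (apply Rmult_le_compat_l; lra).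
  lra.
Qed.
End Estimates.

(** * The equation defining x_0 *)

Lemma ln_shift_increment c tau x y : 0 <= c <= / 2 -> 0 <= tau -> 0 < x -> x < y ->
  c * ln (1 / 2 + y + tau) - c * ln (1 / 2 + x + tau) < y - x.
Proof.
  intros Hc Ht Hx Hxy; set (p := 1 / 2 + x + tau); set (q := 1 / 2 + y + tau).
  assert (Hp : / 2 < p) by (unfold p; lra).
  assert (Hqp : q - p = y - x) by (unfold p, q; lra).
  pose proof (ln_le_sub1 (q / p) ltac:(apply Rdiv_lt_0_compat; lra)) as H.
  unfold Rdiv in H at 1; rewrite ln_mult, ln_Rinv in H by (try apply Rinv_0_lt_compat; lra).
  assert (H1 : (q / p - 1) * p = y - x) by (rewrite <- Hqp; field; lra).
  assert (Hd : 0 < q / p - 1) by (apply (Rmult_lt_reg_r p); lra).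
  apply (Rmult_le_compat_l c) in H; [| lra].
  assert (c * (q / p - 1) <= / 2 * (q / p - 1)) by (apply Rmult_le_compat_r; lra).
  assert (/ 2 * (q / p - 1) < p * (q / p - 1)) by (apply Rmult_lt_compat_r; lra).
  lra.
Qed.

Lemma root_exists c tau L : 0 <= c <= / 2 -> 0 <= tau -> 5 <= L ->
  exists x, 0 < x /\ x - c * ln (1 / 2 + x + tau) = L.
Proof.
  intros Hc Ht HL; set (f := fun x => x - c * ln (1 / 2 + x + tau) - L).
  (* With c <= 1/2 and ln y <= y - 1, the logarithmic term at B is at most (B + tau - 1/2)/2, so the
     left side already exceeds L there. *)
  set (B := 2 * L + tau + 1).
  destruct (Ranalysis5.IVT_interv f 1 B) as [x [Hx Hfx]].
  - intros a Ha; apply derivable_continuous_pt, ex_derive_Reals_0.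
    unfold f; auto_derive; lra.
  - unfold B; lra.
  - unfold f; assert (0 <= ln (1 / 2 + 1 + tau)) by (rewrite <- ln_1; apply ln_le; lra).
    assert (0 <= c * ln (1 / 2 + 1 + tau)) by (apply Rmult_le_pos; lra); lra.
  - unfold f; pose proof (ln_le_sub1 (1 / 2 + B + tau) ltac:(unfold B; lra)) as H.
    assert (H0 : 0 <= ln (1 / 2 + B + tau)) by (rewrite <- ln_1; apply ln_le; unfold B; lra).
    assert (c * ln (1 / 2 + B + tau) <= / 2 * ln (1 / 2 + B + tau)) by (apply Rmult_le_compat_r; lra).
    unfold B in *; lra.
  - exists x; unfold f in Hfx; split; lra.
Qed.

Lemma root_unique c tau L x y : 0 <= c <= / 2 -> 0 <= tau -> 0 < x -> 0 < y ->
  x - c * ln (1 / 2 + x + tau) = L -> y - c * ln (1 / 2 + y + tau) = L -> x = y.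
Proof.
  intros Hc Ht Hx Hy Ex Ey; destruct (Rtotal_order x y) as [H | [H | H]]; [| exact H |].
  - pose proof (ln_shift_increment c tau x y Hc Ht Hx H); lra.
  - pose proof (ln_shift_increment c tau y x Hc Ht Hy H); lra.
Qed.

(** In two rounds: the logarithm is at least -ln 2 >= -1, so x >= L - 1/2 > 4.5. Hence the logarithm
    is non-negative, and x >= L > 5. *)
Lemma root_gt c tau L x : 0 <= c <= / 2 -> 0 <= tau -> 5 < L -> 0 < x ->
  x - c * ln (1 / 2 + x + tau) = L -> 5 < x.
Proof.
  intros Hc Ht HL Hx E.
  assert (Hl : ln (/ 2) <= ln (1 / 2 + x + tau)) by (apply ln_le; lra).
  pose proof (ln_le_sub1 2 ltac:(lra)) as H2; rewrite ln_Rinv in Hl by lra.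
  assert (Hcl : c * (- (1)) <= c * ln (1 / 2 + x + tau)) by (apply Rmult_le_compat_l; lra).
  assert (0 <= ln (1 / 2 + x + tau)) by (rewrite <- ln_1; apply ln_le; lra).
  assert (0 <= c * ln (1 / 2 + x + tau)) by (apply Rmult_le_pos; lra); lra.
Qed.

(** As ln(2 tau) <= 0.8 tau, the candidate bound x1 is at most L + 0.4 tau, and the condition on tau
    is exactly L + 0.4 tau + 3/2 < tau. Then 1/2 + x1 + tau <= 2 tau, so at x1 the left side of the
    equation is at least L, and monotonicity gives x <= x1. *)
Lemma root_le c tau L x : 0 <= c <= / 2 -> 5 <= L -> tau > 5 / 3 * (3 / 2 + L) -> 0 < x ->
  x - c * ln (1 / 2 + x + tau) = L -> x <= L + c * ln (2 * tau) /\ x + 1 + / 2 <= tau.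
Proof.
  intros Hc HL Ht Hx E.
  assert (Hln : 0 <= ln (2 * tau) <= 0.8 * tau).
  { split; [rewrite <- ln_1; apply ln_le; lra |].
    pose proof (ln_le_sub1 (2 * tau / 4) ltac:(lra)) as H.
    replace (2 * tau) with (2 * 2 * (2 * tau / 4)) by field.
    pose proof (ln_le_sub1 2 ltac:(lra)) as H2.
    rewrite !ln_mult by lra; lra. }
  assert (Hcl : 0 <= c * ln (2 * tau) <= / 2 * ln (2 * tau)).
  { split; [apply Rmult_le_pos | apply Rmult_le_compat_r]; lra. }
  set (x1 := L + c * ln (2 * tau)).
  assert (Hx1 : x <= x1).
  { apply Rnot_lt_le; intros Hlt.
    assert (0 < x1) by (unfold x1; lra).
    pose proof (ln_shift_increment c tau x1 x Hc ltac:(lra) H Hlt) as H1.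
    assert (Hle : ln (1 / 2 + x1 + tau) <= ln (2 * tau)) by (apply ln_le; unfold x1 in *; lra).
    apply (Rmult_le_compat_l c) in Hle; [| lra]; unfold x1 in *; lra. }
  split; [exact Hx1 | unfold x1 in *; lra].
Qed.

Theorem theorem2 (sigma tau delta : R)
  (Hsigma : 0 <= sigma <= 2) (Htau : 0 <= tau)
  (Hs1 : tau > 0 \/ sigma <> 1)
  (Hdelta : 0 < delta <= 0.05) :
  let c := Rmax ((1 - sigma) / 2) 0 in
  let L := ln (8 / delta) in
  let s : Cplx := (sigma, tau) in
  (exists! x0 : R, 0 < x0 /\ x0 - c * ln (1/2 + x0 + tau) = L) /\
  forall x0 : R, 0 < x0 -> x0 - c * ln (1/2 + x0 + tau) = L ->
    x0 > 5 /\
    let v : nat := Z.to_nat (Rceil x0) in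
    let N : R := 1.11 * sqrt (1 + (1/2 + tau) / INR v) in
    let M : nat := Z.to_nat (Rceil N) in
    let lambda : R := 3.151 in
    let K : nat := Z.to_nat (Rceil (lambda * INR v * N)) in
    (tau > 0 ->
       Cnorm (Csub (zeta s) (Csub (Cadd (Dsum s v N K) (E1M s v N M)) (Gterm s v N)))
         < delta /\
       (tau > 5/3 * (3/2 + L) ->
          INR (K + (v + 1) * M) <=
            2 + 8 * sqrt (1 + L + c * ln (2 * tau)) * sqrt tau)) /\
    (tau = 0 ->
       Cnorm (Csub (zeta s) (Csub (Dsum s v N K) (Gterm s v N))) < delta).
Proof.
  intros c L s.
  pose proof (Rmax_half_bounds sigma Hsigma) as Hc; fold c in Hc.
  assert (H160 : 160 <= 8 / delta).
  { apply (Rmult_le_reg_r delta); [lra |]; unfold Rdiv; rewrite Rmult_assoc, Rinv_l by lra; lra. }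
  assert (HL : 5 < L).
  { apply Rlt_le_trans with (ln 160); [exact ln_160 | apply ln_le; lra]. }
  split.
  { destruct (root_exists c tau L Hc Htau ltac:(lra)) as [x [Hx E]].
    exists x; split; [split; assumption |].
    intros y [Hy Ey]; apply (root_unique c tau L); assumption. }
  intros x0 Hx0 E.
  assert (Hx5 : 5 < x0) by (apply (root_gt c tau L); assumption).
  split; [exact Hx5 |].
  intros v N M lambda K.
  pose proof (Rceil_nat_bounds x0 Hx0) as Hv; fold v in Hv.
  assert (Hv6 : (6 <= v)%nat).
  { apply INR_lt with (n := 5%nat); simpl; lra. }
  (* From here v is [S n], as in the estimates, whose requirement v >= 6 comes from rounding up x_0
     > 5. *)
  clearbody v; destruct v as [| n]; [lia |].
  assert (Hv6' : 6 <= INR (S n)) by (replace 6 with (INR 6) by (simpl; ring); apply le_INR, Hv6).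
  pose proof (N_ge tau n Htau Hv6') as HN; fold N in HN.
  pose proof (Rceil_nat_bounds N ltac:(lra)) as HM; fold M in HM.
  pose proof (Rceil_nat_bounds (lambda * INR (S n) * N) ltac:(unfold lambda; nra)) as HK; fold K in HK.
  (* Since x - c ln(1/2 + x + tau) increases and v >= x_0, the exponent is at most -L. The unit X is
     thus at most delta/8. *)
  assert (HX : 4.35 * exp (- INR (S n) + c * ln (1 / 2 + INR (S n) + tau)) < delta).
  { assert (Hle : - INR (S n) + c * ln (1 / 2 + INR (S n) + tau) <= - L).
    { destruct (Req_dec x0 (INR (S n))) as [<- | Hne]; [lra |].
      pose proof (ln_shift_increment c tau x0 (INR (S n)) Hc Htau Hx0 ltac:(lra)); lra. }
    apply exp_le in Hle; rewrite exp_Ropp in Hle; unfold L in Hle.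
    rewrite exp_ln in Hle by lra.
    replace (/ (8 / delta)) with (delta / 8) in Hle by (field; lra); lra. }
  split.
  - intros Ht; split.
    + eapply Rle_lt_trans; [| exact HX].
      exact (accuracy_complex sigma tau n Hsigma Htau Hv6' M K Ht (proj1 HM) (proj1 HK)).
    + intros Hbig.
      destruct (root_le c tau L x0 Hc ltac:(lra) Hbig Hx0 E) as [H1 H2].
      (* The summand 1 under the square root of the bound absorbs the rounding v < x_0 + 1. *)
      apply (count_bound sigma tau n Hsigma Htau Hv6'); fold N; unfold lambda in *; lra.
  - intros Ht; eapply Rle_lt_trans; [| exact HX].
    apply (accuracy_real sigma tau n Hsigma Htau Hv6' K Ht); [| apply HK].
    destruct Hs1; [lra | assumption].
Qed.
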